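(* Let $(\mathcal{X},d,\mu)$ be a complete, separable, connected metric measure space with $\mu$ doubling and supporting a weak $(1,1)$-Poincaré inequality. Let $\Omega\Subset\Omega^*\subset\mathcal{X}$ be bounded open sets and let $u_0\in L^2(\Omega^* )\cap \mathrm{BV}(\Omega^* )$. Let $u:\Omega^*\times(0,\infty)\to\mathbb{R}$ be a global variational solution to the Cauchy-Dirichlet problem for the total variation flow with datum $u_0$. Then $u$ is a parabolic minimizer to the total variation flow; that is, for every $T>0$ one has $u\in L^1_w(0,T;\mathrm{BV}_{u_0}(\Omega))$, $\int_0^T\|Du(t)\|(\Omega^* )\,dt<\infty$, and $$\int_0^T\Big(\int_{\Omega^*}u\,\partial_t\varphi\,d\mu+\|Du(t)\|(\Omega^* )\Big)dt\le\int_0^T\|D(u+\varphi)(t)\|(\Omega^* )\,dt$$ for all Lipschitz functions $\varphi$ on $\Omega^*\times(0,T)$ with $\mathrm{supp}\,\varphi\Subset\Omega\times(0,T)$.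
   Context: **Space.** $(\mathcal{X},d)$ is complete, separable, connected, with a Borel measure $\mu$. Doubling: there is $c\ge1$ with $0<\mu(B_{2r}(x))\le c\,\mu(B_r(x))<\infty$ for all $x\in\mathcal{X}$, $r>0$. Weak $(1,1)$-Poincaré inequality: there are $c_P>0$, $\tau\ge1$ such that for all balls $B_\varrho(x_0)$, all $u\in L^1(\mathcal{X})$ and all upper gradients $g$ of $u$, the mean over $B_\varrho(x_0)$ of $|u-u_{\varrho,x_0}|$ is at most $c_P\varrho$ times the mean of $g$ over $B_{\tau\varrho}(x_0)$, where $u_{\varrho,x_0}$ is the mean of $u$ over $B_\varrho(x_0)$. A Borel $g\ge0$ is an upper gradient of $u$ if $|u(x)-u(y)|\le\int_\gamma g\,ds$ for every rectifiable curve $\gamma$ joining $x$ to $y$; a nonnegative measurable $g$ is a $1$-weak upper gradient if this holds for all curves outside a family of $1$-modulus zero; the minimal $1$-weak upper gradient $g_u$ is the one of smallest $L^1$-norm. **BV.** For open $A\subset\mathcal{X}$ and $u\in L^1_{\rm loc}(A)$, the total variation is $\|Du\|(A)=\inf\{\liminf_{i}\int_A g_{u_i}\,d\mu: u_i\in \mathrm{Lip}_{\rm loc}(A),\ u_i\to u \text{ in } L^1_{\rm loc}(A)\}$. $\mathrm{BV}(A)$ is the set of $u\in L^1(A)$ with $\|Du\|(A)<\infty$. **Derivations.** A derivation is a linear map $\mathfrak{d}:\mathrm{Lip}_c(\mathcal{X})\to L^0(\mathcal{X})$ (from compactly supported Lipschitz functions to measurable functions) with $\mathfrak{d}(fg)=f\mathfrak{d}(g)+g\mathfrak{d}(f)$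 for which there is a measurable $h$ with $|\mathfrak{d}(f)|(x)\le h(x)\,\mathrm{Lip}_a(f)(x)$ for $\mu$-a.e. $x$ and all $f$, where $\mathrm{Lip}_a(f)(x)=\lim_{r\searrow0}\sup_{y\in B_r(x),\,y\ne x}|f(x)-f(y)|/d(x,y)$. The smallest such $h$ is $|\mathfrak{d}|$. If $|\mathfrak d|\in L^1_{\rm loc}$, $\mathrm{div}(\mathfrak{d})\in L^\infty$ means there is a unique function $\mathrm{div}(\mathfrak{d})\in L^\infty(\mathcal{X})$ with $\int \mathfrak{d}(f)\,d\mu=-\int f\,\mathrm{div}(\mathfrak{d})\,d\mu$ for all $f\in\mathrm{Lip}_c(\mathcal{X})$. $\mathrm{Der}_b(\mathcal{X})$ is the set of derivations with $|\mathfrak{d}|\in L^\infty$ and $\mathrm{div}(\mathfrak{d})\in L^\infty$; $\mathrm{supp}(\mathfrak{d})$ is the support of $|\mathfrak{d}|$. **Weak parabolic space.** For open $A$ and $T>0$, $L^1_w(0,T;\mathrm{BV}(A))$ consists of all $v\in L^1(A\times(0,T))$ such that $v(t):=v(\cdot,t)\in\mathrm{BV}(A)$ for a.e. $t$; $t\mapsto\int_A v(t)\,\mathrm{div}(\mathfrak{d})\,d\mu$ is measurable for all $\mathfrak{d}\in\mathrm{Der}_b(\mathcal{X})$ with $\mathrm{supp}(\mathfrak{d})\Subset A$; and $\int_0^T\|Dv(t)\|(A)\,dt<\infty$. **Boundary values.** $\mathrm{BV}_{u_0}(\Omega)=\{u\in\mathrm{BV}(\Omega^* ): u=u_0 \text{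 a.e. on }\Omega^*\setminus\Omega\}$, and $L^1_w(0,T;\mathrm{BV}_{u_0}(\Omega))$ is the set of $v\in L^1_w(0,T;\mathrm{BV}(\Omega^* ))$ with $v(t)\in\mathrm{BV}_{u_0}(\Omega)$ for a.e. $t\in(0,T)$. Write $\Omega^*_T=\Omega^*\times(0,T)$. **Variational solution.** For $T\in(0,\infty)$, a map $u\in L^1_w(0,T;\mathrm{BV}_{u_0}(\Omega))\cap C^0([0,T];L^2(\Omega^* ))$ is a variational solution on $\Omega_T$ (with datum $u_0$) if $$\int_0^T\|Du(t)\|(\Omega^* )\,dt\le\int_0^T\Big[\int_{\Omega^*}\partial_tv(v-u)\,d\mu+\|Dv(t)\|(\Omega^* )\Big]dt-\tfrac12\|(v-u)(T)\|^2_{L^2(\Omega^* )}+\tfrac12\|v(0)-u_0\|^2_{L^2(\Omega^* )}$$ for every $v\in L^1_w(0,T;\mathrm{BV}_{u_0}(\Omega))$ with (weak) time derivative $\partial_tv\in L^2(\Omega^*_T)$ and $v(0)\in L^2(\Omega^* )$ (such $v$ lies in $C^0([0,T];L^2(\Omega^* ))$). A map $u:\Omega^*\times(0,\infty)\to\mathbb{R}$ is a global variational solution if for every $T\in(0,\infty)$ it lies in $L^1_w(0,T;\mathrm{BV}_{u_0}(\Omega))\cap C^0([0,T];L^2(\Omega^* ))$ and is a variational solution on $\Omega_T$. *)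

(* Defs.v *)
From HB Require Import structures.
From mathcomp Require Import all_boot all_order all_algebra.
From mathcomp Require Import all_classical all_reals all_analysis.
From mathcomp Require Import measurable_realfun ess_sup_inf.

Set Implicit Arguments.
Unset Strict Implicit.
Unset Printing Implicit Defensive.
Import Order.TTheory GRing.Theory Num.Theory.
Import numFieldNormedType.Exports.
Local Open Scope classical_set_scope.
Local Open Scope ring_scope.
Local Open Scope ereal_scope.

(* Measurable functions are thus Borel functions; elements of L^0 and L^p are
   handled through Borel representatives, with equalities stated a.e. *)
HB.mixin Record isBorelMetric d (R : realType) T
    & Measurable d T & Metric R T := {
  borelE : (measurable : set (set T)) = <<s open >>
}.

#[short(type="completeBorelMetricType")]
HB.structure Definition CompleteBorelMetric d (R : realType) :=
  {T of Measurable d T & Metric R T & Complete T & isBorelMetric d R T}.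

Definition separable_space (T : topologicalType) :=
  exists2 S : set T, countable S & dense S.

Definition compactly_contained (T : topologicalType) (A B : set T) :=
  compact (closure A) /\ closure A `<=` B.

Section lebesgue_spaces.
Context {d} {T : measurableType d} {R : realType}.
Variable mu : {measure set T -> \bar R}.

Definition Lpnorm (p : \bar R) (A : set T) (f : T -> R) : \bar R :=
  'N[mu]_p[EFin \o (f \_ A)].

Definition in_Lp (p : \bar R) (A : set T) (f : T -> R) :=
  measurable_fun A f /\ Lpnorm p A f < +oo.

Definition mean (A : set T) (f : T -> \bar R) : \bar R :=
  ((fine (mu A))^-1)%:E * \int[mu]_(x in A) f x.

End lebesgue_spaces.

Section metric_notions.
Context {R : realType} {X : metricType R}.

Definition metric_bounded (A : set X) := exists x r, A `<=` ball x r.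

Definition loc_lipschitz (A : set X) (u : X -> R) :=
  forall x, A x -> exists r L : R, (0 < r)%R /\
    forall y z, (A `&` ball x r) y -> (A `&` ball x r) z ->
      (`|u y - u z| <= L * mdist y z)%R.

Definition Lip_c (f : X -> R) :=
  (exists L : R, forall x y, (`|f x - f y| <= L * mdist x y)%R) /\
  compact (closure [set x | f x != 0%R]).

(* The adjoined 0 makes the supremum over an empty punctured ball equal 0. *)
Definition Lip_a (f : X -> R) (x : X) : \bar R :=
  lim (ereal_sup (0 |` [set (`|f x - f y| / mdist x y)%:E
                        | y in [set y | ball x r y /\ y != x]])
       @[r --> (0 : R)^'+]).

Record curve := Curve { cleft : R; cright : R; cmap :> R -> X }.

Definition curve_length (g : R -> X) (a b : R) : \bar R :=
  ereal_sup [set (\sum_(0 <= i < size s)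
                   mdist (g (nth b (a :: s) i)) (g (nth b (a :: s) i.+1)))%:E
            | s in itv_partition a b].

Definition clength (c : curve) := curve_length c (cleft c) (cright c).

Definition rectifiable (c : curve) :=
  [/\ (cleft c <= cright c)%R,
      {within `[cleft c, cright c], continuous c} &
      clength c < +oo].

Definition curve_in (A : set X) (c : curve) :=
  forall t, t \in `[cleft c, cright c] -> A (c t).

(* Arc-length parametrization, on [0, clength c]: any parameter at which the
   length run through equals s yields the same point of the curve. *)
Definition arc_param (c : curve) (s : R) : X :=
  c (xget (cleft c) [set t | t \in `[cleft c, cright c] /\
                             curve_length c (cleft c) t = s%:E]).

Definition line_integral (c : curve) (g : X -> \bar R) : \bar R :=
  \int[lebesgue_measure]_(s in `[0%R, fine (clength c)]) g (arc_param c s).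

End metric_notions.
Arguments curve {R} X.

Section total_variation.
Context {d} {R : realType} {X : completeBorelMetricType d R}.
Variable mu : {measure set X -> \bar R}.

Definition doubling :=
  exists2 c : R, (1 <= c)%R & forall (x : X) (r : R), (0 < r)%R ->
    [/\ 0 < mu (ball x (2 * r)%R),
        mu (ball x (2 * r)%R) <= c%:E * mu (ball x r) &
        c%:E * mu (ball x r) < +oo].

Definition upper_gradient_along (u : X -> R) (g : X -> \bar R) (c : curve X) :=
  `|u (c (cleft c)) - u (c (cright c))|%:E <= line_integral c g.

Definition upper_gradient (A : set X) (u : X -> R) (g : X -> \bar R) :=
  [/\ measurable_fun A g, (forall x, A x -> 0 <= g x) &
      forall c, rectifiable c -> curve_in A c -> upper_gradient_along u g c].

Definition poincare11 :=
  exists cP tau : R, [/\ (0 < cP)%R, (1 <= tau)%R &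
    forall (x0 : X) (rho : R) (u : X -> R) (g : X -> \bar R), (0 < rho)%R ->
      mu.-integrable setT (EFin \o u) -> upper_gradient setT u g ->
      let B := ball x0 rho in
      mean mu B (fun x => `|(u x)%:E - mean mu B (EFin \o u)|) <=
      (cP * rho)%:E * mean mu (ball x0 (tau * rho)%R) g].

(* Only the rectifiable curves of a family are tested. *)
Definition modulus1 (G : set (curve X)) : \bar R :=
  ereal_inf [set \int[mu]_x rho x | rho in [set rho : X -> \bar R |
    [/\ measurable_fun setT rho, (forall x, 0 <= rho x) &
        forall c, G c -> rectifiable c -> 1 <= line_integral c rho]]].

Definition weak_upper_gradient (A : set X) (u : X -> R) (g : X -> \bar R) :=
  [/\ measurable_fun A g, (forall x, A x -> 0 <= g x) &
      exists2 G, modulus1 G = 0 &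
        forall c, rectifiable c -> curve_in A c -> ~ G c ->
          upper_gradient_along u g c].

Definition min_weak_upper_gradient (A : set X) (u : X -> R)
    (g : X -> \bar R) :=
  weak_upper_gradient A u g /\
  forall g', weak_upper_gradient A u g' ->
    \int[mu]_(x in A) g x <= \int[mu]_(x in A) g' x.

Definition cvg_L1loc (A : set X) (ui : nat -> X -> R) (u : X -> R) :=
  forall K, compact K -> K `<=` A ->
    \int[mu]_(x in K) `|ui i x - u x|%:E @[i --> \oo] --> 0.

Definition totvar (u : X -> R) (A : set X) : \bar R :=
  ereal_inf [set e | exists (ui : nat -> X -> R) (gi : nat -> X -> \bar R),
    [/\ forall i, loc_lipschitz A (ui i),
        cvg_L1loc A ui u,
        forall i, min_weak_upper_gradient A (ui i) (gi i) &
        e = limn_einf (fun i => \int[mu]_(x in A) gi i x)]].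

Definition BV (A : set X) (u : X -> R) :=
  mu.-integrable A (EFin \o u) /\ totvar u A < +oo.

End total_variation.

Section derivations.
Context {d} {R : realType} {X : completeBorelMetricType d R}.
Variable mu : {measure set X -> \bar R}.
Implicit Types (D : (X -> R) -> (X -> R)) (h k : X -> R).

Definition derivation_bound D h :=
  [/\ measurable_fun setT h, (forall x, 0 <= h x)%R &
      forall f, Lip_c f ->
        \forall x \ae mu, `|D f x|%:E <= (h x)%:E * Lip_a f x].

(* D is only meaningful on Lip_c. *)
Definition derivation D :=
  [/\ forall f, Lip_c f -> measurable_fun setT (D f),
      forall (a : R) f g, Lip_c f -> Lip_c g -> \forall x \ae mu,
        D (fun y => a * f y + g y)%R x = (a * D f x + D g x)%R,
      forall f g, Lip_c f -> Lip_c g -> \forall x \ae mu,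
        D (fun y => f y * g y)%R x = (f x * D g x + g x * D f x)%R &
      exists h, derivation_bound D h].

Definition derivation_norm D h :=
  derivation_bound D h /\
  forall h', derivation_bound D h' -> \forall x \ae mu, (h x <= h' x)%R.

Definition div_identity D k :=
  in_Lp mu +oo setT k /\
  forall f, Lip_c f ->
    \int[mu]_x (D f x)%:E = - \int[mu]_x (f x * k x)%:E.

Definition divergence D k :=
  div_identity D k /\
  forall k', div_identity D k' -> \forall x \ae mu, k x = k' x.

(* D belongs to Der_b, with |D| = h and div D = k. *)
Definition Der_b D h k :=
  [/\ derivation D, derivation_norm D h, in_Lp mu +oo setT h &
      divergence D k].

Definition ess_support h : set X :=
  [set x | forall r : R, (0 < r)%R ->
    ~ \forall y \ae mu, ball x r y -> h y = 0%R].

End derivations.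

(* Functions of space and time are v : X * R -> R, and v(t) is
   [fun x => v (x, t)]. *)
Section parabolic.
Context {d} {R : realType} {X : completeBorelMetricType d R}.
Variable mu : {measure set X -> \bar R}.
Implicit Types (A : set X) (T : R) (v : X * R -> R).

Local Notation leb := (@lebesgue_measure R).
Local Notation slice v t := (fun x => v (x, t)).

Definition cylinder A T : set (X * R) := A `*` `]0%R, T[.

Definition L1w_BV A T v :=
  [/\ (mu \x leb).-integrable (cylinder A T) (EFin \o v),
      (\forall t \ae leb, t \in `]0%R, T[ -> BV mu A (slice v t)),
      (forall D h k, Der_b mu D h k ->
         compactly_contained (ess_support mu h) A ->
         measurable_fun `]0%R, T[
           (fun t => \int[mu]_(x in A) (v (x, t) * k x)%:E)) &
      \int[leb]_(t in `]0%R, T[) totvar mu (slice v t) A < +oo].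

Definition BV_datum (Om Oms : set X) (u0 u : X -> R) :=
  BV mu Oms u /\
  \forall x \ae mu, (Oms `\` Om) x -> u x = u0 x.

Definition L1w_BV_datum (Om Oms : set X) (u0 : X -> R) T v :=
  L1w_BV Oms T v /\
  \forall t \ae leb, t \in `]0%R, T[ -> BV_datum Om Oms u0 (slice v t).

(* V is the representative of v in C^0([0, T]; L^p(A)); it is the one that
   gives a meaning to the values of v at single times. *)
Definition C0_rep (p : \bar R) A T v (V : R -> X -> R) :=
  [/\ forall t, t \in `[0%R, T] -> in_Lp mu p A (V t),
      forall t, t \in `[0%R, T] ->
        Lpnorm mu p A (V s \- V t)%R @[s --> within `[0%R, T] (nbhs t)] --> 0 &
      \forall t \ae leb, t \in `]0%R, T[ ->
        \forall x \ae mu, A x -> v (x, t) = V t x].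

(* By Rademacher's theorem in time this is the a.e. defined time derivative of
   a Lipschitz function. *)
Definition dt (phi : X * R -> R) (x : X) (t : R) : R :=
  ((fun s => phi (x, s))^`())%classic t.

(* Lipschitz functions on S x (0, T) with support compactly contained in
   A x (0, T). *)
Definition lip_test (S A : set X) T (phi : X * R -> R) :=
  (exists L : R, forall x y s t, cylinder S T (x, s) -> cylinder S T (y, t) ->
     (`|phi (x, s) - phi (y, t)| <= L * (mdist x y + `|s - t|))%R) /\
  compactly_contained [set z | cylinder S T z /\ phi z != 0%R] (cylinder A T).

Definition weak_dt A T v (w : X * R -> R) :=
  forall eta, lip_test A A T eta ->
    \int[mu \x leb]_(z in cylinder A T) (v z * dt eta z.1 z.2)%:E =
    - \int[mu \x leb]_(z in cylinder A T) (w z * eta z)%:E.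

(* A function v in L^1 with dv/dt in L^2(Oms_T) lies in C^0([0, T]; L^1(Oms));
   this representative V defines v(0) and v(T). *)
Definition variational_solution (Om Oms : set X) (u0 : X -> R) T
    (u : X * R -> R) :=
  L1w_BV_datum Om Oms u0 T u /\
  exists2 U, C0_rep 2%:E Oms T u U &
  forall (v w : X * R -> R) V,
    L1w_BV_datum Om Oms u0 T v ->
    in_Lp (mu \x leb) 2%:E (cylinder Oms T) w -> weak_dt Oms T v w ->
    C0_rep 1 Oms T v V -> in_Lp mu 2%:E Oms (V 0%R) ->
    \int[leb]_(t in `]0%R, T[) totvar mu (slice u t) Oms <=
    \int[leb]_(t in `]0%R, T[)
      (\int[mu]_(x in Oms) (w (x, t) * (v (x, t) - u (x, t)))%:E
       + totvar mu (slice v t) Oms)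
    - (2^-1)%:E * Lpnorm mu 2%:E Oms (V T \- U T)%R ^+ 2
    + (2^-1)%:E * Lpnorm mu 2%:E Oms (V 0%R \- u0)%R ^+ 2.

Definition global_variational_solution (Om Oms : set X) (u0 : X -> R)
    (u : X * R -> R) :=
  forall T, (0 < T)%R -> variational_solution Om Oms u0 T u.

Definition parabolic_minimizer (Om Oms : set X) (u0 : X -> R)
    (u : X * R -> R) :=
  forall T, (0 < T)%R ->
  [/\ L1w_BV_datum Om Oms u0 T u,
      \int[leb]_(t in `]0%R, T[) totvar mu (slice u t) Oms < +oo &
      forall phi, lip_test Oms Om T phi ->
        \int[leb]_(t in `]0%R, T[)
          (\int[mu]_(x in Oms) (u (x, t) * dt phi x t)%:E
           + totvar mu (slice u t) Oms) <=
        \int[leb]_(t in `]0%R, T[) totvar mu (slice (u \+ phi)%R t) Oms].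

End parabolic.

(* Main.v *)
From HB Require Import structures.
From mathcomp Require Import all_boot all_order all_algebra.
From mathcomp Require Import all_classical all_reals all_analysis.
From mathcomp Require Import measurable_realfun ess_sup_inf.
From mathcomp Require Import ring lra.
Require Import Defs.
Set SsrOldRewriteGoalsOrder.
Set Implicit Arguments.
Unset Strict Implicit.
Unset Printing Implicit Defensive.
Import Order.TTheory GRing.Theory Num.Theory.
Import numFieldNormedType.Exports.
Local Open Scope classical_set_scope.
Local Open Scope ring_scope.
Local Open Scope ereal_scope.

(** The variational inequality has to be tested with a function close to
    [u + phi], but [u] has no time derivative. Comparison functions are obtained
    by relaxation. For a small parameter [h], let [v] solve [h v' = W - v] with
    initial value [u0], where [W = u + phi]; then [v' = (W - v) / h]. Since [v(t)]
    is an average of [u0] and of the values of [W] before [t], convexity of the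
    total variation bounds the time integral of the total variation of [v] by that
    of [W] plus [h] times the total variation of [u0]. With [D] the time derivative
    of [phi],
      v' (v - u) = v' (v - W) + v' phi   and   v' (W - v) = h (v')^2,
    and [phi] being a test function, the integral of [v' phi] is minus the integral
    of [v D], that is, minus the integral of [u D] plus that of [(W - v) D],
    because [phi D] has integral zero. As [(W - v) D = h v' D] is at most
    [h (v')^2 / 2 + h D^2 / 2], the pairing of [v'] with [v - u] is bounded by minus
    the integral of [u D] plus a multiple of [h]. Since [v] starts from [u0] and the
    term at the final time has a favourable sign, the asserted inequality follows
    when [h] tends to zero.

    To stay within finite sums, [W] is replaced by a function that is constant on
    short time intervals, and the equation by an explicit Euler scheme with
    piecewise affine interpolation ([relax], [competitor]). Then [v(t)] is literally
    a convex combination of finitely many functions, its weak time derivative is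
    found by integration by parts on each line in the time direction
    ([integration_by_parts_time]), and its total variation is bounded by
    [totvar_comb] ([competitor_energy]). The constant values are those of [W] at
    times where the total variation does not exceed its mean over the time interval
    ([mean_pick], [sample_exists]); since [u] is continuous in time with values in
    L^2, the error made in the pairing is small ([young_step], [pairing_le],
    [step_error]). Everything is collected in [approximate_inequality].

    Two properties of the total variation are used, besides invariance under
    changes on null sets. It is convex ([totvar_comb]), and it is lower
    semicontinuous in L^1 ([totvar_lsc]), so that its values along a continuous
    curve in L^2 are measurable in time ([totvar_measurable]). In both proofs
    approximations with a given weak upper gradient have to be turned into
    approximating sequences with minimal weak upper gradients. This requires the
    existence of minimal weak upper gradients ([min_wug_exists]), whose core is that
    the minimum of two integrable weak upper gradients is one
    ([le_integral_min], [wug_min]), and the compactness of closed bounded sets,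
    a consequence of doubling ([closed_bounded_compact]). *)

(** * Integrals of arbitrary functions *)

Section almost_everywhere.
Context {d} {T : measurableType d} {R : realType}.
Variable mu : {measure set T -> \bar R}.
Implicit Types P Q : T -> Prop.

Lemma ae_imp P Q : (forall x, P x -> Q x) ->
  (\forall x \ae mu, P x) -> \forall x \ae mu, Q x.
Proof. exact: filterS. Qed.

Lemma ae_imp2 P Q (S : T -> Prop) : (forall x, P x -> Q x -> S x) ->
  (\forall x \ae mu, P x) -> (\forall x \ae mu, Q x) -> \forall x \ae mu, S x.
Proof. exact: filterS2. Qed.

End almost_everywhere.

Section integral_nonmeasurable.
Context {d} {T : measurableType d} {R : realType}.
Variable mu : {measure set T -> \bar R}.
Implicit Types (D : set T) (f g : T -> \bar R).

(** The integral of an arbitrary function is a difference of two suprema over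
    simple functions, hence monotone without any measurability. This is what
    allows to integrate in time the total variation of the slices of a function
    before anything is known about its measurability. *)
Lemma le_integral_gen D f g : (forall x, D x -> f x <= g x) ->
  \int[mu]_(x in D) f x <= \int[mu]_(x in D) g x.
Proof.
move=> fg; rewrite /integral.
have fgD x : (f \_ D) x <= (g \_ D) x.
  by rewrite !patchE; case: ifPn => // /set_mem; exact: fg.
apply: leeB; apply: le_ereal_sup => _ [h /= hf <-]; exists h => //= x;
  apply: (le_trans (hf x)).
  by rewrite !funeposE ge_max le_max fgD/= le_max lexx orbT.
by rewrite !funenegE ge_max le_max leeN2 fgD/= le_max lexx orbT.
Qed.

Import HBNNSimple.

(** Cutting a simple function off on a null set does not change its integral, and
    makes it comparable with any function that agrees with the integrand outside
    of the null set. *)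
Lemma ae_eq_integral_gen D f g :
  (\forall x \ae mu, D x -> f x = g x) ->
  \int[mu]_(x in D) f x = \int[mu]_(x in D) g x.
Proof.
move=> [N [mN N0 sN]]; rewrite /integral.
have mNC : measurable (~` N) by exact: measurableC.
have fgN x : (~` N) x -> (f \_ D) x = (g \_ D) x.
  move=> Nx; rewrite !patchE; case: ifPn => // /set_mem Dx.
  by apply: contrapT => H; apply: Nx; apply: sN => /= K; apply: H; exact: K.
have main (F G : T -> \bar R) : (forall x, 0 <= G x) ->
    (forall x, (~` N) x -> F x = G x) ->
    ereal_sup [set sintegral mu h | h in [set h : {nnsfun T >-> R} | forall x, (h x)%:E <= F x]] <=
    ereal_sup [set sintegral mu h | h in [set h : {nnsfun T >-> R} | forall x, (h x)%:E <= G x]].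
  move=> G0 FG; apply: ge_ereal_sup => _ [h /= hF <-].
  apply: ereal_sup_ge; exists (sintegral mu (proj_nnsfun h mNC)).
    exists (proj_nnsfun h mNC) => //= x; rewrite /= mindicE.
    have [/set_mem Nx|_] := boolP (x \in ~` N); last by rewrite mulr0.
    by rewrite mulr1 -FG.
  rewrite -!integralT_nnsfun.
  rewrite (@ae_eq_integral _ _ _ mu setT (EFin \o (proj_nnsfun h mNC)))//.
  - exact/measurable_EFinP.
  - exact/measurable_EFinP.
  - exists N; split => // x /= H; apply: contrapT => Nx; apply: H => _ /=.
    by rewrite mindicE mem_set// mulr1.
congr (_ - _); apply/eqP; rewrite eq_le; apply/andP; split; apply: main => //.
- by move=> x Nx; rewrite !funeposE fgN.
- by move=> x Nx; rewrite !funeposE fgN.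
- by move=> x Nx; rewrite !funenegE fgN.
- by move=> x Nx; rewrite !funenegE fgN.
Qed.

Lemma ae_le_integral_gen D f g :
  (\forall x \ae mu, D x -> f x <= g x) ->
  \int[mu]_(x in D) f x <= \int[mu]_(x in D) g x.
Proof.
move=> fg; rewrite (@ae_eq_integral_gen D f (fun x => mine (f x) (g x))).
  by apply: le_integral_gen => x _; rewrite ge_min lexx orbT.
case: fg => N [mN N0 sN]; exists N; split => // x /= H; apply: sN => /= K.
by apply: H => Dx; rewrite min_l// K.
Qed.

Lemma bounded_integrable (A : set T) (f : T -> R) (M : R) :
  measurable A -> mu A < +oo -> measurable_fun A f ->
  (forall x, A x -> `|f x| <= M)%R -> mu.-integrable A (EFin \o f).
Proof.
move=> mA A_fin mf fM; apply: measurable_bounded_integrable => //.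
exists M; split; first exact: num_real.
by move=> x Mx y /fM /le_trans; apply; exact: ltW.
Qed.

End integral_nonmeasurable.

(** * Lipschitz functions of a real variable *)

Section lipschitz_line.
Context {R : realType}.
Local Notation leb := (@lebesgue_measure R).

(** Both measures are infima over the same coverings by half-open intervals, so
    that it is enough to compare them on intervals. *)
Lemma lebesgue_stieltjes_le (G : cumulative R R) (K : R) (A : set R) :
  (0 < K)%R -> (forall a b, (a <= b)%R -> (G b - G a <= K * (b - a))%R) ->
  lebesgue_stieltjes_measure G A <= K%:E * leb A.
Proof.
move=> K0 GK; rewrite -lee_pdivrMl// [leRHS]/lebesgue_measure.
rewrite /lebesgue_stieltjes_measure /measure_extension /mu_ext.
apply: le_ereal_inf_tmp => _ [F [mF AF] <-].
rewrite lee_pdivrMl// -nneseriesZl//.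
apply: (@le_trans _ _ (\sum_(k <oo) wlength G (F k))).
  by apply: ereal_inf_lbound; exists F.
apply: lee_nneseries => k _; first by move=> *; exact: (@wlength_ge0 R G).
have /ocitvP[->|[[a b] /= ab ->]] := mF k.
  by rewrite !measure0 mule0.
by rewrite !wlength_itv/= !lte_fin ab -!EFinB -EFinM lee_fin/= GK// ltW.
Qed.

(** Once a linear function is added, [f] is nondecreasing, and its Stieltjes
    measure is bounded by a multiple of Lebesgue measure. It has a density by the
    Radon-Nikodym theorem, and Lebesgue's differentiation theorem identifies the
    density with the derivative. *)
Lemma lipschitz_density (f : R -> R) (L a b : R) : (a < b)%R ->
  (forall x y, (`|f x - f y| <= L * `|x - y|)%R) ->
  exists h : R -> R, [/\ leb.-integrable `]a, b] (EFin \o h),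
    (forall t, t \in `]a, b] ->
       \int[leb]_(s in `]a, t]) (h s)%:E = (f t - f a)%:E) &
    {ae leb, forall t, t \in `]a, b[ -> derivable f t 1 /\ f^`()%classic t = h t}].
Proof.
move=> ab fL.
have L0 : (0 <= L)%R.
  by have := le_trans (normr_ge0 _) (fL 1%R 0%R); rewrite subr0 normr1 mulr1.
(* The slope [L] makes up for the largest possible decrease of [f]. *)
pose G t := (f t + L * t)%R.
have ndG : {homo G : x y / (x <= y)%R}.
  move=> x y xy; rewrite /G; have := fL x y.
  rewrite distrC (distrC x) (ger0_norm (_ : 0 <= y - x)%R) ?subr_ge0//.
  by rewrite ler_norml => /andP[]; lra.
have cf : continuous f.
  move=> x; apply/(@cvgrPdist_le _ R^o) => e e0; near=> y.
  apply: (le_trans (fL _ _)).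
  rewrite (@le_trans _ _ ((L + 1) * `|x - y|)%R)//.
    by rewrite ler_wpM2r// lerDl.
  rewrite -ler_pdivlMl ?ltr_wpDl// mulrC.
  by near: y; apply: (@cvgr_dist_le _ R^o) => //; rewrite divr_gt0// ltr_wpDl.
have cG : continuous G.
  move=> x; apply: continuousD; first exact: cf.
  by apply: continuousM; [exact: cvg_cst|exact: cvg_id].
pose Gc : cumulative R R :=
  HB.pack G (isCumulative.Build R _ R G ndG (right_continuousW cG)).
have GK x y : (x <= y)%R -> (Gc y - Gc x <= (2 * L + 1) * (y - x))%R.
  move=> xy; rewrite /= /G; have := fL y x.
  rewrite (ger0_norm (_ : 0 <= y - x)%R) ?subr_ge0//.
  by rewrite ler_norml => /andP[]; nra.
have K0 : (0 < 2 * L + 1)%R by lra.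
have SL A := @lebesgue_stieltjes_le Gc _ A K0 GK.
pose D : set R := `]a, b]%classic.
have mD : measurable (D : set (measurableTypeR R)) by exact: measurable_itv.
pose m0 : {measure set (measurableTypeR R) -> \bar R} :=
  lebesgue_stieltjes_measure Gc.
have Dfin : m0 D < +oo.
  apply: le_lt_trans (SL _) _; rewrite lte_mul_pinfty ?lee_fin ?ltW//.
  by rewrite lebesgue_measure_itv/=; case: ifP => _; rewrite ?ltry// -EFinB ltry.
pose nu : {finite_measure set (measurableTypeR R) -> \bar R} := mfrestr mD Dfin.
have numu : nu `<< leb.
  apply/null_content_dominatesP => A mA A0; apply/eqP.
  rewrite /nu/= /mfrestr /mrestr eq_le measure_ge0 andbT.
  apply: le_trans (SL _) _.
  rewrite -(mule0 (2 * L + 1)%:E) lee_pmul2l ?lte_fin//.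
  by rewrite -A0 le_measure ?inE//; exact: measurableI.
have [h [h0 hfin hint nuE]] := radon_nikodym_sigma_finite numu.
pose g : R -> R := fine \o h.
have gE : EFin \o g = h by apply/funext => x; rewrite /g/= fineK.
have ig : leb.-integrable [set: R] (EFin \o g) by rewrite gE.
have igS (A : set R) : measurable A -> leb.-integrable A (EFin \o g).
  by move=> mA; exact: integrableS ig.
have gG t : t \in `]a, b] ->
    \int[leb]_(s in `]a, t]) (g s)%:E = (G t - G a)%:E.
  rewrite in_itv/= => /andP[at_ tb].
  transitivity (nu `]a, t]%classic).
    rewrite nuE//; apply: eq_integral => s _.
    by rewrite -[LHS]/((EFin \o g) s) gE.
  rewrite /nu/= /mfrestr /mrestr setIidl; last first.
    by apply: subset_itvl; rewrite bnd_simp.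
  rewrite /m0/= /lebesgue_stieltjes_measure /measure_extension.
  rewrite measurable_mu_extE/=; last exact: is_ocitv.
  by rewrite wlength_itv/= lte_fin at_ -EFinB.
have iL (c d : R) : leb.-integrable `]c, d] (EFin \o cst L).
  have lf : leb (`]c, d]%classic : set R) < +oo.
    rewrite lebesgue_measure_itv/=.
    by case: ifP => _; rewrite ?ltry// -EFinB ltry.
  exact: (@bounded_integrable _ _ _ leb _ _ `|L|%R).
exists (fun t => g t - L)%R; split.
- have -> : EFin \o (fun t => g t - L)%R = (EFin \o g) \- (EFin \o cst L) by [].
  by apply: integrableB => //; exact: igS.
- move=> t tab; under eq_integral do rewrite EFinB.
  rewrite (integralB_EFin _ (igS _ _) (iL _ _))//.
  move: (tab); rewrite in_itv/= => /andP[at_ _].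
  have -> : \int[leb]_(x in `]a, t]) (cst L x)%:E = (L * (t - a))%:E.
    have E : leb (`]a, t]%classic : set R) = (t - a)%:E.
      by rewrite lebesgue_measure_itv/= lte_fin at_ -EFinB.
    exact: (etrans (integral_cst leb (measurable_itv _) L%:E)
                   (congr1 (fun e => L%:E * e) E)).
  by rewrite gG// -EFinB /G; congr EFin; ring.
- have /(_ _ _)/= := @FTC1 _ g (BRight a).
  move=> /(_ (fun y => igS _ (measurable_itv _))).
  move=> /(_ (open_integrable_locally openT ig)).
  apply: ae_imp => t + tab.
  move: (tab); rewrite in_itv/= => /andP[at_ tb].
  move=> H; have {H} [dF F'] := H at_.
  set F := (X in derivable X t 1) in dF F'.
  have FG : \forall s \near t, (F s + G a - L * s)%R = f s.
    near=> s.
    have sab : s \in `]a, b].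
      rewrite in_itv/=; apply/andP; split; first by near: s; exact: lt_nbhsr.
      by apply: ltW; near: s; exact: lt_nbhsl.
    by rewrite /F /Rintegral gG//= /G; ring.
  have idF : is_derive t (1 : R)%R F (g t) by rewrite -F' derive1E; exact: derivableP.
  have idf : is_derive t (1 : R)%R f (g t - L)%R.
    apply: near_eq_is_derive FG _.
    have -> : (g t - L = g t + 0 - L *: 1)%R by rewrite addr0 /GRing.scale/= mulr1.
    exact: is_deriveB.
  split; first exact: ex_derive.
  by rewrite derive1E derive_val.
Unshelve. all: by end_near. Qed.

(** Composition with the projection onto the interval extends [F] to a Lipschitz
    function on the line. *)
Lemma lipschitz_FTC (F : R -> R) (L a b : R) : (a < b)%R ->
  {in `[a, b] &, forall x y, (`|F x - F y| <= L * `|x - y|)%R} ->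
  {ae leb, forall t, t \in `]a, b[ -> derivable F t 1} /\
  \int[leb]_(t in `]a, b[) (F^`()%classic t)%:E = (F b - F a)%:E.
Proof.
move=> ab FL.
pose c (t : R) := Num.max a (Num.min t b).
have cab t : c t \in `[a, b].
  by rewrite in_itv/= /c le_max lexx/= ge_max ge_min lexx orbT (ltW ab).
have c1 x y : (`|c x - c y| <= `|x - y|)%R.
  rewrite /c.
  have h1 := ler_norm (x - y); have := ler_norm (- (x - y)); rewrite normrN.
  case: (leP x b) => ?; case: (leP y b) => ?; case: (leP a x) => ?;
  case: (leP a y) => ?; try (case: (leP a b) => ?);
  by rewrite ler_norml => h2; lra.
have L0 : (0 <= L)%R.
  have := FL a b; rewrite !in_itv/= !lexx (ltW ab)/= => /(_ isT isT).
  move=> /(le_trans (normr_ge0 _)); rewrite pmulr_lge0// normr_gt0 subr_eq0.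
  by rewrite lt_eqF.
have FcL x y : (`|(F \o c) x - (F \o c) y| <= L * `|x - y|)%R.
  by apply: (le_trans (FL _ _ (cab _) (cab _))); rewrite ler_wpM2l.
have [h [ih hE h_ae]] := lipschitz_density ab FcL.
have cE t : t \in `[a, b] -> c t = t.
  by rewrite in_itv/= /c => /andP[? ?]; rewrite min_l// max_r.
have near_c t : t \in `]a, b[ -> \forall s \near t, (F \o c) s = F s.
  move=> tab; near=> s; rewrite /= cE//.
  have : s \in `]a, b[ by near: s; exact: near_in_itvoo.
  by rewrite !in_itv/= => /andP[/ltW -> /ltW ->].
have F_ae : {ae leb, forall t, t \in `]a, b[ ->
    derivable F t 1 /\ F^`()%classic t = h t}.
  apply: ae_imp h_ae => t + tab => /(_ tab) [dF F'].
  have idF : is_derive t (1 : R)%R F (h t).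
    apply: near_eq_is_derive (near_c _ tab) _.
    by rewrite -F' derive1E; exact: derivableP.
  split; first exact: ex_derive.
  by rewrite derive1E derive_val.
split; first by apply: ae_imp F_ae => t H /H[].
rewrite (@ae_eq_integral_gen _ _ _ leb _ _ (EFin \o h)); last first.
  by apply: ae_imp F_ae => t H /H[_ /= ->].
rewrite integral_itv_bndo_bndc//; last first.
  apply: measurable_funS (measurable_int _ ih) => //.
  by apply: subset_itvl; rewrite bnd_simp.
by rewrite hE/= ?cE ?in_itv/= ?lexx ?ab ?(ltW ab).
Unshelve. all: by end_near. Qed.

End lipschitz_line.

(** * Length of curves and arc-length parametrization *)

Section curve_length_theory.
Context {R : realType} {X : metricType R}.
Implicit Types (g : R -> X) (s : seq R).

(** The length of an inscribed polygon, in a form suited to induction on the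
    partition. *)
Fixpoint chord_sum g a s : R :=
  if s is x :: s' then (mdist (g a) (g x) + chord_sum g x s')%R else 0%R.

Lemma chord_sumE g a b s :
  (\sum_(0 <= i < size s)
     mdist (g (nth b (a :: s) i)) (g (nth b (a :: s) i.+1)))%R = chord_sum g a s.
Proof.
elim: s a => [|x s IH] a; first by rewrite big_nil.
by rewrite big_nat_recl//= IH.
Qed.

Lemma curve_lengthE g a b :
  curve_length g a b = ereal_sup [set (chord_sum g a s)%:E | s in itv_partition a b].
Proof.
rewrite /curve_length; congr ereal_sup; apply/seteqP; split => _ [s sab <-];
  by exists s => //; rewrite -(chord_sumE g a b s).
Qed.

Lemma chord_sum_le g a b s : itv_partition a b s ->
  (chord_sum g a s)%:E <= curve_length g a b.
Proof. by move=> sab; rewrite curve_lengthE; apply: ereal_sup_ubound; exists s. Qed.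

Lemma chord_sum_cat g a s1 s2 :
  chord_sum g a (s1 ++ s2) = (chord_sum g a s1 + chord_sum g (last a s1) s2)%R.
Proof. by elim: s1 a => [|x s1 IH] a /=; rewrite ?add0r// IH addrA. Qed.

(** Inserting a vertex lengthens an inscribed polygon. *)
Lemma chord_sum_insert g a m b s : (a <= m <= b)%R -> itv_partition a b s ->
  exists s1 s2, [/\ itv_partition a m s1, itv_partition m b s2 &
    (chord_sum g a s <= chord_sum g a s1 + chord_sum g m s2)%R].
Proof.
elim: s a => [|x s IH] a /andP[am mb] [/= pas lasts].
  move/eqP : lasts => ab; have ma : m = a by apply/eqP; rewrite eq_le am ab mb.
  by exists [::], [::]; split; rewrite /itv_partition/= ?ma ?ab ?addr0//.
move: pas => /andP[ax pxs].
have [xm|mx] := leP x m.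
  have [s1 [s2 [[p1 l1] [p2 l2] le12]]] := IH x (introT andP (conj xm mb)) (conj pxs lasts).
  exists (x :: s1), s2; split => //=; first by split => //=; rewrite ax.
  by rewrite -addrA lerD2l.
move: am; rewrite le_eqVlt => /predU1P[<-|am].
  exists [::], (x :: s); split => //=; first by split => //=; rewrite ax.
  by rewrite add0r.
exists [:: m], (x :: s); split => /=.
- by split => //=; rewrite am.
- by split => //=; rewrite mx.
- by rewrite addr0 addrA lerD2r metric_triangle.
Qed.

Lemma curve_lengthD g a m b : (a <= m <= b)%R ->
  curve_length g a b = curve_length g a m + curve_length g m b.
Proof.
move=> amb; apply/eqP; rewrite eq_le; apply/andP; split.
  rewrite [leLHS]curve_lengthE; apply: ge_ereal_sup => _ [s sab <-].
  have [s1 [s2 [s1am s2mb]]] := chord_sum_insert g amb sab.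
  rewrite -lee_fin => /le_trans; apply; rewrite EFinD.
  by apply: leeD; exact: chord_sum_le.
move/andP : amb => [am mb].
have ne c e : (c <= e)%R -> exists s, itv_partition c e s.
  rewrite le_eqVlt => /predU1P[<-|ce]; first by exists [::]; split.
  by exists [:: e]; split => //=; rewrite ce.
rewrite [X in X + _]curve_lengthE [X in _ + X]curve_lengthE.
set E := [set _ | _ in _]; set F := [set _ | _ in _ ].
have supF : ereal_sup F = +oo -> curve_length g a b = +oo.
  move=> Foo; apply/eqP; rewrite -leye_eq -Foo.
  apply: ge_ereal_sup => _ [s2 [p2 l2] <-].
  have [s1 [p1 /eqP l1]] := ne _ _ am.
  apply: (@le_trans _ _ (chord_sum g a (s1 ++ s2))%:E).
    rewrite chord_sum_cat l1 lee_fin lerDr.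
    by elim: s1 (a) {p1 l1} => //= x s1 IH c; rewrite addr_ge0// mdist_ge0.
  apply: chord_sum_le; split; first by rewrite cat_path p1 l1.
  by rewrite last_cat l1.
have F0 : 0 <= ereal_sup F.
  have [s2 p2] := ne _ _ mb.
  apply: (@le_trans _ _ (chord_sum g m s2)%:E).
    rewrite lee_fin.
    by elim: s2 (m) {p2} => //= x s1 IH c; rewrite addr_ge0// mdist_ge0.
  by apply: ereal_sup_ubound; exists s2.
have [Foo|Ffin] := eqVneq (ereal_sup F) +oo.
  by rewrite (supF Foo) leey.
have Ff : ereal_sup F \is a fin_num.
  by rewrite ge0_fin_numE// ltey.
rewrite -leeBrDr//; apply: ge_ereal_sup => _ [s1 [p1 /eqP l1] <-].
rewrite leeBrDr// addeC -leeBrDr//; apply: ge_ereal_sup => _ [s2 [p2 l2] <-].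
rewrite leeBrDr// -EFinD addrC -[X in (_ + chord_sum g X s2)%R]l1 -chord_sum_cat.
apply: chord_sum_le; split; first by rewrite cat_path p1 l1.
by rewrite last_cat l1.
Qed.

Lemma curve_length_ge_dist g a b : (a <= b)%R ->
  (mdist (g a) (g b))%:E <= curve_length g a b.
Proof.
rewrite le_eqVlt => /predU1P[<-|ab].
  rewrite mdistxx -[leLHS]/((chord_sum g a [::])%:E).
  by apply: chord_sum_le; split.
rewrite -[mdist _ _]addr0 -[leLHS]/((chord_sum g a [:: b])%:E).
by apply: chord_sum_le; split => //=; rewrite ab.
Qed.

Lemma curve_length_ge0 g a b : (a <= b)%R -> 0 <= curve_length g a b.
Proof.
move=> ab; apply: le_trans (curve_length_ge_dist g ab).
by rewrite lee_fin mdist_ge0.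
Qed.

End curve_length_theory.

Section arc_length.
Context {R : realType} {X : metricType R}.
Variable c : curve X.
Hypothesis rc : rectifiable c.
Local Notation a := (cleft c).
Local Notation b := (cright c).
Local Notation len s t := (fine (curve_length c s t)).

Let ab : (a <= b)%R. Proof. by case: rc. Qed.

Lemma subcurve_length_le s t : (a <= s)%R -> (s <= t)%R -> (t <= b)%R ->
  curve_length c s t <= clength c.
Proof.
move=> as_ st tb; rewrite /clength.
rewrite (@curve_lengthD _ _ _ a s); last by rewrite as_ (le_trans st).
rewrite (@curve_lengthD _ _ _ s t b); last by rewrite st tb.
rewrite -[leLHS]add0e; apply: leeD; first exact: curve_length_ge0.
by rewrite leeDl// curve_length_ge0.
Qed.

Lemma subcurve_length_fin s t : (a <= s)%R -> (s <= t)%R -> (t <= b)%R ->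
  curve_length c s t \is a fin_num.
Proof.
move=> as_ st tb; rewrite ge0_fin_numE ?curve_length_ge0//.
by apply: le_lt_trans (subcurve_length_le as_ st tb) _; case: rc.
Qed.

Lemma lenD s t u : (a <= s)%R -> (s <= t)%R -> (t <= u)%R -> (u <= b)%R ->
  len s u = (len s t + len t u)%R.
Proof.
move=> as_ st tu ub.
rewrite (@curve_lengthD _ _ _ s t u) ?st ?tu// fineD//.
  by apply: subcurve_length_fin => //; exact: le_trans ub.
by apply: subcurve_length_fin => //; exact: le_trans st.
Qed.

Lemma len_refl t : (a <= t)%R -> (t <= b)%R -> len t t = 0%R.
Proof.
by move=> at_ tb; have := @lenD t t t at_ (lexx _) (lexx _) tb; lra.
Qed.

Lemma len_ge0 s t : (s <= t)%R -> (0 <= len s t)%R.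
Proof. by move=> st; rewrite fine_ge0// curve_length_ge0. Qed.

Lemma dist_le_len s t : (a <= s)%R -> (s <= t)%R -> (t <= b)%R ->
  (mdist (c s) (c t) <= len s t)%R.
Proof.
move=> as_ st tb; rewrite -lee_fin fineK ?subcurve_length_fin//.
exact: curve_length_ge_dist.
Qed.

Lemma len_homo s t : (a <= s)%R -> (s <= t)%R -> (t <= b)%R ->
  (len a s <= len a t)%R.
Proof. by move=> as_ st tb; rewrite (@lenD a s t)// lerDl len_ge0. Qed.

Lemma curve_cont t e : (a <= t)%R -> (t <= b)%R -> (0 < e)%R ->
  exists2 dl : R, (0 < dl)%R & forall s, (a <= s)%R -> (s <= b)%R ->
    (`|t - s| < dl)%R -> (mdist (c t) (c s) < e)%R.
Proof.
move=> at_ tb e0; have [_ /subspace_continuousP/(_ t) + _] := rc.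
rewrite /= in_itv/= at_ tb => /(_ isT)/(_ (ball (c t) e) (nbhsx_ballx _ _ e0)).
move=> /nbhs_ballP[dl /= dl0 H]; exists dl => // s as_ sb ts.
have := H s ts; rewrite /= in_itv/= as_ sb => /(_ isT).
by rewrite ballEmdist.
Qed.

(** If an inscribed polygon of the arc from [t] to [b] has almost the length of
    the arc, then a short arc from [t] is not much longer than its chord, which
    tends to zero by continuity of the curve. *)
Let len_right t e : (a <= t)%R -> (t < b)%R -> (0 < e)%R ->
  exists2 dl : R, (0 < dl)%R & forall s, (t <= s)%R -> (s <= b)%R ->
    (s - t < dl)%R -> (len t s <= e)%R.
Proof.
move=> at_ tb e0; have e20 : (0 < e / 2)%R by rewrite divr_gt0.
have Lfin := subcurve_length_fin at_ (ltW tb) (lexx _).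
have : (curve_length c t b - (e / 2)%:E < curve_length c t b)%E.
  by rewrite lteBlDr// lteDl// lte_fin.
rewrite {2}curve_lengthE => /ereal_sup_gt[_ [[|x s'] [/= p l] <-]].
  by move: l => /eqP l; move: tb; rewrite l ltxx.
move: p => /andP[tx pxs]; have xb : (x <= b)%R.
  move: l => /eqP <-; clear -pxs; elim: s' x pxs => //= y s IH x /andP[xy pys].
  exact: le_trans (ltW xy) (IH _ pys).
rewrite -(fineK Lfin) -EFinB lte_fin => H.
have [dl dl0 cdl] := curve_cont at_ (ltW tb) e20.
exists (Num.min dl (x - t))%R; first by rewrite lt_min dl0 subr_gt0.
move=> s ts sb; rewrite lt_min ltrD2r => /andP[tsdl sx].
have ctcs : (mdist (c t) (c s) < e / 2)%R.
  by apply: cdl => //; [exact: le_trans ts|rewrite distrC ger0_norm// subr_ge0].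
have rest : (mdist (c s) (c x) + chord_sum c x s' <= len s b)%R.
  rewrite -lee_fin fineK; last by apply: subcurve_length_fin; rewrite ?(le_trans at_).
  rewrite -[X in (X)%:E]/(chord_sum c s (x :: s')).
  by apply: chord_sum_le; split; rewrite //= sx.
have := @lenD t s b at_ ts sb (lexx _).
by have := metric_triangle (c t) (c s) (c x); lra.
Qed.

Let len_left t e : (a < t)%R -> (t <= b)%R -> (0 < e)%R ->
  exists2 dl : R, (0 < dl)%R & forall s, (a <= s)%R -> (s <= t)%R ->
    (t - s < dl)%R -> (len s t <= e)%R.
Proof.
move=> at_ tb e0; have e20 : (0 < e / 2)%R by rewrite divr_gt0.
have Lfin := subcurve_length_fin (lexx _) (ltW at_) tb.
have : (curve_length c a t - (e / 2)%:E < curve_length c a t)%E.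
  by rewrite lteBlDr// lteDl// lte_fin.
rewrite {2}curve_lengthE => /ereal_sup_gt[_ [s' [/= p l] <-]].
case/lastP : s' p l => [|s' x] p l.
  by move: l => /eqP /= l; move: at_; rewrite l ltxx.
move: l; rewrite last_rcons => /eqP xt; rewrite {x}xt in p *.
move: p; rewrite rcons_path => /andP[p lt].
rewrite -cats1 chord_sum_cat/= addr0 -(fineK Lfin) -EFinB lte_fin => H.
have al : (a <= last a s')%R.
  clear -p; elim: s' (a) p => //= y s IH x /andP[xy pys].
  exact: le_trans (ltW xy) (IH _ pys).
have [dl dl0 cdl] := curve_cont (ltW at_) tb e20.
exists (Num.min dl (t - last a s'))%R; first by rewrite lt_min dl0 subr_gt0.
move=> s as_ st; rewrite lt_min ltrD2l ltrN2 => /andP[tsdl ls].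
have ctcs : (mdist (c t) (c s) < e / 2)%R.
  by apply: cdl => //; [exact: le_trans tb|rewrite ger0_norm// subr_ge0].
have rest : (chord_sum c a s' + mdist (c (last a s')) (c s) <= len a s)%R.
  rewrite -lee_fin fineK; last by apply: subcurve_length_fin; rewrite ?(le_trans st).
  rewrite -[X in (_ + X)%R]addr0 -/(chord_sum c (last a s') [:: s]) -chord_sum_cat.
  apply: chord_sum_le; split; last by rewrite last_cat.
  by rewrite cat_path p/= ls.
have := @lenD a s t (lexx _) as_ st tb.
have := metric_triangle (c (last a s')) (c s) (c t).
by rewrite (metric_sym (c s)); lra.
Qed.

(** By the intermediate value theorem, continuity of the arc length implies that
    every number up to the length of the curve is the length of an initial arc;
    this is what makes [arc_param] meaningful. *)
Lemma len_within_continuous : {within `[a, b], continuous (fun t => len a t)}.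
Proof.
apply/subspace_continuousP => t; rewrite /= in_itv/= => /andP[at_ tb].
apply/(@cvgrPdist_le _ R^o) => e e0.
have [d1 d10 H1] : exists2 dl : R, (0 < dl)%R & forall s, (t <= s)%R -> (s <= b)%R ->
    (s - t < dl)%R -> (len t s <= e)%R.
  move: tb; rewrite le_eqVlt => /predU1P[tb|tb]; last exact: len_right.
  exists 1%R => // s ts sb _; have -> : s = t by apply/eqP; rewrite eq_le ts tb sb.
  by rewrite len_refl ?tb// ltW.
have [d2 d20 H2] : exists2 dl : R, (0 < dl)%R & forall s, (a <= s)%R -> (s <= t)%R ->
    (t - s < dl)%R -> (len s t <= e)%R.
  move: at_; rewrite le_eqVlt => /predU1P[at_|at_]; last exact: len_left.
  exists 1%R => // s ts sb _; have -> : s = t by apply/eqP; rewrite eq_le sb -at_ ts.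
  by rewrite len_refl -?at_ ?at_// ltW.
apply/nbhs_ballP; exists (Num.min d1 d2)%R => /=; first by rewrite lt_min d10 d20.
move=> s; rewrite /ball/= lt_min => /andP[ts1 ts2]; rewrite in_itv/= => /andP[as_ sb].
have [ts|st] := leP t s.
  have := @lenD a t s (lexx _) at_ ts sb.
  have : (len t s <= e)%R.
    by apply: H1 => //; rewrite -(ger0_norm (_ : 0 <= s - t)%R) ?subr_ge0// distrC.
  move=> h E; change (`|len a t - len a s| <= e)%R.
  by rewrite E opprD addrA subrr add0r normrN ger0_norm// len_ge0.
have := @lenD a s t (lexx _) as_ (ltW st) tb.
have : (len s t <= e)%R.
  apply: H2 => //; first exact: ltW.
  by rewrite -(ger0_norm (_ : 0 <= t - s)%R) ?subr_ge0// ltW.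
move=> h E; change (`|len a t - len a s| <= e)%R.
by rewrite E addrC addKr ger0_norm// len_ge0// ltW.
Qed.

Lemma same_len_same_point s t : (a <= s)%R -> (s <= b)%R -> (a <= t)%R -> (t <= b)%R ->
  len a s = len a t -> c s = c t.
Proof.
wlog st : s t / (s <= t)%R.
  move=> W as_ sb at_ tb e; have [st|/ltW ts] := leP s t; first exact: W.
  by apply/esym; exact: W.
move=> as_ sb at_ tb e; apply: mdist_positivity; apply/eqP.
rewrite eq_le mdist_ge0 andbT; apply: le_trans (dist_le_len as_ st tb) _.
by have := @lenD a s t (lexx _) as_ st tb; rewrite e; lra.
Qed.

Lemma arc_paramP s : (0 <= s)%R -> (s <= fine (clength c))%R ->
  exists t, [/\ (a <= t)%R, (t <= b)%R, len a t = s & arc_param c s = c t].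
Proof.
move=> s0 sL; rewrite /arc_param; case: xgetP => [t _ [tab lt]|].
  move: tab; rewrite in_itv/= => /andP[at_ tb]; exists t; split => //.
  by rewrite lt.
move=> noS; exfalso.
have laa : len a a = 0%R by exact: len_refl.
have [] := @IVT R (fun t => len a t) a b s ab len_within_continuous.
  by rewrite laa min_l ?len_ge0// max_r ?len_ge0// s0.
move=> t tab lt; apply: (noS t); split => //.
move: tab; rewrite in_itv/= => /andP[at_ tb].
by rewrite -lt fineK// subcurve_length_fin.
Qed.

Lemma arc_param_len t : (a <= t)%R -> (t <= b)%R -> arc_param c (len a t) = c t.
Proof.
move=> at_ tb.
have [|u [au ub lu ->]] := @arc_paramP (len a t) (len_ge0 at_).
  exact: len_homo.
exact: same_len_same_point.
Qed.

Lemma arc_param_lip s t : (0 <= s)%R -> (s <= fine (clength c))%R ->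
  (0 <= t)%R -> (t <= fine (clength c))%R ->
  (mdist (arc_param c s) (arc_param c t) <= `|s - t|)%R.
Proof.
wlog st : s t / (s <= t)%R.
  move=> W s0 sL t0 tL; have [st|/ltW ts] := leP s t; first exact: W.
  by rewrite metric_sym distrC; exact: W.
move=> s0 sL t0 tL.
have [s' [as' sb' ls ->]] := arc_paramP s0 sL.
have [t' [at' tb' lt ->]] := arc_paramP t0 tL.
have [st'|ts'] := leP s' t'.
  apply: (le_trans (dist_le_len as' st' tb')).
  have := @lenD a s' t' (lexx _) as' st' tb'; rewrite ls lt => ->.
  by rewrite opprD addNKr normrN ger0_norm// len_ge0.
have -> : c s' = c t'; last by rewrite mdistxx.
apply: same_len_same_point => //; apply/eqP; rewrite eq_le ls lt st/= -ls -lt.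
exact: len_homo (ltW ts') sb'.
Qed.

End arc_length.

(** * Line integrals *)

Section lebesgue_translation.
Context {R : realType}.
Local Notation leb := (@lebesgue_measure R).

Lemma lebesgue_measure_shift (r : R) (A : set R) : measurable A ->
  leb ((fun x => r + x)%R @^-1` A) = leb A.
Proof.
move=> mA.
have mr : measurable_fun [set: measurableTypeR R]
    (fun x : measurableTypeR R => (r + x)%R : measurableTypeR R).
  exact: measurable_funD.
pose m_ : {measure set (measurableTypeR R) -> \bar R} :=
  pushforward leb (fun x : measurableTypeR R => (r + x)%R : measurableTypeR R).
pose m := m_ mr.
suff H B : ocitv B -> leb B = m B.
  by rewrite [RHS](lebesgue_measure_unique H mA).
move=> /ocitvP[->|]; first by rewrite !measure0.
move=> [[a b] /= ab ->]; rewrite /m /m_/= /pushforward.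
have -> : (fun x : R => r + x)%R @^-1` `]a, b]%classic = `](a - r)%R, (b - r)%R]%classic.
  by apply/seteqP; split => x; rewrite /= !in_itv/=; lra.
by rewrite !lebesgue_measure_itv/= !lte_fin ltrD2r ab -!EFinB; congr EFin; ring.
Qed.

Lemma ge0_integral_shift (r a b : R) (f : R -> \bar R) :
  measurable_fun `[(r + a)%R, (r + b)%R] f ->
  (forall x, x \in `[(r + a)%R, (r + b)%R] -> 0 <= f x) ->
  \int[leb]_(x in `[a, b]) f (r + x)%R =
  \int[leb]_(x in `[(r + a)%R, (r + b)%R]) f x.
Proof.
move=> mf f0.
have mr : measurable_fun [set: measurableTypeR R]
    (fun x : measurableTypeR R => (r + x)%R : measurableTypeR R).
  exact: measurable_funD.
have -> : `[a, b]%classic = (fun x : R => r + x)%R @^-1` `[(r + a)%R, (r + b)%R]%classic.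
  by apply/seteqP; split => x; rewrite /= !in_itv/= !lerD2l.
rewrite -(@ge0_integral_pushforward _ _ (measurableTypeR R) (measurableTypeR R) R _ mr leb)//; last first.
  by move=> x; rewrite inE; exact: f0.
apply: eq_measure_integral => //= A mA _.
exact: (lebesgue_measure_shift r mA).
Qed.

End lebesgue_translation.

Section line_integral_theory.
Context {d} {R : realType} {X : completeBorelMetricType d R}.
Local Notation leb := (@lebesgue_measure R).
Implicit Types (A : set X) (c : curve X) (g : X -> \bar R).

Lemma open_measurableX (A : set X) : open A -> measurable A.
Proof. by move=> oA; rewrite borelE; exact: sub_sigma_algebra. Qed.

Lemma compact_measurableX (A : set X) : compact A -> measurable A.
Proof.
move=> cA; rewrite -(setCK A); apply: measurableC; apply: open_measurableX.
by apply: closed_openC; apply: compact_closed => //; exact: metric_hausdorff.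
Qed.

Lemma arc_param_in A c s : rectifiable c -> curve_in A c ->
  (0 <= s)%R -> (s <= fine (clength c))%R -> A (arc_param c s).
Proof.
move=> rc cA s0 sL; have [t [at_ tb _ ->]] := arc_paramP rc s0 sL.
by apply: cA; rewrite in_itv/= at_ tb.
Qed.

(** The arc-length parametrization is 1-Lipschitz: the preimage of an open set is
    the trace of the open set of reals [W] near which this bound keeps the curve
    in the set. *)
Lemma measurable_arc_param c : rectifiable c ->
  measurable_fun `[0%R, fine (clength c)] (arc_param c).
Proof.
move=> rc; apply: (measurability _ borelE) => _ [U oU <-].
pose W := [set t : R | exists s r : R, [/\ (0 < r)%R, (0 <= s <= fine (clength c))%R,
   ball (arc_param c s) r `<=` U & ball s r t]].
have -> : `[0%R, fine (clength c)] `&` arc_param c @^-1` U =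
          `[0%R, fine (clength c)] `&` W.
  apply/seteqP; split => t [/=]; rewrite in_itv/= => tL.
    move=> Ut; split => //.
    have /nbhs_ballP[r /= r0 rU] := open_nbhs_nbhs (conj oU Ut).
    by exists t, r; split => //; exact: ballxx.
  move=> [s [r [r0 /andP[s0 sL] rU st]]]; split => //; apply: rU.
  move/andP : tL => [t0 tL].
  by rewrite ballEmdist/=; apply: le_lt_trans (arc_param_lip rc s0 sL t0 tL) _.
apply: measurableI => //; apply: open_measurable.
rewrite openE => t [s [r [r0 sL rU st]]].
apply/nbhs_ballP; exists (r - `|s - t|)%R; first by rewrite /= subr_gt0.
move=> u; rewrite /ball/= => tu; exists s, r; split => //; rewrite /ball/=.
have -> : (s - u = (s - t) + (t - u))%R by rewrite addrA subrK.
by apply: (le_lt_trans (ler_normD _ _)); lra.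
Qed.

Lemma measurable_along A c g : measurable A -> measurable_fun A g ->
  rectifiable c -> curve_in A c ->
  measurable_fun `[0%R, fine (clength c)] (g \o arc_param c).
Proof.
move=> mA mg rc cA; apply: (measurable_comp mA) => //; last exact: measurable_arc_param.
by move=> y [s + <-]; rewrite /= in_itv/= => /andP[s0 sL]; exact: arc_param_in.
Qed.

(** A subarc is again a curve, and the line integral along it is the integral
    of the integrand over the corresponding arc-length interval of the whole
    curve. *)
Lemma line_integral_subcurve A c g (t1 t2 : R) :
  measurable A -> measurable_fun A g ->
  (forall x, A x -> 0 <= g x) -> rectifiable c -> curve_in A c ->
  (cleft c <= t1)%R -> (t1 <= t2)%R -> (t2 <= cright c)%R ->
  let len t := fine (curve_length c (cleft c) t) in
  rectifiable (Curve t1 t2 c) /\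
  line_integral (Curve t1 t2 c) g =
    \int[leb]_(s in `[len t1, len t2]) g (arc_param c s).
Proof.
move=> mA mg g0 rc cA at1 t12 tb2 len.
have at2 := le_trans at1 t12; have tb1 := le_trans t12 tb2.
have rc' : rectifiable (Curve t1 t2 c).
  split => //=; last by rewrite ltey_eq (subcurve_length_fin rc).
  apply: continuous_subspaceW (let: And3 _ h _ := rc in h).
  by apply: subset_itv; rewrite bnd_simp.
split => //.
have lenE : fine (clength (Curve t1 t2 c)) = (len t2 - len t1)%R.
  by rewrite /clength/= /len (@lenD _ _ _ rc (cleft c) t1 t2)//; ring.
rewrite /line_integral lenE.
transitivity (\int[leb]_(s in `[0%R, (len t2 - len t1)%R]) g (arc_param c (len t1 + s)%R)).
  apply: eq_integral => s; rewrite inE/= in_itv/= => /andP[s0 ss]; congr g.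
  have [|u [/= t1u ut2 lu ->]] := arc_paramP rc' s0; first by rewrite lenE.
  have -> : (len t1 + s)%R = fine (curve_length c (cleft c) u).
    by rewrite (@lenD _ _ _ rc (cleft c) t1 u) ?lu// (le_trans ut2).
  by rewrite (arc_param_len rc)// ?(le_trans at1)// (le_trans ut2).
have := @ge0_integral_shift R (len t1) 0 (len t2 - len t1) (g \o arc_param c).
rewrite addr0 addrC subrK; apply.
- apply: measurable_funS (measurable_along mA mg rc cA) => //.
  by apply: subset_itv; rewrite bnd_simp; [exact: len_ge0|exact: len_homo].
- move=> x; rewrite in_itv/= => /andP[s1x xs2]; apply: g0.
  apply: arc_param_in => //; first by rewrite (le_trans _ s1x)// len_ge0.
  by rewrite (le_trans xs2)// len_homo.
Qed.

(** Inequalities that hold along all subarcs of a curve thus become inequalities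
    on all intervals of arc-length parameters. *)
Lemma subcurveP A c g (s1 s2 : R) : measurable A -> measurable_fun A g ->
  (forall x, A x -> 0 <= g x) -> rectifiable c -> curve_in A c ->
  (0 <= s1)%R -> (s1 <= s2)%R -> (s2 <= fine (clength c))%R ->
  exists t1 t2, let c' := Curve t1 t2 c in
    [/\ (cleft c <= t1)%R, (t1 <= t2)%R, (t2 <= cright c)%R, rectifiable c' &
      [/\ c t1 = arc_param c s1, c t2 = arc_param c s2 &
      line_integral c' g = \int[leb]_(s in `[s1, s2]) g (arc_param c s)]].
Proof.
move=> mA mg g0 rc cA s10 s12 s2L.
have s20 := le_trans s10 s12; have s1L := le_trans s12 s2L.
have [t1 [at1 tb1 l1 ct1]] := arc_paramP rc s10 s1L.
have [t2 [at2 tb2 l2 ct2]] : exists t2, [/\ (t1 <= t2)%R, (t2 <= cright c)%R,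
    fine (curve_length c (cleft c) t2) = s2 & arc_param c s2 = c t2].
  have [t2 [at2 tb2 l2 ct2]] := arc_paramP rc s20 s2L.
  have [t12|t21] := leP t1 t2; first by exists t2.
  have E : s1 = s2.
    apply/eqP; rewrite eq_le s12/= -l1 -l2.
    by apply: len_homo => //; exact: ltW.
  by exists t1; split => //; rewrite -E.
have [rc' lc'] := line_integral_subcurve mA mg g0 rc cA at1 at2 tb2.
by exists t1, t2; split => //; split => //; rewrite lc' l1 l2.
Qed.

End line_integral_theory.

Section integral_absolute_continuity.
Context {d} {T : measurableType d} {R : realType}.
Variable mu : {measure set T -> \bar R}.

(** Truncating [g] at a high level [n] loses little of its integral, and the
    truncated function has integral at most [n * mu S] over [S]. *)
Lemma integral_abs_continuity (D : set T) (g : T -> \bar R) (e : R) :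
  measurable D -> measurable_fun D g -> (forall x, D x -> 0 <= g x) ->
  \int[mu]_(x in D) g x < +oo -> (0 < e)%R ->
  exists2 dl : R, (0 < dl)%R & forall S, measurable S -> S `<=` D ->
    mu S < dl%:E -> \int[mu]_(x in S) g x <= e%:E.
Proof.
move=> mD mg g0 goo e0.
have e20 : (0 < e / 2)%R by rewrite divr_gt0.
pose f (n : nat) x := mine (g x) n%:R%:E.
have mf n : measurable_fun D (f n) by exact: measurable_mine.
have f0 n x : D x -> 0 <= f n x by move=> Dx; rewrite le_min g0//= lee_fin.
have fcvg : \int[mu]_(x in D) f n x @[n --> \oo] --> \int[mu]_(x in D) g x.
  have -> : \int[mu]_(x in D) g x = \int[mu]_(x in D) limn (f^~ x).
    apply: eq_integral => x /set_mem Dx; apply/esym/cvg_lim => //.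
    have := g0 _ Dx; rewrite /f; case: (g x) => [r r0| _ |//].
      apply: cvg_near_cst; near=> n; rewrite min_l// lee_fin.
      by near: n; exact: nbhs_infty_ger.
    rewrite (_ : (fun n => _) = (fun n : nat => n%:R%:E)); last first.
      by apply/funext => n; rewrite min_r// leey.
    exact/cvgeryP/cvgr_idn.
  apply: cvg_monotone_convergence => // x Dx m n mn.
  by rewrite /f le_min ge_min lexx/= ge_min lee_fin ler_nat mn orbT.
have gfin : \int[mu]_(x in D) g x \is a fin_num.
  by rewrite ge0_fin_numE// integral_ge0.
have [n Hn] : exists n, \int[mu]_(x in D) g x - (e / 2)%:E < \int[mu]_(x in D) f n x.
  have lt1 : \int[mu]_(x in D) g x - (e / 2)%:E < \int[mu]_(x in D) g x.
    by rewrite lteBlDr// lteDl// lte_fin.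
  have nV : nbhs (\int[mu]_(x in D) g x)
      [set y | \int[mu]_(x in D) g x - (e / 2)%:E < y].
    by apply: open_nbhs_nbhs; split; [exact: open_ereal_gt_ereal|exact: lt1].
  by have [n _ /(_ n (leqnn n))] := fcvg _ nV; exists n.
exists (e / 2 / n.+1%:R)%R; first by rewrite divr_gt0.
move=> S mS SD muS.
have mDS : measurable (D `\` S) by exact: measurableD.
have dis : [disjoint S & D `\` S] by apply/disj_setPS => x [? []].
have split h : measurable_fun D h -> (forall x, D x -> 0 <= h x) ->
    \int[mu]_(x in D) h x = \int[mu]_(x in S) h x + \int[mu]_(x in D `\` S) h x.
  by move=> mh h0; rewrite -ge0_integral_setU ?setDUK.
have fSn : \int[mu]_(x in S) f n x <= (e / 2)%:E.
  apply: (@le_trans _ _ (\int[mu]_(x in S) (cst n%:R%:E) x)).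
    by apply: le_integral_gen => x Sx; rewrite ge_min lexx orbT.
  rewrite integral_cst//; apply: (@le_trans _ _ (n%:R%:E * (e / 2 / n.+1%:R)%:E)).
    by rewrite lee_pmul// ?lee_fin// ltW.
  rewrite -EFinM lee_fin mulrA ler_pdivrMr// mulrC ler_wpM2l ?ler_nat//.
  exact: ltW.
move: Hn; rewrite (split g)// (split (f n))//; last by move=> x; exact: f0.
set a := \int[mu]_(x in S) g x; set b := \int[mu]_(x in D `\` S) g x.
set a' := \int[mu]_(x in S) f n x; set b' := \int[mu]_(x in D `\` S) f n x.
have a0 : 0 <= a by apply: integral_ge0 => x /SD; exact: g0.
have b0 : 0 <= b by apply: integral_ge0 => x [/g0].
have a'0 : 0 <= a' by apply: integral_ge0 => x /SD; exact: f0.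
have b'0 : 0 <= b' by apply: integral_ge0 => x [/(f0 n)].
have b'b : b' <= b by apply: le_integral_gen => x _; rewrite ge_min lexx.
have : a + b < +oo by rewrite /a /b -split.
have : a' <= (e / 2)%:E by exact: fSn.
move: a b a' b' a0 b0 a'0 b'0 b'b => [a| |] [b| |] [a'| |] [b'| |] //=.
by rewrite -?EFinB -?EFinD ?lee_fin ?lte_fin => *; lra.
Unshelve. all: by end_near. Qed.

End integral_absolute_continuity.

Section minimum_along_a_curve.
Context {R : realType}.
Local Notation leb := (@lebesgue_measure R).
Implicit Types (f g h : R -> \bar R).

Lemma ge0_integral_itvD (a m b : R) f : (a <= m <= b)%R ->
  measurable_fun `[a, b] f -> (forall x, x \in `[a, b] -> 0 <= f x) ->
  \int[leb]_(x in `[a, b]) f x =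
  \int[leb]_(x in `[a, m]) f x + \int[leb]_(x in `[m, b]) f x.
Proof.
move=> /andP[am mb] mf f0.
have E : `[a, b]%classic = `[a, m]%classic `|` `]m, b]%classic :> set R.
  by rewrite -itv_bndbnd_setU// bnd_simp.
rewrite {1}E ge0_integral_setU//; last 3 first.
- by rewrite -E.
- by move=> x; rewrite -E => /f0.
- by apply/disj_setPS => x [/=]; rewrite !in_itv/= => /andP[_ xm] /andP[]; rewrite ltNge xm.
congr (_ + _); apply: integral_itv_obnd_cbnd.
by apply: measurable_funS mf => //; apply: subset_itv; rewrite bnd_simp.
Qed.

Lemma compact_disjoint_dist (K1 K2 : set R) : compact K1 -> compact K2 ->
  K1 `&` K2 = set0 ->
  exists2 dl : R, (0 < dl)%R & forall x y, K1 x -> K2 y -> (dl <= `|x - y|)%R.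
Proof.
move=> cK1 cK2 K12.
have K2c : closed K2 by apply: compact_closed => //; exact: Rhausdorff.
have /compact_near_coveringP/(_ _ (0%R^'+) (fun dl x => forall y, K2 y -> dl <= `|x - y|)%R) := cK1.
have key x : K1 x -> \forall x' \near x & i \near 0%R^'+,
    (fun dl x => forall y, K2 y -> dl <= `|x - y|)%R i x'.
  move=> K1x.
  have /nbhs_ballP[r /= r0 rK] : nbhs x (~` K2).
    apply: open_nbhs_nbhs; split; first exact: closed_openC.
    by move=> K2x; have : (K1 `&` K2) x by []; rewrite K12.
  exists (ball x (r / 2), [set i | i <= r / 2]%R).
    split => /=; first by apply: nbhsx_ballx; rewrite divr_gt0.
    by apply: nbhs_right_le; rewrite divr_gt0.
  move=> [x' i] /= [xx' ir] y K2y; apply: (le_trans ir); rewrite leNgt; apply/negP => x'y.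
  apply: (rK y) => //; rewrite /ball/= in xx' *.
  have -> : (x - y = (x - x') + (x' - y))%R by rewrite addrA subrK.
  by apply: (le_lt_trans (ler_normD _ _)); lra.
move=> /(_ _ key) H.
have [dl [H1 dl0]] : exists dl : R, (K1 `<=` (fun x => forall y, K2 y -> dl <= `|x - y|)%R) /\ (0 < dl)%R.
  near (0%R : R)^'+ => dl; exists dl; split; first by near: dl.
  by near: dl; exact: nbhs_right_gt.
by exists dl => // x y /H1; exact.
Unshelve. all: by end_near. Qed.

Lemma chain_le_integral (h : R -> R) (k : R -> \bar R) (L dl : R) (N : nat) :
  (0 <= dl)%R -> (N%:R * dl <= L)%R ->
  measurable_fun `[0%R, L] k -> (forall x, x \in `[0%R, L] -> 0 <= k x) ->
  (forall i, (i < N)%N -> `|h (i%:R * dl)%R - h (i.+1%:R * dl)%R|%:E <=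
     \int[leb]_(s in `[(i%:R * dl)%R, (i.+1%:R * dl)%R]) k s) ->
  `|h 0%R - h (N%:R * dl)%R|%:E <= \int[leb]_(s in `[0%R, (N%:R * dl)%R]) k s.
Proof.
move=> dl0 NL mk k0; elim: N NL => [|N IH] NL H.
  by rewrite mul0r subrr normr0 integral_ge0// => x /=;
    rewrite in_itv/= => /andP[x0 x00]; apply: k0;
    rewrite in_itv/= x0 (le_trans x00)// (le_trans _ NL)// mul0r.
have NL' : (N%:R * dl <= L)%R.
  by rewrite (le_trans _ NL)// ler_wpM2r// ler_nat.
have N01 : (0 <= N%:R * dl <= N.+1%:R * dl)%R.
  by rewrite mulr_ge0//= ler_wpM2r// ler_nat.
rewrite (ge0_integral_itvD N01); last 2 first.
- by apply: measurable_funS mk => //; apply: subset_itvl; rewrite bnd_simp.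
- move=> x; rewrite in_itv/= => /andP[x0 xN]; apply: k0.
  by rewrite in_itv/= x0 (le_trans xN).
apply: (@le_trans _ _ (`|h 0 - h (N%:R * dl)| + `|h (N%:R * dl) - h (N.+1%:R * dl)|)%:E).
  rewrite lee_fin.
  have -> : (h 0 - h (N.+1%:R * dl) =
    (h 0 - h (N%:R * dl)) + (h (N%:R * dl) - h (N.+1%:R * dl)))%R by ring.
  exact: ler_normD.
by rewrite EFinD; apply: leeD; [apply: IH => // i iN; apply: H; exact: ltnW|exact: H].
Qed.

(** The interval is cut into pieces so short that no piece meets both a compact
    part of the set where [g1] is the smaller function and a compact part of
    the set where [g2] is; on each piece the better of the two bounds is used,
    and the error lives on the small set left out by the two compact parts. *)
Lemma le_integral_min (h : R -> R) g1 g2 (L : R) : (0 <= L)%R ->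
  measurable_fun `[0%R, L] g1 -> measurable_fun `[0%R, L] g2 ->
  (forall x, x \in `[0%R, L] -> 0 <= g1 x) ->
  (forall x, x \in `[0%R, L] -> 0 <= g2 x) ->
  \int[leb]_(s in `[0%R, L]) g1 s < +oo ->
  \int[leb]_(s in `[0%R, L]) g2 s < +oo ->
  (forall s t, (0 <= s)%R -> (s <= t)%R -> (t <= L)%R ->
     `|h s - h t|%:E <= \int[leb]_(x in `[s, t]) g1 x) ->
  (forall s t, (0 <= s)%R -> (s <= t)%R -> (t <= L)%R ->
     `|h s - h t|%:E <= \int[leb]_(x in `[s, t]) g2 x) ->
  `|h 0%R - h L|%:E <= \int[leb]_(x in `[0%R, L]) mine (g1 x) (g2 x).
Proof.
move=> L0 mg1 mg2 g10 g20 g1oo g2oo hg1 hg2.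
set D := `[0%R, L]%classic : set R.
have mD : measurable D by exact: measurable_itv.
have Dfin : leb D < +oo.
  by rewrite lebesgue_measure_itv/=; case: ifP => _; rewrite ?ltry// -EFinB ltry.
have mmin : measurable_fun D (fun x => mine (g1 x) (g2 x)).
  exact: measurable_mine.
have msum : measurable_fun D (fun x => g1 x + g2 x) by exact: emeasurable_funD.
have sum0 x : D x -> 0 <= g1 x + g2 x by move=> Dx; rewrite adde_ge0// ?g10 ?g20.
have sumoo : \int[leb]_(x in D) (g1 x + g2 x) < +oo.
  by rewrite ge0_integralD//; exact: lte_add_pinfty.
apply/lee_addgt0Pr => e e0.
have [dl dl0 Hdl] :=
  @integral_abs_continuity _ (measurableTypeR R) R leb D _ e mD msum sum0 sumoo e0.
have dl20 : (0 < dl / 2)%R by rewrite divr_gt0.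
pose E := D `&` [set x | g1 x <= g2 x].
have mE : measurable E by exact: emeasurable_fun_le.
have mE' : measurable (D `\` E) by exact: measurableD.
have Efin : leb E < +oo.
  by apply: le_lt_trans Dfin; rewrite le_measure ?inE// => x [].
have E'fin : leb (D `\` E) < +oo.
  by apply: le_lt_trans Dfin; rewrite le_measure ?inE// => x [].
have [K1 [cK1 K1E EK1]] := lebesgue_regularity_inner mE Efin dl20.
have [K2 [cK2 K2E EK2]] := lebesgue_regularity_inner mE' E'fin dl20.
have mK1 : measurable K1 by exact: compact_measurable.
have mK2 : measurable K2 by exact: compact_measurable.
have K12 : K1 `&` K2 = set0.
  by apply/seteqP; split => // x [/K1E Ex /K2E[_]].
have [r r0 Hr] := compact_disjoint_dist cK1 cK2 K12.
pose S := D `\` (K1 `|` K2).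
have mS : measurable S by apply: measurableD => //; exact: measurableU.
have Ssmall : leb S < dl%:E.
  apply: (@le_lt_trans _ _ (leb ((E `\` K1) `|` ((D `\` E) `\` K2)))).
    rewrite le_measure ?inE//; first by apply: measurableU; exact: measurableD.
    move=> x [Dx /not_orP[K1x K2x]].
    by have [Ex|Ex] := pselect (E x); [left|right; split].
  apply: (@le_lt_trans _ _ (leb (E `\` K1) + leb ((D `\` E) `\` K2))).
    by apply: measureU2; exact: measurableD.
  by rewrite [dl]splitr EFinD; exact: lteD.
pose k x := mine (g1 x) (g2 x) + ((fun x => g1 x + g2 x) \_ S) x.
have SD : S `<=` D by move=> x [].
have mks : measurable_fun D ((fun x => g1 x + g2 x) \_ S).
  apply/(measurable_restrict _ mS mD).
  by apply: measurable_funS msum => // x [].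
have ks0 x : D x -> 0 <= ((fun x => g1 x + g2 x) \_ S) x.
  by move=> Dx; rewrite patchE; case: ifPn => // _; exact: sum0.
have mk : measurable_fun D k by exact: emeasurable_funD.
have min0 x : D x -> 0 <= mine (g1 x) (g2 x).
  by move=> Dx; rewrite le_min g10// g20.
have k0 x : D x -> 0 <= k x by move=> Dx; rewrite adde_ge0 ?ks0 ?min0.
apply: (@le_trans _ _ (\int[leb]_(x in D) k x)); last first.
  rewrite ge0_integralD// leeD2l//.
  by rewrite -integral_mkcondr setIidr//; exact: Hdl.
have [N LN] : exists N : nat, (L / r < N.+1%:R)%R.
  by exists (Num.truncn (L / r)); rewrite truncnS_gt.
pose st := (L / N.+1%:R)%R.
have st0 : (0 <= st)%R by rewrite divr_ge0.
have str : (st < r)%R by rewrite ltr_pdivrMr// mulrC -ltr_pdivrMr.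
have NstL : (N.+1%:R * st = L)%R by rewrite mulrC divfK.
rewrite /D -{1 2}NstL; apply: (@chain_le_integral _ _ L) => //.
  by rewrite NstL.
move=> i iN; set s := (i%:R * st)%R; set t := (i.+1%:R * st)%R.
have s0 : (0 <= s)%R by rewrite mulr_ge0.
have st_ : (s <= t)%R by rewrite ler_wpM2r// ler_nat.
have tL : (t <= L)%R by rewrite -NstL ler_wpM2r// ler_nat.
have ts : (t - s < r)%R by rewrite /t /s -mulrBl -natrB// subSnn mul1r.
have IN x : x \in `[s, t] -> D x.
  by rewrite /D/= !in_itv/= => /andP[sx xt]; rewrite (le_trans s0)// (le_trans xt).
have [K1I|K1I] := pselect (exists2 x, x \in `[s, t] & K1 x).
  apply: (le_trans (hg1 _ _ s0 st_ tL)); apply: le_integral_gen => x /= xst.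
  have K2x : ~ K2 x.
    move=> K2x; have [y yst K1y] := K1I.
    have := Hr _ _ K1y K2x; apply/negP; rewrite -ltNge.
    apply: le_lt_trans ts.
    by move: xst yst; rewrite !in_itv/= ler_norml; lra.
  have [K1x|K1x] := pselect (K1 x).
    rewrite /k min_l; first by rewrite leeDl// (ks0 _ (IN _ xst)).
    by have [] := K1E _ K1x.
  rewrite /k patchE ifT; last by rewrite inE; split; [exact: IN|case].
  by rewrite addeCA leeDl// adde_ge0 ?(min0 _ (IN _ xst)) ?(g20 _ (IN _ xst)).
apply: (le_trans (hg2 _ _ s0 st_ tL)); apply: le_integral_gen => x /= xst.
have K1x : ~ K1 x by move=> K1x; apply: K1I; exists x.
have [K2x|K2x] := pselect (K2 x).
  rewrite /k min_r; first by rewrite leeDl// (ks0 _ (IN _ xst)).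
  have [Dx Ex] := K2E _ K2x; rewrite leNgt; apply/negP => g12; apply: Ex.
  by split => //=; exact: ltW.
rewrite /k patchE ifT; last by rewrite inE; split; [exact: IN|case].
by rewrite addeA leeDr// adde_ge0 ?(min0 _ (IN _ xst)) ?(g10 _ (IN _ xst)).
Qed.

End minimum_along_a_curve.

(** * Modulus of curve families and weak upper gradients *)

Section modulus.
Context {d} {R : realType} {X : completeBorelMetricType d R}.
Variable mu : {measure set X -> \bar R}.
Local Notation leb := (@lebesgue_measure R).
Implicit Types (A : set X) (c : curve X) (g : X -> \bar R) (G : set (curve X)).

Definition admissible G (rho : X -> \bar R) :=
  [/\ measurable_fun setT rho, (forall x, 0 <= rho x) &
      forall c, G c -> rectifiable c -> 1 <= line_integral c rho].

Lemma modulus0P G : modulus1 mu G = 0 <-> forall e : R, (0 < e)%R ->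
  exists2 rho, admissible G rho & \int[mu]_x rho x <= e%:E.
Proof.
split=> [G0 e e0|H].
  have : modulus1 mu G < e%:E by rewrite G0 lte_fin.
  by move=> /ereal_inf_lt[_ [rho arho <-] /ltW le_e]; exists rho.
apply/eqP; rewrite eq_le; apply/andP; split; last first.
  apply: le_ereal_inf_tmp => _ [rho [_ rho0 _] <-].
  by apply: integral_ge0 => x _.
apply/lee_addgt0Pr => e e0; rewrite add0e; have [rho arho le_e] := H e e0.
by apply: ge_ereal_inf; exists (\int[mu]_x rho x) => //; exists rho.
Qed.

Lemma line_integral_le c g1 g2 : (forall x, g1 x <= g2 x) ->
  line_integral c g1 <= line_integral c g2.
Proof. by move=> g12; apply: le_integral_gen => s _. Qed.

Lemma modulus0_sub G G' : (forall c, G c -> rectifiable c -> G' c) ->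
  modulus1 mu G' = 0 -> modulus1 mu G = 0.
Proof.
move=> GG' /modulus0P H; apply/modulus0P => e /H[rho [mr r0 ar] le_e].
by exists rho => //; split => // c Gc rc; apply: ar => //; exact: GG'.
Qed.

Lemma modulus0_bigcup (G : nat -> set (curve X)) :
  (forall n, modulus1 mu (G n) = 0) -> modulus1 mu (\bigcup_n G n) = 0.
Proof.
move=> G0; apply/modulus0P => e e0.
have en n : (0 < e / (2 ^ n.+1)%:R)%R by rewrite divr_gt0// ltr0n expn_gt0.
have /choice[rho H] n : exists rho, admissible (G n) rho /\
    \int[mu]_x rho x <= (e / (2 ^ n.+1)%:R)%:E.
  by have /modulus0P/(_ _ (en n))[rho] := G0 n; exists rho.
have rho0 n x : 0 <= rho n x by have [[]] := H n.
have mrho n : measurable_fun setT (rho n) by have [[]] := H n.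
exists (fun x => \sum_(n <oo) rho n x).
  split.
  - have := @ge0_emeasurable_sum _ _ _ setT rho xpredT.
    by apply => // k x _ _; exact: rho0.
  - by move=> x; exact: nneseries_ge0.
  - move=> c [n _ Gc] rc; have [[_ _ ad] _] := H n.
    apply: le_trans (ad c Gc rc) _; apply: line_integral_le => x.
    rewrite (@nneseriesD1 _ _ n)//.
    by rewrite leeDl// nneseries_ge0.
rewrite integral_nneseries//.
apply: le_trans (epsilon_trick0 xpredT (ltW e0)).
apply: lee_nneseries => [n ? ?|n ?]; first exact: integral_ge0.
by have [] := H n.
Qed.

Lemma modulus0U G1 G2 : modulus1 mu G1 = 0 -> modulus1 mu G2 = 0 ->
  modulus1 mu (G1 `|` G2) = 0.
Proof.
move=> h1 h2; have := @modulus0_bigcup (fun n => if n is 0%N then G1 else G2).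
move=> H; apply: modulus0_sub (H _) => [c [Gc|Gc] _|[|n]//].
  by exists 0%N.
by exists 1%N.
Qed.

(** A curve is exceptional as soon as one of its subarcs is: a function that is
    admissible for the subarcs is admissible for the whole curves. *)
Lemma modulus0_supercurves G : modulus1 mu G = 0 ->
  modulus1 mu [set c | exists t1 t2, [/\ (cleft c <= t1)%R, (t1 <= t2)%R,
    (t2 <= cright c)%R & G (Curve t1 t2 c)]] = 0.
Proof.
move=> /modulus0P H; apply/modulus0P => e /H[rho [mr r0 ar] le_e].
exists rho => //; split => // c [t1 [t2 [at1 t12 tb2 Gc']]] rc.
have [] := @line_integral_subcurve _ _ _ setT c rho t1 t2 => //.
move=> rc' lc'; apply: le_trans (ar _ Gc' rc') _; rewrite lc'.
rewrite /line_integral; apply: ge0_subset_integral => //.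
- exact: (@measurable_along _ _ _ setT).
- apply: subset_itv; rewrite bnd_simp.
    by rewrite len_ge0.
  by apply: len_homo => //; exact: le_trans t12.
Qed.

(** Any positive multiple of [g] is admissible for these curves. *)
Lemma modulus0_infinite A g : open A -> measurable_fun A g ->
  (forall x, A x -> 0 <= g x) -> \int[mu]_(x in A) g x < +oo ->
  modulus1 mu [set c | curve_in A c /\ line_integral c g = +oo] = 0.
Proof.
move=> oA mg g0 goo; have mA := open_measurableX oA.
apply/modulus0P => e e0; pose I := fine (\int[mu]_(x in A) g x).
have IE : \int[mu]_(x in A) g x = I%:E.
  by rewrite fineK// ge0_fin_numE// integral_ge0.
have I0 : (0 <= I)%R by rewrite fine_ge0// integral_ge0.
pose k := (e / (I + 1))%R; have k0 : (0 < k)%R by rewrite divr_gt0// ltr_wpDl.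
have mgA : measurable_fun setT (g \_ A).
  by apply/(measurable_restrictT _ mA).
have gA0 x : 0 <= (g \_ A) x by rewrite patchE; case: ifPn => // /set_mem /g0.
exists (fun x => k%:E * (g \_ A) x).
  split; first exact: measurable_funeM.
    by move=> x; rewrite mule_ge0// lee_fin ltW.
  move=> c [cA lc] rc; rewrite /line_integral.
  rewrite ge0_integralZl_EFin//; last exact: ltW.
    rewrite (_ : \int[_]_(s in _) _ = line_integral c g).
      by rewrite lc gt0_muley ?lte_fin// leey.
    apply: eq_integral => s; rewrite inE/= in_itv/= => /andP[s0 sL].
    by rewrite patchE mem_set//; exact: arc_param_in.
  exact: (@measurable_along _ _ _ setT).
rewrite ge0_integralZl_EFin//; last exact: ltW.
rewrite -integral_mkcond IE -EFinM lee_fin /k mulrAC ler_pdivrMr ?ltr_wpDl//.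
by rewrite ler_wpM2l ?ltW// ltrDl.
Qed.

End modulus.

Section weak_upper_gradients.
Context {d} {R : realType} {X : completeBorelMetricType d R}.
Variable mu : {measure set X -> \bar R}.
Variable A : set X.
Hypothesis oA : open A.
Local Notation leb := (@lebesgue_measure R).
Implicit Types (c : curve X) (g : X -> \bar R) (u : X -> R).
Local Notation wug := (weak_upper_gradient mu A).

Let mA : measurable A. Proof. exact: open_measurableX. Qed.

Lemma wug_comb (a b : R) u v g h : (0 <= a)%R -> (0 <= b)%R ->
  wug u g -> wug v h ->
  wug (fun x => a * u x + b * v x)%R (fun x => a%:E * g x + b%:E * h x).
Proof.
move=> a0 b0 [mg g0 [G G0 Gu]] [mh h0 [H H0 Hv]]; split.
- by apply: emeasurable_funD; exact: measurable_funeM.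
- by move=> x Ax; rewrite adde_ge0// mule_ge0 ?lee_fin ?g0 ?h0.
- exists (G `|` H); first exact: modulus0U.
  move=> c rc cA /not_orP[Gc Hc].
  have := Gu c rc cA Gc; have := Hv c rc cA Hc; rewrite /upper_gradient_along.
  have mgc := measurable_along mA mg rc cA.
  have mhc := measurable_along mA mh rc cA.
  have gc0 s : s \in `[0%R, fine (clength c)] -> 0 <= g (arc_param c s).
    by rewrite in_itv/= => /andP[s0 sL]; apply: g0; exact: arc_param_in.
  have hc0 s : s \in `[0%R, fine (clength c)] -> 0 <= h (arc_param c s).
    by rewrite in_itv/= => /andP[s0 sL]; apply: h0; exact: arc_param_in.
  have -> : line_integral c (fun x => a%:E * g x + b%:E * h x) =
      a%:E * line_integral c g + b%:E * line_integral c h.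
    rewrite /line_integral ge0_integralD//.
    - by rewrite !ge0_integralZl_EFin.
    - by move=> s sL; rewrite mule_ge0 ?lee_fin ?gc0.
    - exact: measurable_funeM.
    - by move=> s sL; rewrite mule_ge0 ?lee_fin ?hc0.
    - exact: measurable_funeM.
  move=> hv hu; apply: (@le_trans _ _
    (a%:E * `|u (c (cleft c)) - u (c (cright c))|%:E +
     b%:E * `|v (c (cleft c)) - v (c (cright c))|%:E)); last first.
    by apply: leeD; apply: lee_wpmul2l; rewrite ?lee_fin.
  rewrite -!EFinM -EFinD lee_fin -[in leRHS](ger0_norm a0) -[in leRHS](ger0_norm b0).
  rewrite -!normrM; apply: le_trans (ler_normD _ _).
  by rewrite le_eqVlt; apply/orP; left; apply/eqP; congr `|_|%R; ring.
Qed.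

(** Outside of a family of modulus zero, all subarcs of a curve satisfy both upper
    gradient inequalities and both line integrals are finite, so that
    [le_integral_min] applies. *)
Lemma wug_min u g1 g2 : wug u g1 -> wug u g2 ->
  \int[mu]_(x in A) g1 x < +oo -> \int[mu]_(x in A) g2 x < +oo ->
  wug u (fun x => mine (g1 x) (g2 x)).
Proof.
move=> [mg1 g10 [G1 G10 G1u]] [mg2 g20 [G2 G20 G2u]] g1oo g2oo; split.
- exact: measurable_mine.
- by move=> x Ax; rewrite le_min g10// g20.
pose sup G := [set c : curve X | exists t1 t2, [/\ (cleft c <= t1)%R,
  (t1 <= t2)%R, (t2 <= cright c)%R & G (Curve t1 t2 c)]].
pose inf g := [set c | curve_in A c /\ line_integral c g = +oo].
exists ((sup G1 `|` sup G2) `|` (inf g1 `|` inf g2)).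
  apply: modulus0U; apply: modulus0U;
    [exact: modulus0_supercurves|exact: modulus0_supercurves| |];
    exact: modulus0_infinite.
move=> c rc cA /not_orP[/not_orP[sG1 sG2] /not_orP[ig1 ig2]].
set L := fine (clength c).
have L0 : (0 <= L)%R by rewrite fine_ge0// curve_length_ge0//; case: rc.
have [cab _ _] := rc.
have lend : arc_param c 0%R = c (cleft c).
  by rewrite -[0%R in LHS](len_refl rc (lexx _) cab) (arc_param_len rc).
have rend : arc_param c L = c (cright c) by rewrite (arc_param_len rc).
rewrite /upper_gradient_along -lend -rend.
have bound g G : measurable_fun A g -> (forall x, A x -> 0 <= g x) ->
    (forall c, rectifiable c -> curve_in A c -> ~ G c -> upper_gradient_along u g c) ->
    ~ sup G c -> forall s t, (0 <= s)%R -> (s <= t)%R -> (t <= L)%R ->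
    `|u (arc_param c s) - u (arc_param c t)|%:E <=
      \int[leb]_(x in `[s, t]) g (arc_param c x).
  move=> mg g0 Gu sG s t s0 st tL.
  have [t1 [t2 [at1 t12 tb2 rc' [<- <- <-]]]] :=
    subcurveP mA mg g0 rc cA s0 st tL.
  apply: Gu => //; last by move=> Gc'; apply: sG; exists t1, t2.
  move=> r /=; rewrite in_itv/= => /andP[t1r rt2]; apply: cA.
  by rewrite in_itv/= (le_trans at1)// (le_trans rt2).
apply: (@le_integral_min _ (u \o arc_param c) (g1 \o arc_param c) (g2 \o arc_param c)) => //.
- exact: (measurable_along mA mg1 rc cA).
- exact: (measurable_along mA mg2 rc cA).
- by move=> s; rewrite in_itv/= => /andP[s0 sL]; apply: g10; exact: arc_param_in.
- by move=> s; rewrite in_itv/= => /andP[s0 sL]; apply: g20; exact: arc_param_in.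
- by rewrite ltey; apply/eqP => h; apply: ig1.
- by rewrite ltey; apply/eqP => h; apply: ig2.
- exact: bound G1u sG1.
- exact: bound G2u sG2.
Qed.

(** Dominated convergence along almost every curve, where the line integral of
    the first function is finite. *)
Lemma wug_nonincreasing_lim u (g : nat -> X -> \bar R) :
  (forall n, wug u (g n)) -> (forall x, nonincreasing_seq (g ^~ x)) ->
  \int[mu]_(x in A) g 0%N x < +oo ->
  wug u (fun x => limn (g ^~ x)).
Proof.
move=> wg gn g0oo.
have mg n : measurable_fun A (g n) by case: (wg n).
have g0 n x : A x -> 0 <= g n x by case: (wg n) => _ + _; apply.
have cg x : g ^~ x @ \oo --> limn (g ^~ x) by exact: ereal_nonincreasing_is_cvgn.
have ml : measurable_fun A (fun x => limn (g ^~ x)).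
  by apply: (emeasurable_fun_cvg g) => // x _; exact: cg.
have l0 x : A x -> 0 <= limn (g ^~ x).
  by move=> Ax; apply: lime_ge; [exact: cg|apply: nearW => n; exact: g0].
split => //.
have /choice[G HG] n : exists G, modulus1 mu G = 0 /\ forall c, rectifiable c ->
    curve_in A c -> ~ G c -> upper_gradient_along u (g n) c.
  by have [_ _ [G]] := wg n; exists G.
exists ((\bigcup_n G n) `|` [set c | curve_in A c /\ line_integral c (g 0%N) = +oo]).
  apply: modulus0U; last by apply: modulus0_infinite => // x; exact: g0.
  by apply: modulus0_bigcup => n; have [] := HG n.
move=> c rc cA /not_orP[Gc ic].
have mgc n : measurable_fun `[0%R, fine (clength c)] (g n \o arc_param c).
  exact: (measurable_along mA (mg n) rc cA).
have gc0 n s : s \in `[0%R, fine (clength c)] -> 0 <= g n (arc_param c s).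
  by rewrite in_itv/= => /andP[s0 sL]; apply: g0; exact: arc_param_in.
have : \int[leb]_(s in `[0%R, fine (clength c)]) (g n \o arc_param c) s @[n --> \oo] -->
    \int[leb]_(s in `[0%R, fine (clength c)]) ((fun x => limn (g ^~ x)) \o arc_param c) s.
  have ig0 : leb.-integrable `[0%R, fine (clength c)] (g 0%N \o arc_param c).
    apply/integrableP; split; first exact: mgc.
    apply: (@le_lt_trans _ _ (line_integral c (g 0%N))).
      by apply: le_integral_gen => s sL; rewrite /= gee0_abs// gc0.
    by rewrite ltey; apply/eqP => h; apply: ic.
  have [] // := @dominated_convergence _ (measurableTypeR R) R leb
    `[0%R, fine (clength c)]%classic (measurable_itv _)
    (fun n => g n \o arc_param c) ((fun x => limn (g ^~ x)) \o arc_param c)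
    (g 0%N \o arc_param c) mgc (measurable_along mA ml rc cA) _ ig0.
  - by apply: aeW => s _; exact: cg.
  - by apply: aeW => s n sL; rewrite /= gee0_abs ?gc0//; exact: gn.
move=> cvgl; rewrite /upper_gradient_along.
apply: (@le_trans _ _ (limn (fun n =>
    \int[leb]_(s in `[0%R, fine (clength c)]) (g n \o arc_param c) s))); last first.
  by rewrite (cvg_lim (@ereal_hausdorff R) cvgl).
apply: lime_ge; first by apply/cvg_ex; eexists; exact: cvgl.
apply: nearW => n; have [_ H] := HG n; apply: H => // Gnc.
by apply: Gc; exists n.
Qed.

(** Minima of a minimizing sequence decrease to a minimal weak upper gradient.
    Since only minimal weak upper gradients enter the total variation, this is
    needed to bound it by means of any other weak upper gradient. *)
Lemma min_wug_exists u g : wug u g ->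
  exists2 g', min_weak_upper_gradient mu A u g' &
    \int[mu]_(x in A) g' x <= \int[mu]_(x in A) g x.
Proof.
move=> wg; suff [g' [wg' Hg']] : exists g', min_weak_upper_gradient mu A u g'.
  by exists g' => //; apply: Hg'.
pose S := [set \int[mu]_(x in A) h x | h in wug u].
pose I := ereal_inf S.
have SI h : wug u h -> I <= \int[mu]_(x in A) h x.
  by move=> wh; apply: ereal_inf_lbound; exists h.
have I0 : 0 <= I.
  by apply: le_ereal_inf_tmp => _ [h [_ h0 _] <-]; exact: integral_ge0.
have [Ioo|Ifin] := eqVneq I +oo.
  exists g; split => // h wh; apply: le_trans (SI _ wh).
  by rewrite Ioo leey.
have If : I \is a fin_num by rewrite ge0_fin_numE// ltey.
have /choice[f Hf] n : exists f, wug u f /\ \int[mu]_(x in A) f x < I + (n.+1%:R^-1)%:E.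
  have : I < I + (n.+1%:R^-1)%:E by rewrite lteDl// lte_fin.
  by move=> /ereal_inf_lt[_ [h wh <-] hI]; exists h.
pose G := fix G n := if n is m.+1 then fun x => mine (G m x) (f m.+1 x) else f 0%N.
have Gf n x : G n x <= f n x by case: n => [|n] //=; rewrite ge_min lexx orbT.
have foo n : \int[mu]_(x in A) f n x < +oo.
  have [_ /lt_le_trans] := Hf n; apply; exact: leey.
have Goo n : \int[mu]_(x in A) G n x < +oo.
  by apply: le_lt_trans (foo n); apply: le_integral_gen => x _; exact: Gf.
have wG n : wug u (G n).
  elim: n => [|n IH] /=; first by have [] := Hf 0%N.
  by apply: wug_min => //; have [] := Hf n.+1.
have nG x : nonincreasing_seq (G ^~ x).
  by apply/nonincreasing_seqP => n /=; rewrite ge_min lexx.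
have wl : wug u (fun x => limn (G ^~ x)).
  by apply: wug_nonincreasing_lim => //; exact: Goo 0%N.
exists (fun x => limn (G ^~ x)); split => // h wh.
apply: le_trans (SI _ wh); apply/lee_addgt0Pr => e e0.
have [n Hn] : exists n : nat, (n.+1%:R^-1 < e)%R.
  by exists (Num.truncn e^-1); rewrite invf_plt ?posrE// truncnS_gt.
apply: (@le_trans _ _ (\int[mu]_(x in A) f n x)); last first.
  have [_ /ltW/le_trans] := Hf n; apply; rewrite leeD2l// lee_fin; exact: ltW.
apply: le_integral_gen => x _; apply: le_trans (Gf n x).
apply: lime_le; first exact: ereal_nonincreasing_is_cvgn.
by exists n => // m /= nm; exact: nG.
Qed.

End weak_upper_gradients.

(** * Doubling measures *)

Section doubling_spaces.
Context {d} {R : realType} {X : completeBorelMetricType d R}.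
Variable mu : {measure set X -> \bar R}.
Hypothesis dbl : doubling mu.

Lemma ball_measurableX (x : X) (r : R) : measurable (ball x r).
Proof.
apply: open_measurableX; rewrite openE => y; rewrite ballEmdist/= => xy.
apply/nbhs_ballP; exists (r - mdist x y)%R; rewrite /= ?subr_gt0// => z.
rewrite !ballEmdist/= => yz.
by apply: le_lt_trans (metric_triangle x y z) _; lra.
Qed.

Lemma ball_measure_gt0 (x : X) (r : R) : (0 < r)%R -> 0 < mu (ball x r).
Proof.
move=> r0; have [c _ /(_ x (r / 2)%R)] := dbl.
by rewrite divr_gt0// mulrC divfK// => /(_ isT)[].
Qed.

Lemma ball_measure_lty (x : X) (r : R) : mu (ball x r) < +oo.
Proof.
have [r0|r0] := ltP 0%R r; last first.
  have -> : ball x r = set0.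
    apply/seteqP; split => // y; rewrite ballEmdist/=.
    by rewrite ltNge (le_trans r0)// mdist_ge0.
  by rewrite measure0.
have [c _ /(_ x (r / 2)%R)] := dbl.
rewrite divr_gt0// mulrC divfK// => /(_ isT)[_ h1 h2].
exact: le_lt_trans h1 h2.
Qed.

Lemma doubling_iter : exists2 c : R, (0 < c)%R & forall k (x : X) (r : R),
  (0 < r)%R -> mu (ball x (2 ^+ k * r)%R) <= (c ^+ k)%:E * mu (ball x r).
Proof.
have [c c1 H] := dbl; have c0 : (0 < c)%R by exact: lt_le_trans c1.
exists c => //; elim=> [|k IH] x r r0; first by rewrite expr0 mul1r mul1e.
rewrite exprS -mulrA; have r'0 : (0 < 2 ^+ k * r)%R by rewrite mulr_gt0// exprn_gt0.
have [_ h _] := H x _ r'0; apply: (le_trans h).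
by rewrite exprS EFinM -muleA lee_pmul2l ?lte_fin// IH.
Qed.

(** Disjoint balls of radius [e / 2] centred in a ball have measure bounded
    below by doubling, so only finitely many of them fit. *)
Lemma ball_finite_net (x : X) (r e : R) : (0 < r)%R -> (0 < e)%R ->
  exists s : seq X, forall y, ball x r y -> exists2 z, z \in s & ball z e y.
Proof.
move=> r0 e0; apply: contrapT => nonet.
have /choice[f Hf] (s : seq X) : exists y, ball x r y /\
    forall z, z \in s -> ~ ball z e y.
  apply: contrapT => nos; apply: nonet; exists s => y xy.
  apply: contrapT => h; apply: nos; exists y; split => // z zs zy.
  by apply: h; exists z.
pose S := fix S n : seq X := if n is m.+1 then f (S m) :: S m else [::].
pose y n := f (S n).
have yS i j : (i < j)%N -> y i \in S j.
  elim: j => // j IH; rewrite ltnS leq_eqVlt => /predU1P[->|/IH] /=.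
    by rewrite inE eqxx.
  by rewrite inE => ->; rewrite orbT.
have sep i j : (i < j)%N -> ~ ball (y i) e (y j).
  by move=> ij; have [_ h] := Hf (S j); apply: h; exact: yS.
have xy n : ball x r (y n) by have [] := Hf (S n).
pose B n := ball (y n) (e / 2).
have e20 : (0 < e / 2)%R by rewrite divr_gt0.
have disj : trivIset setT B.
  apply/trivIsetP => i j _ _; wlog ij : i j / (i < j)%N.
    move=> W ij; have := ij; rewrite neq_ltn => /orP[h|h]; first exact: W.
    by rewrite setIC; apply: W => //; rewrite eq_sym.
  move=> _; apply/seteqP; split => // z [].
  rewrite /B !ballEmdist/= => iz jz.
  apply: (sep _ _ ij); rewrite ballEmdist/=.
  by have := metric_triangle (y i) z (y j); rewrite (metric_sym z); lra.
have mB n : measurable (B n) by exact: ball_measurableX.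
have [c c0 Hc] := doubling_iter.
have [k Hk] : exists k, (2 * r <= 2 ^+ k * (e / 2))%R.
  exists (Num.truncn (2 * r / (e / 2))).+1.
  rewrite -ler_pdivrMr//; apply: ltW; apply: lt_trans (truncnS_gt _) _.
  by rewrite -natrX ltr_nat ltn_expl.
have lb n : mu (ball x r) <= (c ^+ k)%:E * mu (B n).
  apply: le_trans (Hc k (y n) _ e20); apply: le_measure; rewrite ?inE//;
    [exact: ball_measurableX|exact: ball_measurableX|].
  move=> z; have := xy n; rewrite !ballEmdist/= => h1 h2.
  by have := metric_triangle (y n) x z; rewrite (metric_sym (y n) x); lra.
have ub n : (\sum_(0 <= i < n) mu (B i)) <= mu (ball x (r + e)%R).
  rewrite big_mkord -measure_semi_additive_ord_I//; last 2 first.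
  - exact: sub_trivIset disj.
  - exact: bigsetU_measurable.
  apply: le_measure; rewrite ?inE//; [exact: bigsetU_measurable|exact: ball_measurableX|].
  move=> z; rewrite -bigcup_mkord => -[i /= _]; have := xy i.
  rewrite /B !ballEmdist/= => h1 h2.
  by have := metric_triangle x (y i) z; lra.
have mfin : mu (ball x r) \is a fin_num by rewrite ge0_fin_numE// ball_measure_lty.
have Mfin : mu (ball x (r + e)%R) \is a fin_num by rewrite ge0_fin_numE// ball_measure_lty.
have Bfin n : mu (B n) \is a fin_num by rewrite ge0_fin_numE// ball_measure_lty.
pose m := fine (mu (ball x r)); pose M := fine (mu (ball x (r + e)%R)).
have m0 : (0 < m)%R.
  by rewrite fine_gt0// ball_measure_gt0// ball_measure_lty.
have lb' n : ((m / c ^+ k)%:E <= mu (B n))%E.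
  have := lb n; rewrite -(fineK (Bfin n)) -(fineK mfin) -EFinM !lee_fin => h.
  by rewrite ler_pdivrMr ?exprn_gt0// mulrC.
have ub' n : (n%:R * (m / c ^+ k) <= M)%R.
  rewrite -lee_fin /M fineK//; apply: le_trans (ub n).
  rewrite mulr_natl -[n in (_ *+ n)%R]subn0 -sumr_const_nat -sumEFin.
  by apply: lee_sum => i _.
have mc0 : (0 < m / c ^+ k)%R by rewrite divr_gt0// exprn_gt0.
have := ub' (Num.truncn (M / (m / c ^+ k))).+1.
by rewrite -ler_pdivlMr// leNgt truncnS_gt.
Qed.

Lemma ultra_seq_bigcup (T : Type) (I : eqType) (F : set_system T) (s : seq I)
    (B : I -> set T) : UltraFilter F -> F [set y | exists2 z, z \in s & B z y] ->
  exists2 z, z \in s & F (B z).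
Proof.
move=> FU; elim: s => [|z s IH] FB.
  by exfalso; apply: (@filter_not_empty _ F); apply: filterS FB => y [].
have [FBz|FBz] := in_ultra_setVsetC (B z) FU; first by exists z; rewrite // inE eqxx.
have [|w ws FBw] := IH.
  apply: filterS (filterI FB FBz) => y [[w]].
  by rewrite inE => /predU1P[->//|ws] Bw _; exists w.
by exists w => //; rewrite inE ws orbT.
Qed.

(** By [ball_finite_net] an ultrafilter on a bounded set contains balls of all
    radii; it is Cauchy, and converges by completeness. *)
Lemma closed_bounded_compact (K : set X) (x : X) (r : R) :
  closed K -> K `<=` ball x r -> compact K.
Proof.
move=> clK Kr; rewrite compact_ultra => F FU FK.
have [r0|r0] := ltP 0%R r; last first.
  exfalso; apply: (@filter_not_empty _ F); apply: filterS FK => y /Kr.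
  by rewrite ballEmdist/= ltNge (le_trans r0)// mdist_ge0.
have cF : cauchy F.
  apply: cauchy_exP => e e0; have [s Hs] := ball_finite_net x r0 e0.
  have [|z _ Fz] := @ultra_seq_bigcup _ _ F s (fun z => ball z e) FU.
    by apply: filterS FK => y /Kr /Hs.
  by exists z.
have := cauchy_cvg F cF; set l := lim F => Fl; exists l; split; last exact: Fl.
apply: clK => U Ul; have FUK : F (K `&` U) by apply: filterI => //; exact: Fl.
exact: filter_ex FUK.
Qed.

(** The points at distance at least [1 / (n + 1)] from the complement form a
    closed and bounded, hence compact, set. *)
Lemma bounded_exhaustion (A : set X) : open A -> metric_bounded A ->
  exists K : nat -> set X, (forall n, compact (K n) /\ K n `<=` A) /\
    forall K', compact K' -> K' `<=` A ->
      exists n, forall m, (n <= m)%N -> K' `<=` K m.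
Proof.
move=> oA [x [r Ar]].
pose K n := [set y | ball y n.+1%:R^-1 `<=` A].
have KA n : K n `<=` A by move=> y; apply; exact: ballxx.
exists K; split.
  move=> n; split => //; apply: (@closed_bounded_compact _ x r).
    rewrite -(setCK (K n)); apply: open_closedC; rewrite openE => y.
    move=> nKy.
    have [z [yz Az]] : exists z, ball y n.+1%:R^-1 z /\ ~ A z.
      apply: contrapT => h; apply: nKy => z yz; apply: contrapT => Az.
      by apply: h; exists z.
    move: yz; rewrite ballEmdist/= => yz.
    apply/nbhs_ballP; exists (n.+1%:R^-1 - mdist y z)%R; first by rewrite /= subr_gt0.
    move=> w; rewrite ballEmdist/= => yw Kw; apply: Az; apply: Kw.
    rewrite ballEmdist/=.
    apply: le_lt_trans (metric_triangle w y z) _.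
    by rewrite (metric_sym w y) -ltrBrDr.
  by move=> y /KA; exact: Ar.
move=> K' /compact_near_coveringP/(_ _ \oo (fun n y => ball y n.+1%:R^-1 `<=` A)) + K'A.
have key y : K' y -> \forall y' \near y & n \near \oo, ball y' n.+1%:R^-1 `<=` A.
  move=> /K'A Ay; have /nbhs_ballP[e /= e0 eA] := open_nbhs_nbhs (conj oA Ay).
  have e20 : (0 < e / 2)%R by rewrite divr_gt0.
  exists (ball y (e / 2), [set n | (n.+1%:R^-1 < e / 2)%R]).
    split => /=; first exact: nbhsx_ballx.
    exact: (near_infty_natSinv_lt (PosNum e20)).
  move=> [y' n] /= [yy' ne] z y'z; apply: eA.
  move: yy' y'z; rewrite !ballEmdist/= => yy' y'z.
  apply: le_lt_trans (metric_triangle y y' z) _.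
  by have := ltrD yy' (lt_trans y'z ne); rewrite -splitr.
by move=> /(_ _ key)[n _ Hn]; exists n => m nm y K'y; exact: Hn.
Qed.

End doubling_spaces.

Section doubling_finiteness.
Context {d} {R : realType} {X : completeBorelMetricType d R}.
Variable mu : {measure set X -> \bar R}.
Hypothesis dbl : doubling mu.

Lemma doubling_sigma_finite : sigma_finite [set: X] mu.
Proof.
exists (fun n => ball (point : X) n%:R).
  apply/seteqP; split => // x _; exists (Num.truncn (mdist point x)).+1 => //=.
  by rewrite ballEmdist/= truncnS_gt.
by move=> n; split; [exact: ball_measurableX|exact: ball_measure_lty].
Qed.

Lemma bounded_measure_lty (A : set X) : measurable A -> metric_bounded A -> mu A < +oo.
Proof.
move=> mA [x [r Ar]]; apply: le_lt_trans (ball_measure_lty dbl x r).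
by apply: le_measure => //; rewrite inE//; exact: ball_measurableX.
Qed.

End doubling_finiteness.

(** * Convexity and lower semicontinuity of the total variation *)

Section total_variation_theory.
Context {d} {R : realType} {X : completeBorelMetricType d R}.
Variable mu : {measure set X -> \bar R}.
Hypothesis dbl : doubling mu.
Variable A : set X.
Hypothesis oA : open A.
Hypothesis bA : metric_bounded A.
Implicit Types (u v f : X -> R) (g : X -> \bar R) (c : \bar R).

Let mA : measurable A. Proof. exact: open_measurableX. Qed.

Lemma loc_lipschitz_measurable f : loc_lipschitz A f -> measurable_fun A f.
Proof.
move=> lf; apply: (measurability _ (RGenOInfty.measurableE R)) => _ [_ [r ->] <-].
apply: open_measurableX; rewrite openE => x [Ax /=].
rewrite in_itv/= andbT => rfx.
have [e [L [e0 eL]]] := lf x Ax.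
have /nbhs_ballP[e' /= e'0 e'A] := open_nbhs_nbhs (conj oA Ax).
pose e'' := (Num.min (Num.min e e') ((f x - r) / (`|L| + 1)))%R.
have L10 : (0 < `|L| + 1)%R by rewrite ltr_wpDl.
have e''0 : (0 < e'')%R by rewrite !lt_min e0 e'0 divr_gt0// subr_gt0.
apply/nbhs_ballP; exists e'' => //= y; rewrite ballEmdist/= !lt_min.
move=> /andP[/andP[xe xe'] xL].
have Ay : A y by apply: e'A; rewrite ballEmdist.
split => //; rewrite in_itv/= andbT.
have := eL x y (conj Ax (ballxx _ e0)).
rewrite ballEmdist => /(_ (conj Ay xe)) H.
have : (L * mdist x y < f x - r)%R.
  move: xL; rewrite ltr_pdivlMr// mulrC; apply: le_lt_trans.
  rewrite ler_wpM2r ?mdist_ge0//.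
  by apply: le_trans (ler_norm _) _; rewrite lerDl.
by move: H; rewrite ler_norml => /andP[]; lra.
Qed.

Lemma loc_lipschitz_comb (a b : R) f h : loc_lipschitz A f -> loc_lipschitz A h ->
  loc_lipschitz A (fun x => a * f x + b * h x)%R.
Proof.
move=> lf lh x Ax; have [r [L [r0 H]]] := lf x Ax; have [s [M [s0 H']]] := lh x Ax.
exists (Num.min r s)%R, (`|a| * L + `|b| * M)%R; split; first by rewrite lt_min r0 s0.
move=> y z [Ay]; rewrite ballEmdist/= lt_min => /andP[xr xs].
move=> [Az] /=; rewrite lt_min => /andP[zr zs].
have hf : (`|f y - f z| <= L * mdist y z)%R by apply: H; (split; first by []); rewrite ballEmdist.
have hh : (`|h y - h z| <= M * mdist y z)%R by apply: H'; (split; first by []); rewrite ballEmdist.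
have -> : (a * f y + b * h y - (a * f z + b * h z) =
  a * (f y - f z) + b * (h y - h z))%R by ring.
apply: le_trans (ler_normD _ _) _; rewrite !normrM mulrDl -!mulrA.
by apply: lerD; rewrite ler_wpM2l.
Qed.

(** On a bounded open set of a proper space, local convergence of a sequence may
    be tested on one exhausting sequence of compact sets, so that the relaxed
    energy is bounded by [c] as soon as single competitors of energy at most
    [c] exist, at any accuracy on any compact set. *)
Definition approximable u c := forall K (e : R), compact K -> K `<=` A ->
  (0 < e)%R -> exists f g, [/\ loc_lipschitz A f, weak_upper_gradient mu A f g,
    \int[mu]_(x in A) g x <= c & \int[mu]_(x in K) `|f x - u x|%:E <= e%:E].

Lemma totvar_approximable u c : totvar mu u A < c -> approximable u c.
Proof.
move=> /ereal_inf_lt[_ [ui [gi [lui cvui mgi ->]]]] ltc K e cK KA e0.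
have [n _ Hn] : \forall n \near \oo, \int[mu]_(x in K) `|ui n x - u x|%:E <= e%:E.
  have nV : nbhs (0 : \bar R) [set y : \bar R | y < e%:E].
    by apply: open_nbhs_nbhs; split; [exact: open_ereal_lt_ereal|rewrite /= lte_fin].
  have [N _ HN] := cvui K cK KA _ nV.
  by exists N => // n Nn; apply: ltW; exact: HN.
have : einfs (fun i => \int[mu]_(x in A) gi i x) n < c.
  apply: le_lt_trans ltc; rewrite limn_einf_lim.
  rewrite (cvg_lim (@ereal_hausdorff R) (@cvg_einfs_sup R _)).
  by apply: ereal_sup_ubound; exists n.
move=> /ereal_inf_lt[_ [m /= nm <-]] /ltW le_c.
exists (ui m), (gi m); split => //; first by have [] := mgi m.
exact: Hn.
Qed.

Lemma approximable_totvar u c : approximable u c -> totvar mu u A <= c.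
Proof.
move=> ap; have [K [KA Kex]] := bounded_exhaustion dbl oA bA.
have /choice[ui H] n : exists f, exists g, [/\ loc_lipschitz A f,
    min_weak_upper_gradient mu A f g, \int[mu]_(x in A) g x <= c &
    \int[mu]_(x in K n) `|f x - u x|%:E <= (n.+1%:R^-1)%:E].
  have [cK KnA] := KA n.
  have n0 : (0 < n.+1%:R^-1 :> R)%R by [].
  have [f [g [lf wg gc fK]]] := ap _ _ cK KnA n0.
  have [g' mg' g'g] := min_wug_exists oA wg.
  by exists f, g'; split => //; exact: le_trans gc.
have {H}/choice[gi H] := H.
apply: ge_ereal_inf; exists (limn_einf (fun i => \int[mu]_(x in A) gi i x)).
  exists ui, gi; split => //; [by move=> i; have [] := H i| |by move=> i; have [] := H i].
  move=> K' cK' K'A; have [N KN] := Kex _ cK' K'A.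
  apply: (@squeeze_cvge _ _ _ _ (cst 0) _ (fun n => (n.+1%:R^-1)%:E)).
  - exists N => // n /= Nn; rewrite integral_ge0//=.
    have [_ _ _] := H n; apply: le_trans.
    rewrite integral_mkcond [leRHS]integral_mkcond; apply: le_integral_gen => x _.
    rewrite !patchE; case: ifPn => [/set_mem /(KN _ Nn) Kx|_]; first by rewrite mem_set.
    by case: ifPn => // _; rewrite lee_fin.
  - exact: cvg_cst.
  - apply: cvg_EFin; first exact: nearW.
    exact: cvg_harmonic.
(* All energies are at most [c], hence so are the tail infima and their limit. *)
rewrite limn_einf_lim; apply: lime_le; first exact: is_cvg_einfs.
apply: nearW => n; apply: (@le_trans _ _ (\int[mu]_(x in A) gi n x)).
  by apply: ereal_inf_lbound; exists n => /=.
by have [] := H n.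
Qed.

Lemma totvar_ge0 u : 0 <= totvar mu u A.
Proof.
apply: le_ereal_inf_tmp => _ [ui [gi [_ _ mgi ->]]].
rewrite limn_einf_lim; apply: lime_ge; first exact: is_cvg_einfs.
apply: nearW => n; apply: le_ereal_inf_tmp => _ [m _ <-].
by apply: integral_ge0 => x Ax; have [[_ h _] _] := mgi m; exact: h.
Qed.

Lemma totvar_ae_eq u v : (\forall x \ae mu, A x -> u x = v x) ->
  totvar mu u A = totvar mu v A.
Proof.
move=> uv; suff cvE ui : cvg_L1loc mu A ui u = cvg_L1loc mu A ui v.
  rewrite /totvar; congr ereal_inf; apply/seteqP; split => e [ui [gi [h1 h2 h3 h4]]];
  by exists ui, gi; split => //; rewrite ?cvE// -cvE.
have E K : K `<=` A -> (fun n => \int[mu]_(x in K) `|ui n x - u x|%:E) =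
                      (fun n => \int[mu]_(x in K) `|ui n x - v x|%:E).
  move=> KA; apply/funext => n; apply: ae_eq_integral_gen.
  by apply: ae_imp uv => x h' Kx; rewrite h'//; exact: KA.
by rewrite /cvg_L1loc; apply/propext; split => h K cK KA;
  have := h K cK KA; rewrite E.
Qed.

Let measurable_diff K f u : compact K -> K `<=` A -> measurable_fun A f ->
  measurable_fun A u -> measurable_fun K (fun x => `|f x - u x|%:E).
Proof.
move=> cK KA mf mu_; apply/measurable_EFinP; apply: measurableT_comp => //.
by apply: measurable_funB; apply: measurable_funS KA _.
Qed.

(** Lower semicontinuity of the total variation for convergence in L^1. *)
Lemma totvar_lsc u c : measurable_fun A u ->
  (forall e : R, (0 < e)%R -> exists v, [/\ measurable_fun A v, totvar mu v A <= c &
    \int[mu]_(x in A) `|v x - u x|%:E <= e%:E]) ->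
  totvar mu u A <= c.
Proof.
move=> mu_ H.
have [coo|cfin] := eqVneq c +oo; first by rewrite coo leey.
have cnum : c \is a fin_num.
  have [v [_ tv _]] := H 1%R ltr01.
  by rewrite ge0_fin_numE ?ltey// (le_trans _ tv)// totvar_ge0.
apply/lee_addgt0Pr => e0 e00; apply: approximable_totvar => K e cK KA e_gt0.
have e2 : (0 < e / 2)%R by rewrite divr_gt0.
have [v [mv tv vu]] := H _ e2.
have tvc : totvar mu v A < c + e0%:E by apply: le_lt_trans tv _; rewrite lteDl.
have [f [g [lf wg gc fv]]] := totvar_approximable tvc cK KA e2.
have mf := loc_lipschitz_measurable lf.
exists f, g; split => //.
apply: (@le_trans _ _ (\int[mu]_(x in K) (`|f x - v x|%:E + `|v x - u x|%:E))).
  apply: le_integral_gen => x _; rewrite -EFinD lee_fin.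
  have -> : (f x - u x = (f x - v x) + (v x - u x))%R by ring.
  exact: ler_normD.
have mK := compact_measurableX cK.
rewrite ge0_integralD//; [|exact: measurable_diff|exact: measurable_diff].
rewrite [e]splitr EFinD; apply: leeD => //; apply: le_trans vu.
apply: ge0_subset_integral => //.
apply/measurable_EFinP; apply: measurableT_comp => //; exact: measurable_funB.
Qed.

(** Combinations of approximations of [u] and [v] approximate the combination, and
    weak upper gradients combine in the same way. *)
Lemma totvar_comb (a b p q : R) u v : (0 <= a)%R -> (0 <= b)%R ->
  measurable_fun A u -> measurable_fun A v ->
  totvar mu u A <= p%:E -> totvar mu v A <= q%:E ->
  totvar mu (fun x => a * u x + b * v x)%R A <= (a * p + b * q)%:E.
Proof.
move=> a0 b0 mu_ mv up vq.
apply/lee_addgt0Pr => e e0; rewrite -EFinD.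
have ab1 : (0 < a + b + 1)%R by rewrite ltr_wpDl// addr_ge0.
pose e' := (e / (a + b + 1))%R; have e'0 : (0 < e')%R by rewrite divr_gt0.
have e'E : ((a + b + 1) * e' = e)%R by rewrite mulrC divfK// gt_eqF.
apply: approximable_totvar => K k cK KA k0.
pose k' := (k / (a + b + 1))%R; have k'0 : (0 < k')%R by rewrite divr_gt0.
have k'E : ((a + b + 1) * k' = k)%R by rewrite mulrC divfK// gt_eqF.
have ltp : totvar mu u A < (p + e')%:E.
  by apply: le_lt_trans up _; rewrite lte_fin ltrDl.
have ltq : totvar mu v A < (q + e')%:E.
  by apply: le_lt_trans vq _; rewrite lte_fin ltrDl.
have [f [g [lf wg gc fu]]] := totvar_approximable ltp cK KA k'0.
have [h [l [lh wl lc hv]]] := totvar_approximable ltq cK KA k'0.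
have mf := loc_lipschitz_measurable lf; have mh := loc_lipschitz_measurable lh.
have mK := compact_measurableX cK.
have [mg g0 _] := wg; have [ml l0 _] := wl.
exists (fun x => a * f x + b * h x)%R, (fun x => a%:E * g x + b%:E * l x); split.
- exact: loc_lipschitz_comb.
- exact: wug_comb.
- rewrite ge0_integralD//.
  + rewrite !ge0_integralZl_EFin//.
    apply: (@le_trans _ _ (a%:E * (p + e')%:E + b%:E * (q + e')%:E)).
      by apply: leeD; apply: lee_wpmul2l; rewrite ?lee_fin.
    by rewrite -!EFinM -EFinD lee_fin; nra.
  + by move=> x Ax; rewrite mule_ge0 ?lee_fin ?g0.
  + exact: measurable_funeM.
  + by move=> x Ax; rewrite mule_ge0 ?lee_fin ?l0.
  + exact: measurable_funeM.
- apply: (@le_trans _ _ (\int[mu]_(x in K)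
      (a%:E * `|f x - u x|%:E + b%:E * `|h x - v x|%:E))).
    apply: le_integral_gen => x _; rewrite -!EFinM -EFinD lee_fin.
    have -> : (a * f x + b * h x - (a * u x + b * v x) =
      a * (f x - u x) + b * (h x - v x))%R by ring.
    by apply: le_trans (ler_normD _ _) _; rewrite !normrM (ger0_norm a0) (ger0_norm b0).
  have md1 := measurable_diff cK KA mf mu_; have md2 := measurable_diff cK KA mh mv.
  rewrite ge0_integralD//.
  + rewrite !ge0_integralZl_EFin//.
    apply: (@le_trans _ _ (a%:E * k'%:E + b%:E * k'%:E)).
      by apply: leeD; apply: lee_wpmul2l; rewrite ?lee_fin.
    by rewrite -!EFinM -EFinD lee_fin; nra.
  + by move=> x Ax; rewrite mule_ge0 ?lee_fin.
  + exact: measurable_funeM.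
  + by move=> x Ax; rewrite mule_ge0 ?lee_fin.
  + exact: measurable_funeM.
Qed.

End total_variation_theory.

(** * Product integrals and square integrable functions *)

Section rectangle_fubini.
Context {d1 d2} {T1 : measurableType d1} {T2 : measurableType d2} {R : realType}.
Variable m1 : {sigma_finite_measure set T1 -> \bar R}.
Variable m2 : {sigma_finite_measure set T2 -> \bar R}.
Variables (A : set T1) (B : set T2).
Hypotheses (mA : measurable A) (mB : measurable B).
Implicit Type f : T1 * T2 -> \bar R.
Local Notation C := (A `*` B).

Let mC : measurable C. Proof. exact: measurableX. Qed.

Let patch1 f x y : (f \_ C) (x, y) =
  ((fun x => ((fun y => f (x, y)) \_ B) y) \_ A) x.
Proof.
rewrite !patchE in_setX; by case: (x \in A).
Qed.

Let int1 f x : \int[m2]_y (f \_ C) (x, y) =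
  ((fun x => \int[m2]_(y in B) f (x, y)) \_ A) x.
Proof.
rewrite patchE; case: ifPn => xA.
  by rewrite [RHS]integral_mkcond; apply: eq_integral => y _; rewrite patch1 patchE xA.
by under eq_integral do rewrite patch1 patchE (negbTE xA); rewrite integral0.
Qed.

Let int2 f y : \int[m1]_x (f \_ C) (x, y) =
  ((fun y => \int[m1]_(x in A) f (x, y)) \_ B) y.
Proof.
rewrite patchE; case: ifPn => yB.
  rewrite [RHS]integral_mkcond; apply: eq_integral => x _.
  by rewrite patch1 !patchE yB.
under eq_integral do rewrite patch1 !patchE (negbTE yB) if_same.
by rewrite integral0.
Qed.

Lemma rect_tonelli2 f : measurable_fun C f -> (forall z, C z -> 0 <= f z) ->
  \int[m1 \x m2]_(z in C) f z = \int[m2]_(y in B) \int[m1]_(x in A) f (x, y).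
Proof.
move=> mf f0; rewrite [LHS]integral_mkcond fubini_tonelli2.
- by rewrite [RHS]integral_mkcond; apply: eq_integral => x _; exact: int2.
- exact/(measurable_restrictT _ mC).
- by move=> z; rewrite patchE; case: ifPn => // /set_mem /f0.
Qed.

Let intC f : (m1 \x m2).-integrable C f ->
  (m1 \x m2).-integrable setT (f \_ C).
Proof. by move=> fi; apply/(integrable_mkcond _ mC). Qed.

Lemma rect_fubini1 f : (m1 \x m2).-integrable C f ->
  \int[m1 \x m2]_(z in C) f z = \int[m1]_(x in A) \int[m2]_(y in B) f (x, y).
Proof.
move=> /intC fi; rewrite [LHS]integral_mkcond -integral12_prod_meas1//.
by rewrite [RHS]integral_mkcond; apply: eq_integral => x _; exact: int1.
Qed.

Lemma rect_fubini2 f : (m1 \x m2).-integrable C f ->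
  \int[m1 \x m2]_(z in C) f z = \int[m2]_(y in B) \int[m1]_(x in A) f (x, y).
Proof.
move=> /intC fi; rewrite [LHS]integral_mkcond -integral21_prod_meas1//.
by rewrite [RHS]integral_mkcond; apply: eq_integral => x _; exact: int2.
Qed.

Lemma rect_integrable2 f : (m1 \x m2).-integrable C f ->
  m2.-integrable B (fun y => \int[m1]_(x in A) f (x, y)).
Proof.
move=> /intC fi; apply/(integrable_mkcond _ mB).
have -> : (fun y => \int[m1]_(x in A) f (x, y)) \_ B =
    fubini_G m1 (f \_ C) by apply/funext => y; rewrite -int2.
have mG := measurable_fubini_G fi.
apply/integrableP; split => //.
have /integrableP[mf foo] := fi.
apply: le_lt_trans ((integrable21ltyP m1 m2 mf).1 fi).
by apply: le_integral_gen => y _; apply: le_abse_integral => //; exact: measurableT_comp.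
Qed.

Lemma rect_null (N : set (T1 * T2)) : measurable N -> N `<=` C ->
  (forall x, A x -> m2 (xsection N x) = 0) -> (m1 \x m2) N = 0.
Proof.
move=> mN NC N0; rewrite /product_measure1 integral0_eq// => x _ /=.
have [Ax|Ax] := pselect (A x); first exact: N0.
rewrite (_ : xsection N x = set0) ?measure0//.
by apply/seteqP; split => // y /xsectionP /NC[].
Qed.

(** The measure of a set is the integral of the measures of its sections, and a
    nonnegative function of integral zero vanishes almost everywhere. *)
Lemma rect_null_section2 (P : T1 * T2 -> Prop) :
  (\forall z \ae (m1 \x m2), C z -> P z) ->
  \forall y \ae m2, B y -> \forall x \ae m1, A x -> P (x, y).
Proof.
move=> [N [mN N0 sN]].
have mNy : measurable_fun setT (m1 \o ysection N) by exact: measurable_fun_ysection.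
have : \int[m2]_y (m1 \o ysection N) y = 0.
  rewrite -[RHS]N0.
  transitivity ((m1 \x^ m2) N) => //.
  apply: esym; apply: product_measure_unique => // A1 A2 mA1 mA2.
  exact: product_measure2E.
have : \int[m2]_y `|(m1 \o ysection N) y| = \int[m2]_y (m1 \o ysection N) y.
  by apply: eq_integral => y _; rewrite gee0_abs.
move=> absE int0; move: absE; rewrite int0.
move=> /(@ae_eq_integral_abs _ _ _ m2 setT measurableT _ mNy).1.
apply: ae_imp => y /(_ I) /= Ny0 By.
exists (ysection N y); split => //; first exact: measurable_ysection.
by move=> x /= nP; apply/ysectionP; apply: sN => /= h; apply: nP => Ax; apply: h.
Qed.

End rectangle_fubini.

Section square_integrable.
Context {d} {T : measurableType d} {R : realType}.
Variable m : {measure set T -> \bar R}.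
Variable C : set T.
Hypothesis mC : measurable C.
Implicit Types f g : T -> R.

Definition square_integrable f :=
  measurable_fun C f /\ \int[m]_(x in C) (f x ^+ 2)%:E < +oo.

Lemma measurable_sqr f : measurable_fun C f ->
  measurable_fun C (fun x => (f x ^+ 2)%:E).
Proof. by move=> mf; apply/measurable_EFinP; exact: measurable_funX. Qed.

Lemma ge0_int_sqr f : 0 <= \int[m]_(x in C) (f x ^+ 2)%:E.
Proof. by apply: integral_ge0 => x _; rewrite lee_fin sqr_ge0. Qed.

Lemma square_integrable_le f g (k : R) : measurable_fun C f -> square_integrable g ->
  (forall x, C x -> (f x ^+ 2 <= k * g x ^+ 2)%R) -> square_integrable f.
Proof.
move=> mf [mg g2] fg; split => //.
apply: (@le_lt_trans _ _ (\int[m]_(x in C) (`|k|%:E * (g x ^+ 2)%:E))).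
  apply: le_integral_gen => x Cx; rewrite -EFinM lee_fin.
  apply: le_trans (fg _ Cx) _; rewrite ler_wpM2r ?sqr_ge0//; exact: ler_norm.
rewrite ge0_integralZl_EFin//.
- by rewrite lte_mul_pinfty// lee_fin.
- by move=> x _; rewrite lee_fin sqr_ge0.
- exact: measurable_sqr.
Qed.

Lemma int_sqrD f g : measurable_fun C f -> measurable_fun C g ->
  \int[m]_(x in C) ((f x + g x) ^+ 2)%:E <=
  2%:E * \int[m]_(x in C) (f x ^+ 2)%:E + 2%:E * \int[m]_(x in C) (g x ^+ 2)%:E.
Proof.
move=> mf mg; rewrite -!ge0_integralZl_EFin//; do ?[exact: measurable_sqr];
  do ?[by move=> x _; rewrite lee_fin sqr_ge0].
rewrite -ge0_integralD//; last 4 first.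
- by move=> x _; rewrite -EFinM lee_fin mulr_ge0// sqr_ge0.
- by apply: measurable_funeM; exact: measurable_sqr.
- by move=> x _; rewrite -EFinM lee_fin mulr_ge0// sqr_ge0.
- by apply: measurable_funeM; exact: measurable_sqr.
apply: le_integral_gen => x _; rewrite -!EFinM -EFinD lee_fin.
have : (0 <= (f x - g x) ^+ 2)%R by exact: sqr_ge0.
by rewrite !expr2; nra.
Qed.

Lemma square_integrableD f g : square_integrable f -> square_integrable g ->
  square_integrable (fun x => f x + g x)%R.
Proof.
move=> [mf f2] [mg g2]; split; first exact: measurable_funD.
apply: le_lt_trans (int_sqrD mf mg) _.
by apply: lte_add_pinfty; rewrite lte_mul_pinfty// lee_fin.
Qed.

Lemma square_integrableZ (k : R) f : square_integrable f ->
  square_integrable (fun x => k * f x)%R.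
Proof.
move=> sf; apply: (@square_integrable_le _ f (k ^+ 2)) => //.
  by apply: measurable_funM => //; have [] := sf.
by move=> x _; rewrite exprMn.
Qed.

Lemma square_integrableB f g : square_integrable f -> square_integrable g ->
  square_integrable (fun x => f x - g x)%R.
Proof.
move=> sf sg; have := square_integrableD sf (square_integrableZ (-1) sg).
by under eq_fun do rewrite mulN1r.
Qed.

Lemma integrable_mul f g : square_integrable f -> square_integrable g ->
  m.-integrable C (fun x => (f x * g x)%:E).
Proof.
move=> sf sg; have [mf _] := sf; have [mg _] := sg.
have mfg : measurable_fun C (fun x => (f x * g x)%:E).
  by apply/measurable_EFinP; exact: measurable_funM.
apply/integrableP; split => //.
have h0 h : forall x, C x -> 0 <= (h x ^+ 2 : R)%:E.
  by move=> x _; rewrite lee_fin sqr_ge0.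
apply: (@le_lt_trans _ _ (\int[m]_(x in C) ((f x ^+ 2)%:E + (g x ^+ 2)%:E))).
  apply: le_integral_gen => x _; rewrite /= lee_fin normrM.
  have : (0 <= (`|f x| - `|g x|) ^+ 2)%R by exact: sqr_ge0.
  by rewrite -(real_normK (num_real (f x))) -(real_normK (num_real (g x))) !expr2; nra.
rewrite ge0_integralD//; [|exact: (h0 f)|exact: measurable_sqr|exact: (h0 g)|exact: measurable_sqr].
by apply: lte_add_pinfty; [case: sf|case: sg].
Qed.

Hypothesis Cfin : m C < +oo.

Lemma square_integrable_bounded f (M : R) : measurable_fun C f ->
  (forall x, C x -> (`|f x| <= M)%R) -> square_integrable f.
Proof.
move=> mf fM; split => //.
apply: (@le_lt_trans _ _ (\int[m]_(x in C) (cst (M ^+ 2)%:E) x)).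
  apply: le_integral_gen => x Cx; rewrite lee_fin -(real_normK (num_real (f x))).
  by rewrite ler_sqr ?nnegrE// ?fM// (le_trans _ (fM _ Cx)).
by rewrite integral_cst// lte_mul_pinfty// lee_fin sqr_ge0.
Qed.

Lemma square_integrable_integrable f : square_integrable f ->
  m.-integrable C (EFin \o f).
Proof.
move=> sf; have s1 : square_integrable (cst 1%R).
  by apply: (@square_integrable_bounded _ 1%R) => // x _; rewrite normr1.
by have := integrable_mul sf s1; under eq_fun do rewrite mulr1.
Qed.

(** A quantitative form of the inclusion of L^2 in L^1. *)
Lemma int_abs_le_sqr f (e : R) : (0 < e)%R -> measurable_fun C f ->
  \int[m]_(x in C) `|f x|%:E <= e%:E * m C + (e^-1)%:E * \int[m]_(x in C) (f x ^+ 2)%:E.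
Proof.
move=> e0 mf; apply: (@le_trans _ _
  (\int[m]_(x in C) (e%:E + (e^-1)%:E * (f x ^+ 2)%:E))).
  apply: le_integral_gen => x _; rewrite -EFinM -EFinD lee_fin.
  have : (0 <= e^-1 * (`|f x| - e) ^+ 2)%R by rewrite mulr_ge0 ?sqr_ge0// invr_ge0 ltW.
  have ke : (e^-1 * e = 1)%R by rewrite mulVf ?gt_eqF.
  have -> : (e^-1 * (`|f x| - e) ^+ 2 =
    e^-1 * `|f x| ^+ 2 - 2 * `|f x| * (e^-1 * e) + e * (e^-1 * e))%R by ring.
  rewrite ke real_normK ?num_real// !mulr1.
  by have := normr_ge0 (f x); lra.
rewrite ge0_integralD//; first last.
- by apply: measurable_funeM; exact: measurable_sqr.
- by move=> x _; rewrite -EFinM lee_fin mulr_ge0 ?sqr_ge0// invr_ge0 ltW.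
- by move=> x _; rewrite lee_fin ltW.
rewrite (integral_cst m mC e%:E) ge0_integralZl_EFin//.
- by move=> x _; rewrite lee_fin sqr_ge0.
- exact: measurable_sqr.
- by rewrite invr_ge0 ltW.
Qed.

Lemma Lpnorm2_sqr f : Lpnorm m 2%:E C f ^+ 2 = \int[m]_(x in C) (f x ^+ 2)%:E.
Proof.
rewrite /Lpnorm Lnorm.unlock /Lnorm.
rewrite [in RHS]integral_mkcond.
rewrite (_ : \int[m]_x _ `^ 2 = \int[m]_x ((fun x => (f x ^+ 2)%:E) \_ C) x); last first.
  apply: eq_integral => x _; rewrite /= !patchE; case: ifPn => _.
    by rewrite powR_mulrn// real_normK// num_real.
  by rewrite [`|_|%R](normr0 R) powR0.
set I := \int[m]_x _.
have I0 : 0 <= I.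
  by apply: integral_ge0 => x _; rewrite patchE; case: ifPn => // _; rewrite lee_fin sqr_ge0.
by rewrite poweR12_sqrt// sqr_sqrte.
Qed.

Lemma in_L2P f : in_Lp m 2%:E C f <-> square_integrable f.
Proof.
rewrite /in_Lp /square_integrable -Lpnorm2_sqr.
have N0 : 0 <= Lpnorm m 2%:E C f by exact: Lnorm_ge0.
split=> -[mf h]; split => //.
  by rewrite expe2 lte_mul_pinfty// ge0_fin_numE.
move: h; rewrite expe2; case: (Lpnorm m 2%:E C f) N0 => //= r _ _.
exact: ltry.
Qed.

Lemma Lpnorm1E f : Lpnorm m 1 C f = \int[m]_(x in C) `|f x|%:E.
Proof.
rewrite /Lpnorm Lnorm1 [in RHS]integral_mkcond; apply: eq_integral => x _.
by rewrite /= !patchE; case: ifPn => // _; rewrite normr0.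
Qed.

End square_integrable.

Section space_time_fubini.
Context {d} {R : realType} {X : completeBorelMetricType d R}.
Variable mu : {measure set X -> \bar R}.
Hypothesis sf : sigma_finite [set: X] mu.
Local Notation leb := (@lebesgue_measure R).

Let smu : {sigma_finite_measure set X -> \bar R} :=
  @SigmaFiniteMeasure.Pack _ _ _ (Measure.sort mu)
    (SigmaFiniteMeasure.Class
      (Measure.measure_function_Content_isMeasure_mixin (Measure.class mu))
      (isSFinite.Axioms_ _ _ _ (sfinite_measure_sigma_finite sf))
      (isSigmaFinite.Axioms_ _ _ _ sf)).

Variables (A : set X) (T : R).
Hypothesis mA : measurable A.
Local Notation C := (cylinder A T).
Implicit Type f : X * R -> \bar R.

Let mI : measurable (`]0%R, T[%classic : set R). Proof. exact: measurable_itv. Qed.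

Lemma cyl_measurable : measurable C.
Proof. exact: measurableX. Qed.

Lemma cyl_tonelli2 f : measurable_fun C f -> (forall z, C z -> 0 <= f z) ->
  \int[mu \x leb]_(z in C) f z = \int[leb]_(t in `]0%R, T[) \int[mu]_(x in A) f (x, t).
Proof. exact: (@rect_tonelli2 _ _ _ _ _ smu leb A _ mA mI). Qed.

Lemma cyl_fubini1 f : (mu \x leb).-integrable C f ->
  \int[mu \x leb]_(z in C) f z = \int[mu]_(x in A) \int[leb]_(t in `]0%R, T[) f (x, t).
Proof. exact: (@rect_fubini1 _ _ _ _ _ smu leb A _ mA mI). Qed.

Lemma cyl_fubini2 f : (mu \x leb).-integrable C f ->
  \int[mu \x leb]_(z in C) f z = \int[leb]_(t in `]0%R, T[) \int[mu]_(x in A) f (x, t).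
Proof. exact: (@rect_fubini2 _ _ _ _ _ smu leb A _ mA mI). Qed.

Lemma cyl_integrable2 f : (mu \x leb).-integrable C f ->
  leb.-integrable `]0%R, T[ (fun t => \int[mu]_(x in A) f (x, t)).
Proof. exact: (@rect_integrable2 _ _ _ _ _ smu leb A _ mA mI). Qed.

Lemma cyl_null (N : set (X * R)) : measurable N -> N `<=` C ->
  (forall x, A x -> leb (xsection N x) = 0) -> (mu \x leb) N = 0.
Proof. exact: (@rect_null _ _ _ _ _ smu leb A). Qed.

Lemma cyl_ae_slice (P : X * R -> Prop) : (\forall z \ae (mu \x leb), C z -> P z) ->
  \forall t \ae leb, t \in `]0%R, T[ -> \forall x \ae mu, A x -> P (x, t).
Proof. exact: (@rect_null_section2 _ _ _ _ _ smu leb A). Qed.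

Lemma cyl_measure : mu A < +oo -> (mu \x leb) C < +oo.
Proof.
move=> Afin; rewrite product_measure1E//.
have lI : leb (`]0%R, T[%classic : set R) < +oo.
  rewrite lebesgue_measure_itv/=.
  by case: ifP => _; rewrite ?ltry// -EFinB ltry.
by rewrite lte_mul_pinfty// ge0_fin_numE.
Qed.

End space_time_fubini.

(** * Time derivatives of test functions *)

(** Test functions are only controlled on the open cylinder; extended by zero
    outside of the time interval they are Lipschitz in time on the whole line,
    because their support stays away from both ends. *)
Definition time_ext {R : realType} {X : Type} (T : R) (phi : X * R -> R) (z : X * R) : R :=
  if z.2 \in `]0%R, T[ then phi z else 0%R.

Section test_functions.
Context {d} {R : realType} {X : completeBorelMetricType d R}.
Variables (A B : set X) (T : R) (phi : X * R -> R).
Hypothesis oA : open A.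
Hypothesis T0 : (0 < T)%R.
Hypothesis tphi : lip_test A B T phi.
Local Notation Phi := (time_ext T phi).

Let vanish (x : X) (t0 : R) : A x -> (t0 <= 0 \/ T <= t0)%R ->
  exists2 r : R, (0 < r)%R & forall t, t \in `]0%R, T[ -> (`|t0 - t| < r)%R ->
    phi (x, t) = 0%R.
Proof.
move=> Ax ht0; have [_ [_ sub]] := tphi.
have : ~ closure [set z | cylinder A T z /\ phi z != 0%R] (x, t0).
  move=> /sub[_ /=]; rewrite in_itv/= => /andP[t00 t0T].
  by case: ht0; rewrite leNgt ?t00 ?t0T.
move=> /existsNP[V /not_implyP[/nbhs_ballP[r /= r0 rV] Vn]].
exists r => // t tT t0t; apply: contrapT => /eqP phi0; apply: Vn.
exists (x, t); split; first by split.
by apply: rV; split => //=; exact: ballxx.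
Qed.

Lemma time_ext_lip : exists2 L : R, (0 <= L)%R & [/\
  forall x, A x -> forall s t, (`|Phi (x, s) - Phi (x, t)| <= L * `|s - t|)%R,
  forall x y t, A x -> A y -> (`|Phi (x, t) - Phi (y, t)| <= L * mdist x y)%R &
  forall x t, A x -> (`|Phi (x, t)| <= L * T)%R].
Proof.
have [[L' HL'] _] := tphi; pose L := `|L'|%R; exists L; first exact: normr_ge0.
have L0 : (0 <= L)%R by exact: normr_ge0.
have HL x y s t : A x -> A y -> s \in `]0%R, T[ -> t \in `]0%R, T[ ->
    (`|phi (x, s) - phi (y, t)| <= L * (mdist x y + `|s - t|))%R.
  move=> Ax Ay sT tT; apply: le_trans (HL' x y s t (conj Ax sT) (conj Ay tT)) _.
  by rewrite ler_wpM2r ?ler_norm// addr_ge0 ?mdist_ge0.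
have left x s : A x -> s \in `]0%R, T[ -> (`|phi (x, s)| <= L * s)%R.
  move=> Ax sT; have [r r0 Hr] := vanish Ax (or_introl (lexx 0%R)).
  move: (sT); rewrite in_itv/= => /andP[s0 sT'].
  pose t := (Num.min r s / 2)%R.
  have m0 : (0 < Num.min r s)%R by rewrite lt_min r0 s0.
  have mr : (Num.min r s <= r)%R by rewrite ge_min lexx.
  have ms : (Num.min r s <= s)%R by rewrite ge_min lexx orbT.
  have tT : t \in `]0%R, T[ by rewrite in_itv/= /t; apply/andP; split; lra.
  have pt : phi (x, t) = 0%R.
    by apply: Hr => //; rewrite sub0r normrN gtr0_norm /t; lra.
  rewrite -[phi (x, s)]subr0 -pt; apply: le_trans (HL _ _ _ _ Ax Ax sT tT) _.
  rewrite mdistxx add0r ler_wpM2l// gtr0_norm /t; lra.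
have right x s : A x -> s \in `]0%R, T[ -> (`|phi (x, s)| <= L * (T - s))%R.
  move=> Ax sT; have [r r0 Hr] := vanish Ax (or_intror (lexx T)).
  move: (sT); rewrite in_itv/= => /andP[s0 sT'].
  pose t := (T - Num.min r (T - s) / 2)%R.
  have m0 : (0 < Num.min r (T - s))%R by rewrite lt_min r0 subr_gt0.
  have mr : (Num.min r (T - s) <= r)%R by rewrite ge_min lexx.
  have ms : (Num.min r (T - s) <= T - s)%R by rewrite ge_min lexx orbT.
  have tT : t \in `]0%R, T[ by rewrite in_itv/= /t; apply/andP; split; lra.
  have pt : phi (x, t) = 0%R.
    by apply: Hr => //; rewrite gtr0_norm /t; lra.
  rewrite -[phi (x, s)]subr0 -pt; apply: le_trans (HL _ _ _ _ Ax Ax sT tT) _.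
  rewrite mdistxx add0r ler_wpM2l// ltr0_norm /t; lra.
split.
- move=> x Ax s t; wlog sT : s t / s \in `]0%R, T[.
    move=> W; have [sT|sT] := boolP (s \in `]0%R, T[); first exact: W.
    have [tT|tT] := boolP (t \in `]0%R, T[); first by rewrite distrC (distrC s); exact: W.
    by rewrite /time_ext/= (negbTE sT) (negbTE tT) subrr normr0 mulr_ge0.
  rewrite /time_ext/= sT; case: ifPn => tT.
    by have := HL _ _ _ _ Ax Ax sT tT; rewrite mdistxx add0r.
  rewrite subr0; move: tT; rewrite in_itv/= negb_and -!leNgt => /orP[t0|Tt].
    apply: le_trans (left _ _ Ax sT) _; rewrite ler_wpM2l//.
    by apply: le_trans (ler_norm _); lra.
  apply: le_trans (right _ _ Ax sT) _; rewrite ler_wpM2l// distrC.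
  by apply: le_trans (ler_norm _); lra.
- move=> x y t Ax Ay; rewrite /time_ext/=; case: ifPn => tT.
    by have := HL _ _ _ _ Ax Ay tT tT; rewrite subrr normr0 addr0.
  by rewrite subrr normr0 mulr_ge0 ?mdist_ge0.
- move=> x t Ax; rewrite /time_ext/=; case: ifPn => tT.
    apply: le_trans (left _ _ Ax tT) _; rewrite ler_wpM2l//.
    by move: tT; rewrite in_itv/= => /andP[_ /ltW].
  by rewrite normr0 mulr_ge0// ltW.
Qed.

Lemma time_ext_dt x t : t \in `]0%R, T[ ->
  dt phi x t = ((fun s => Phi (x, s))^`())%classic t.
Proof.
move=> tT; rewrite /dt !derive1E; apply: near_eq_derive; near=> s.
rewrite /time_ext/= ifT//; near: s; exact: near_in_itvoo.
Unshelve. all: by end_near. Qed.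

Lemma time_ext_slice_measurable t : measurable_fun A (fun x => Phi (x, t)).
Proof.
have [L L0 [_ H _]] := time_ext_lip.
apply: (loc_lipschitz_measurable oA) => x Ax; exists 1%R, L; split => //.
by move=> y z [Ay _] [Az _]; exact: H.
Qed.

(** Being Lipschitz in time, the extension is the infimum of the countably many
    functions obtained by moving from rational times at maximal slope. *)
Lemma time_ext_measurable : measurable_fun (A `*` [set: R]) Phi.
Proof.
have [L L0 [H _ _]] := time_ext_lip.
have mA : measurable A by exact: open_measurableX.
pose q (n : nat) : R := ratr (odflt 0%R (unpickle n : option rat)).
pose f n (z : X * R) := (Phi (z.1, q n) + L * `|z.2 - q n|)%:E.
have mf n : measurable_fun (A `*` [set: R]) (f n).
  apply/measurable_EFinP; apply: measurable_funD.
    apply: (@measurable_comp _ _ _ _ _ _ A (fun x => Phi (x, q n)) _ fst) => //.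
    - by move=> _ [z [Az _] <-].
    - exact: time_ext_slice_measurable.
    - exact: measurable_funTS measurable_fst.
  apply: measurable_funM => //; apply: measurableT_comp => //.
  by apply: measurable_funB => //; exact: measurable_funTS measurable_snd.
apply/measurable_EFinP.
apply: (eq_measurable_fun (fun z => einfs (f ^~ z) 0%N)); last first.
  exact: measurable_fun_einfs.
move=> [x t] /set_mem[/= Ax _]; rewrite /einfs/=; apply/eqP; rewrite eq_le.
apply/andP; split; last first.
  apply: le_ereal_inf_tmp => _ [n _ <-]; rewrite /f lee_fin/=.
  by have := H x Ax t (q n); rewrite ler_norml => /andP[_]; lra.
apply/lee_addgt0Pr => e e0; rewrite -EFinD.
pose dl := (e / (2 * L + 1))%R.
have L1 : (0 < 2 * L + 1)%R by lra.
have dl0 : (0 < dl)%R by rewrite divr_gt0.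
have dlE : (dl * (2 * L + 1) = e)%R by rewrite divfK// gt_eqF.
have tdl : (t - dl < t + dl)%R by lra.
have [r] := rat_in_itvoo tdl; rewrite in_itv/= => /andP[r1 r2].
apply: ge_ereal_inf; exists (f (pickle r) (x, t)); first by exists (pickle r).
rewrite /f /q pickleK/= lee_fin.
have := H x Ax (ratr r) t; rewrite ler_norml => /andP[_].
have : (`|t - ratr r| <= dl)%R by rewrite ler_norml; lra.
rewrite (distrC (ratr r)); set k := `|t - ratr r|%R => kdl.
have : (L * k <= L * dl)%R by rewrite ler_wpM2l.
by nra.
Qed.

End test_functions.

Section time_derivative.
Context {d} {R : realType} {X : completeBorelMetricType d R}.
Variable mu : {measure set X -> \bar R}.
Hypothesis sf : sigma_finite [set: X] mu.
Local Notation leb := (@lebesgue_measure R).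
Variables (A B : set X) (T : R) (phi : X * R -> R).
Hypothesis oA : open A.
Hypothesis T0 : (0 < T)%R.
Hypothesis tphi : lip_test A B T phi.
Local Notation Phi := (time_ext T phi).
Local Notation C := (cylinder A T).

Let mA : measurable A. Proof. exact: open_measurableX. Qed.
Let mC : measurable C. Proof. exact: cyl_measurable. Qed.

Let Q (h : R) (z : X * R) : R := (h^-1 * (Phi (z.1, h + z.2) - Phi z))%R.

Let Q_measurable h : measurable_fun C (Q h).
Proof.
have mPhi := time_ext_measurable oA T0 tphi.
have mAT : measurable (A `*` [set: R]) by exact: measurableX.
have CA : C `<=` A `*` [set: R] by move=> z [].
apply: measurable_funM => //; apply: measurable_funB; last exact: measurable_funS mPhi.
apply: (@measurable_comp _ _ _ _ _ _ (A `*` [set: R]) Phi C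
  (fun z => (z.1, h + z.2)%R)) => //.
  by move=> _ [z [Az _] <-].
apply: measurable_funTS; apply: measurable_fun_pair => /=; first exact: measurable_fst.
by apply: measurable_funD => //; exact: measurable_snd.
Qed.

Let rat_ (n : nat) : R := ratr (odflt 0%R (unpickle n : option rat)).

Let rat_near (h : R) (P : set R) : (\forall h' \near h, P h') -> exists n, P (rat_ n).
Proof.
move=> /nbhs_ballP[e /= e0 eP].
have he : (h - e < h + e)%R by lra.
have [r] := rat_in_itvoo he; rewrite in_itv/= => /andP[r1 r2].
exists (pickle r); rewrite /rat_ pickleK/=; apply: eP.
by rewrite /ball/= ltr_norml; lra.
Qed.

Let small (m n : nat) := (rat_ n != 0%R) && (`|rat_ n| < m.+1%:R^-1)%R.

(** The set where the difference quotients along rational increments are not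
    Cauchy: it is measurable in space and time, and outside of it the time
    derivative exists. *)
Let bad : set (X * R) := \bigcup_k \bigcap_m \bigcup_n \bigcup_n'
  (C `&` [set z | [&& small m n, small m n' &
                 (k.+1%:R^-1 < `|Q (rat_ n) z - Q (rat_ n') z|)%R]]).

Let bad_measurable : measurable bad.
Proof.
apply: bigcup_measurable => k _; apply: bigcap_measurable => [|m _]; first by exists 0%N.
apply: bigcup_measurable => n _; apply: bigcup_measurable => n' _.
case: (small m n) => /=; last by rewrite (_ : _ `&` _ = set0)//; apply/seteqP; split => // z [].
case: (small m n') => /=; last by rewrite (_ : _ `&` _ = set0)//; apply/seteqP; split => // z [].
have mf : measurable_fun C (fun z => `|Q (rat_ n) z - Q (rat_ n') z|%R).
  apply: measurableT_comp => //; exact: measurable_funB.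
have := mf mC `](k.+1%:R^-1)%R, +oo[%classic (measurable_itv _).
congr measurable; congr (_ `&` _); apply/seteqP; split => z /=; by rewrite in_itv/= andbT.
Qed.

Let badC : bad `<=` C.
Proof. by move=> z [k _ /(_ 0%N I)[n _ [n' _ []]]]. Qed.

Let derivable_notbad x t : A x -> t \in `]0%R, T[ ->
  derivable (fun s => Phi (x, s)) t 1 -> ~ bad (x, t).
Proof.
move=> Ax tT dx [k _ Hm].
have k0 : (0 < k.+1%:R^-1 / 2 :> R)%R by [].
have /(@cvgrPdist_lt _ R^o)/(_ _ k0) := dx.
set l := lim _ => /nbhs_ballP[e /= e0 He].
have Qe h : h != 0%R -> (`|h| < e)%R -> (`|l - Q h (x, t)| < k.+1%:R^-1 / 2)%R.
  move=> h0 he; have := He h; rewrite /ball/= sub0r normrN => /(_ he h0).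
  by rewrite /Q /= [(h *: 1)%R]mulr1.
have [m me] : exists m : nat, (m.+1%:R^-1 < e)%R.
  by exists (Num.truncn e^-1); rewrite invf_plt ?posrE// truncnS_gt.
have [n _ [n' _ [_ /= /and3P[/andP[n0 nm] /andP[n'0 n'm]]]]] := Hm m I.
apply/negP; rewrite -leNgt.
have h1 := Qe _ n0 (lt_trans nm me); have h2 := Qe _ n'0 (lt_trans n'm me).
have -> : (Q (rat_ n) (x, t) - Q (rat_ n') (x, t) =
  (l - Q (rat_ n') (x, t)) - (l - Q (rat_ n) (x, t)))%R by ring.
apply: le_trans (ler_normB _ _) _.
by have := ltrD h2 h1; rewrite -splitr => /ltW.
Qed.

Let notbad_derivable x t : A x -> t \in `]0%R, T[ -> ~ bad (x, t) ->
  derivable (fun s => Phi (x, s)) t 1.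
Proof.
move=> Ax tT nb; have [L L0 [H _ _]] := time_ext_lip T0 tphi.
rewrite /derivable; apply/cauchy_cvgP; apply: cauchy_exP => e e0.
have [k ke] : exists k : nat, (k.+1%:R^-1 < e)%R.
  by exists (Num.truncn e^-1); rewrite invf_plt ?posrE// truncnS_gt.
have [m Hm] : exists m, forall n n', small m n -> small m n' ->
    (`|Q (rat_ n) (x, t) - Q (rat_ n') (x, t)| <= k.+1%:R^-1)%R.
  apply: contrapT => /forallNP h; apply: nb; exists k => // m _.
  have /existsNP[n /existsNP[n' /not_implyP[sn /not_implyP[sn' /negP]]]] := h m.
  rewrite -ltNge => hk; exists n => //; exists n' => //; split => //=.
  by rewrite sn sn' hk.
have m0 : (0 < m.+1%:R^-1 :> R)%R by [].
have [n0 sn0] : exists n0, small m n0.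
  have [|n] := @rat_near (m.+1%:R^-1 / 2)%R (fun h => (h != 0%R) && (`|h| < m.+1%:R^-1)%R).
    near=> h; apply/andP; split.
      by rewrite gt_eqF//; near: h; apply: lt_nbhsr; rewrite divr_gt0.
    have h0 : (0 < h)%R by near: h; apply: lt_nbhsr; rewrite divr_gt0.
    rewrite gtr0_norm//; near: h; apply: lt_nbhsl.
    by rewrite ltr_pdivrMr// ltr_pMr// ltr1n.
  by exists n.
exists (Q (rat_ n0) (x, t)).
apply/nbhs_ballP; exists (m.+1%:R^-1)%R => //= h.
rewrite /ball/= sub0r normrN => hm h0; rewrite /ball/=.
rewrite [(h *: 1)%R]mulr1 -/(Q h (x, t)).
apply: le_lt_trans ke; rewrite leNgt; apply/negP => lt_k.
have cQ : {for h, continuous (fun h => Q h (x, t))}.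
  rewrite /Q /=; apply: (@cvgM R^o); first exact: cvgV.
  apply: (@cvgB _ R^o); last exact: cvg_cst.
  apply/(@cvgrPdist_le _ R^o) => r r0; near=> h'.
  apply: (le_trans (H x Ax _ _)); rewrite opprD addrACA subrr addr0.
  rewrite (@le_trans _ _ ((L + 1) * `|h - h'|)%R)//.
    by rewrite ler_wpM2r// lerDl.
  rewrite -ler_pdivlMl ?ltr_wpDl// mulrC.
  by near: h'; apply: (@cvgr_dist_le _ R^o) => //; rewrite divr_gt0// ltr_wpDl.
have [|n /and3P[n_0 nm nk]] := @rat_near h (fun h' => [&& h' != 0%R,
    (`|h'| < m.+1%:R^-1)%R & (k.+1%:R^-1 < `|Q (rat_ n0) (x, t) - Q h' (x, t)|)%R]).
  near=> h'; apply/and3P; split.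
  - near: h'; apply/nbhs_ballP; exists `|h|%R; first by rewrite /= normr_gt0.
    by move=> h'; apply: contraTneq => ->; rewrite /ball/= subr0 ltxx.
  - near: h'; apply: (@cvgr_lt _ _ _ _ (fun h => `|h|%R) `|h|%R) => //.
    exact: norm_continuous.
  - near: h'.
    have cN : (`|Q (rat_ n0) (x, t) - Q h' (x, t)|)%R @[h' --> h] -->
        `|Q (rat_ n0) (x, t) - Q h (x, t)|%R.
      apply: cvg_norm; apply: (@cvgB _ R^o); [exact: cvg_cst|exact: cQ].
    exact: (cvgr_gt _ cN).
have := Hm n0 n sn0 (introT andP (conj n_0 nm)).
by rewrite leNgt nk.
Unshelve. all: by end_near. Qed.

(** The derivative of a test function exists only almost everywhere. A
    representative of it is the limit of measurable difference quotients outside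
    of [bad], and zero on [bad]. By [lipschitz_FTC] and Fubini's theorem the
    exceptional set is null, on every line in the time direction and in the
    cylinder. *)
Lemma test_dt_repr : exists (D : X * R -> R) (L : R), [/\ (0 <= L)%R,
  measurable_fun C D, forall z, C z -> (`|D z| <= L)%R,
  forall x, A x -> {ae leb, forall t, t \in `]0%R, T[ ->
    derivable (fun s => Phi (x, s)) t 1 /\
    D (x, t) = ((fun s => Phi (x, s))^`())%classic t} &
  \forall z \ae (mu \x leb), C z -> dt phi z.1 z.2 = D z].
Proof.
have [L L0 [H _ _]] := time_ext_lip T0 tphi.
pose D := (fun z : X * R => dt phi z.1 z.2) \_ (C `\` bad).
have mG : measurable (C `\` bad) by exact: measurableD.
pose inc (n : nat) : R := (n.+1%:R^-1)%R.
have QD z : (C `\` bad) z -> Q (inc n) z @[n --> \oo] --> dt phi z.1 z.2.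
  move=> [[/= Ax tT]]; case: z => x t /= in Ax tT *.
  move=> nb; have := notbad_derivable Ax tT nb.
  rewrite (time_ext_dt phi x tT) derive1E => dx.
  have inc0 : inc n @[n --> \oo] --> (0%R : R)^'.
    move=> U /nbhs_ballP[e /= e0 eU].
    have [N _ HN] := near_infty_natSinv_lt (PosNum e0).
    exists N => // n /HN /= ne; apply: eU => /=; last by rewrite invr_eq0 pnatr_eq0.
    by rewrite /ball/= sub0r normrN gtr0_norm ?invr_gt0//; exact: ne.
  have := cvg_comp _ _ inc0 dx; apply: cvg_trans.
  apply: near_eq_cvg; apply: nearW => n /=.
  by rewrite /Q /= [(inc n *: 1)%R]mulr1.
have QL h z : C z -> h != 0%R -> (`|Q h z| <= L)%R.
  move=> [Ax _] h0; rewrite /Q normrM; case: z Ax => x t /= Ax.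
  rewrite normfV ler_pdivrMl ?normr_gt0// mulrC.
  by apply: le_trans (H x Ax _ _) _; rewrite addrK.
exists D, L; split => //.
- apply: (measurable_fun_cvg (h := fun n => Q (inc n) \_ (C `\` bad))).
    move=> n; apply/(measurable_restrict _ mG mC).
    apply: measurable_funS (Q_measurable (inc n)) => //; exact: subIsetl.
  move=> z Cz; rewrite /D; have [/set_mem nb|nb] := boolP (z \in C `\` bad).
    under eq_fun do rewrite patchE mem_set//.
    by rewrite patchE mem_set//; exact: QD.
  under eq_fun do rewrite patchE (negbTE nb).
  by rewrite patchE (negbTE nb); exact: cvg_cst.
- move=> z Cz; rewrite /D patchE; case: ifPn => [/set_mem nb|_]; last first.
    by rewrite [`|_|%R](normr0 R).
  apply/ler_addgt0Pr => e e0; have /(@cvgrPdist_lt _ R^o)/(_ _ e0)[n _ Hn] := QD z nb.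
  have := Hn n (leqnn n); have := QL (inc n) z Cz.
  rewrite /inc invr_eq0 pnatr_eq0 => /(_ isT) h1 h2.
  rewrite -[dt _ _ _](subrK (Q (inc n) z)).
  by apply: (le_trans (ler_normD _ _)); rewrite addrC lerD// ltW.
- move=> x Ax; have /(_ _)[] := @lipschitz_FTC R (fun s => Phi (x, s)) L 0 T T0.
    by move=> s t _ _; exact: H.
  move=> + _; apply: ae_imp => t dx tT; split; first exact: dx.
  rewrite /D patchE mem_set; first by rewrite (time_ext_dt phi x tT).
  by split => //; apply: derivable_notbad => //; exact: dx.
- exists bad; split => //.
    apply: (cyl_null sf (A := A) (T := T)) => // x Ax.
    have /(_ _)[] := @lipschitz_FTC R (fun s => Phi (x, s)) L 0 T T0.
      by move=> s t _ _; exact: H.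
    move=> [N [mN N0 sN]] _; apply/eqP; rewrite eq_le measure_ge0 andbT -N0.
    rewrite le_measure ?inE//; first exact: measurable_xsection.
    move=> t /xsectionP bt; apply: sN => /= h.
    have [_ tT] := badC bt.
    by apply: derivable_notbad (h tT) bt.
  move=> z /= h; apply: contrapT => nb; apply: h => Cz.
  by rewrite /D patchE mem_set.
Qed.

End time_derivative.

(** * Curves in L^2 and their total variation *)

Section interval_integrals.
Context {R : realType}.
Local Notation leb := (@lebesgue_measure R).
Implicit Types (a b : R) (f : R -> \bar R).

Lemma lebesgue_itv_oo a b : (a <= b)%R -> leb (`]a, b[%classic : set R) = (b - a)%:E.
Proof.
rewrite le_eqVlt lebesgue_measure_itv/= lte_fin => /predU1P[->|->].
  by rewrite ltxx subrr.
by rewrite EFinB.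
Qed.

(** A measurable function does not exceed its mean everywhere, not even up to a
    null set. *)
Lemma mean_pick a b f (P : R -> Prop) (e : R) : (a < b)%R -> (0 < e)%R ->
  (forall t, t \in `]a, b[ -> 0 <= f t) -> (\forall t \ae leb, t \in `]a, b[ -> P t) ->
  exists s, [/\ s \in `]a, b[, P s &
    (b - a)%:E * f s <= \int[leb]_(t in `]a, b[) f t + e%:E].
Proof.
move=> ab e0 f0 aeP; apply: contrapT => nos.
have ba0 : (0 < b - a)%R by rewrite subr_gt0.
have H s : s \in `]a, b[ -> P s ->
    \int[leb]_(t in `]a, b[) f t + e%:E < (b - a)%:E * f s.
  move=> sab Ps; rewrite ltNge; apply/negP => h; apply: nos; by exists s.
have int_cst (c : \bar R) : \int[leb]_(t in `]a, b[) cst c t = c * (b - a)%:E.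
  have E := lebesgue_itv_oo (ltW ab).
  exact: (etrans (integral_cst leb (measurable_itv _) c) (congr1 (fun e => c * e) E)).
move: H; set I := \int[leb]_(t in `]a, b[) f t => H.
have step (c : R) : (forall s, s \in `]a, b[ -> P s -> c%:E <= (b - a)%:E * f s) -> c%:E <= I.
  move=> Hc; have -> : c%:E = \int[leb]_(t in `]a, b[) cst ((c / (b - a))%:E) t.
    by rewrite int_cst -EFinM divfK// gt_eqF.
  apply: ae_le_integral_gen; apply: ae_imp aeP => s Ps sab.
  have -> : (cst (c / (b - a))%:E s : \bar R) = (b - a)^-1%:E * c%:E by rewrite /= mulrC EFinM.
  by rewrite lee_pdivrMl//; apply: Hc => //; exact: Ps.
have I0 : 0 <= I by apply: integral_ge0 => t /= tab; exact: f0.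
move: I0 H step; case: I => [r| |] // I0 H step.
- have := step (r + e)%R (fun s sab Ps => ltW (H s sab (Ps))).
  by rewrite lee_fin gerDl leNgt e0.
- have := step 1%R; rewrite leey => _.
  have : leb (`]a, b[%classic : set R) = 0.
    apply/eqP; rewrite eq_le measure_ge0 andbT.
    have [N [mN N0 sN]] := aeP; rewrite -N0.
    rewrite le_measure ?inE//.
    move=> s /= sab; apply: sN => /= /(_ sab) Ps.
    by have := H s sab Ps; rewrite addye// ltNge leey.
  by rewrite lebesgue_itv_oo ?ltW// => -[]; lra.
Qed.

Lemma integral_uniform_partition f (dl : R) (N : nat) : (0 < dl)%R ->
  leb.-integrable `]0%R, (N%:R * dl)%R[ f ->
  \int[leb]_(t in `]0%R, (N%:R * dl)%R[) f t =
  \sum_(j < N) \int[leb]_(t in `](j%:R * dl)%R, (j.+1%:R * dl)%R[) f t.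
Proof.
move=> dl0; elim: N => [|N IH] fi.
  by rewrite big_ord0 mul0r set_itv_ge ?bnd_simp ?ltxx// integral_set0.
have jN : (N%:R * dl <= N.+1%:R * dl)%R by rewrite ler_wpM2r ?ltW// ltr_nat.
have N0 : (0 <= N%:R * dl)%R by rewrite mulr_ge0// ltW.
have fiN : leb.-integrable `]0%R, (N%:R * dl)%R[ f.
  by apply: integrableS fi => //; apply: subset_itvl; rewrite bnd_simp.
rewrite big_ord_recr/= -IH//.
have mf : measurable_fun `]0%R, (N.+1%:R * dl)%R[ f by exact: measurable_int fi.
move: N0; rewrite le_eqVlt => /predU1P[N0|N0].
  have -> : \int[leb]_(t in `]0%R, (N%:R * dl)%R[) f t = 0.
    by rewrite set_itv_ge ?integral_set0// bnd_simp -N0 ltxx.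
  by rewrite -N0 add0e.
have E : `]0%R, (N.+1%:R * dl)%R[%classic =
  `]0%R, (N%:R * dl)%R[%classic `|` `[(N%:R * dl)%R, (N.+1%:R * dl)%R[%classic :> set R.
  by rewrite -itv_bndbnd_setU// bnd_simp// ltW.
rewrite {1}E integral_setU//=; last 2 first.
- by rewrite -E; exact: (measurable_int _ fi).
- by apply/disj_setPS => x [/=]; rewrite !in_itv/= => /andP[_ xN] /andP[]; rewrite leNgt xN.
congr (_ + _); apply/esym; apply: integral_itv_obnd_cbnd.
apply: measurable_funS mf => //; apply: subset_itv; rewrite bnd_simp//.
exact: ltW.
Qed.

End interval_integrals.

Section continuous_L2_curves.
Context {d} {R : realType} {X : completeBorelMetricType d R}.
Variable mu : {measure set X -> \bar R}.
Local Notation leb := (@lebesgue_measure R).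
Variables (A : set X) (T : R) (v : X * R -> R) (V : R -> X -> R).
Hypothesis mA : measurable A.
Hypothesis cV : C0_rep mu 2%:E A T v V.
Local Notation dist s t := (\int[mu]_(x in A) ((V s x - V t x) ^+ 2)%:E).

Lemma C0_square_integrable t : t \in `[0%R, T] -> square_integrable mu A (V t).
Proof. by move=> tT; apply/in_L2P => //; have [h _ _] := cV; exact: h. Qed.

Lemma C0_continuous t (e : R) : t \in `[0%R, T] -> (0 < e)%R ->
  exists2 dl : R, (0 < dl)%R & forall s, s \in `[0%R, T] -> (`|t - s| < dl)%R ->
    dist s t <= e%:E.
Proof.
move=> tT e0; have [_ /(_ t tT) h _] := cV.
pose r := Num.sqrt e; have r0 : (0 < r)%R by rewrite sqrtr_gt0.
have nV : nbhs (0 : \bar R) [set y : \bar R | y < r%:E].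
  by apply: open_nbhs_nbhs; split; [exact: open_ereal_lt_ereal|rewrite /= lte_fin].
have /nbhs_ballP[dl /= dl0 H] := h _ nV; exists dl => // s sT ts.
have := H s ts sT; rewrite /= -(Lpnorm2_sqr mu A (fun x => V s x - V t x)%R) => hr.
rewrite -(sqr_sqrtr (ltW e0)) -/r expe2 expr2 EFinM.
have N0 : 0 <= Lpnorm mu 2%:E A (fun x => V s x - V t x)%R by exact: Lnorm_ge0.
by apply: lee_pmul => //; exact: ltW.
Qed.

(** Compactness of the time interval. *)
Lemma C0_uniform (e : R) : (0 < e)%R ->
  exists2 dl : R, (0 < dl)%R & forall s t, s \in `[0%R, T] -> t \in `[0%R, T] ->
    (`|t - s| < dl)%R -> dist s t <= e%:E.
Proof.
move=> e0; have e40 : (0 < e / 4)%R by rewrite divr_gt0.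
have cI : compact `[0%R, T]%classic by exact: segment_compact.
have /compact_near_coveringP/(_ _ (0%R^'+) (fun dl t => t \in `[0%R, T] ->
  forall s, s \in `[0%R, T] -> (`|t - s| < dl)%R -> dist s t <= e%:E)) := cI.
have key t : `[0%R, T]%classic t -> \forall t' \near t & dl \near 0%R^'+,
    (fun dl t => t \in `[0%R, T] -> forall s, s \in `[0%R, T] ->
      (`|t - s| < dl)%R -> dist s t <= e%:E) dl t'.
  move=> tT; have [r r0 Hr] := C0_continuous tT e40.
  exists (ball t (r / 2), [set i | i <= r / 2]%R).
    split => /=; first by apply: nbhsx_ballx; rewrite divr_gt0.
    by apply: nbhs_right_le; rewrite divr_gt0.
  move=> [t' i] /= [tt' ir] t'T s sT t's.
  have h1 : dist t' t <= (e / 4)%:E.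
    by apply: Hr => //; apply: lt_trans tt' _; rewrite ltr_pdivrMr// ltr_pMr// ltr1n.
  have h2 : dist s t <= (e / 4)%:E.
    apply: Hr => //; rewrite /ball/= in tt'.
    have -> : (t - s = (t - t') + (t' - s))%R by rewrite addrA subrK.
    by apply: (le_lt_trans (ler_normD _ _)); lra.
  have [mt _] := C0_square_integrable tT; have [mt' _] := C0_square_integrable t'T.
  have [ms _] := C0_square_integrable sT.
  apply: (@le_trans _ _ (2%:E * dist s t + 2%:E * dist t' t)).
    have := @int_sqrD _ _ _ mu A mA (fun x => V s x - V t x)%R (fun x => - (V t' x - V t x))%R.
    rewrite (eq_integral (fun x => ((V t' x - V t x) ^+ 2)%:E) (fun x => ((- (V t' x - V t x)) ^+ 2)%:E)); last first.
      by move=> x _; rewrite sqrrN.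
    move=> H; apply: le_trans (H _ _); last 2 first.
    - exact: measurable_funB.
    - by apply: measurableT_comp => //; exact: measurable_funB.
    by apply: le_integral_gen => x _; rewrite lee_fin opprB addrA subrK.
  apply: (@le_trans _ _ (2%:E * (e / 4)%:E + 2%:E * (e / 4)%:E)).
    by apply: leeD; apply: lee_wpmul2l; rewrite ?lee_fin.
  by rewrite -!EFinM -EFinD lee_fin; lra.
move=> /(_ _ key) H.
have [dl [H1 dl0]] : exists dl : R, (`[0%R, T]%classic `<=` (fun t => t \in `[0%R, T] -> forall s, s \in `[0%R, T] ->
      (`|t - s| < dl)%R -> dist s t <= e%:E)) /\ (0 < dl)%R.
  near (0%R : R)^'+ => dl; exists dl; split; first by near: dl.
  by near: dl; exact: nbhs_right_gt.
by exists dl => // s t sT tT; apply: H1.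
Unshelve. all: by end_near. Qed.

End continuous_L2_curves.

Section total_variation_measurable.
Context {d} {R : realType} {X : completeBorelMetricType d R}.
Variable mu : {measure set X -> \bar R}.
Hypothesis dbl : doubling mu.
Variable A : set X.
Hypothesis oA : open A.
Hypothesis bA : metric_bounded A.

(** By lower semicontinuity, the sublevel sets of the total variation along a
    curve that is continuous in L^1 are relatively closed. *)
Lemma totvar_measurable (I : set R) (W : R -> X -> R) : measurable I ->
  (forall t, I t -> measurable_fun A (W t)) ->
  (forall t (e : R), I t -> (0 < e)%R -> exists2 dl : R, (0 < dl)%R &
     forall s, I s -> (`|t - s| < dl)%R ->
       \int[mu]_(x in A) `|W s x - W t x|%:E <= e%:E) ->
  measurable_fun I (fun t => totvar mu (W t) A).
Proof.
move=> mI mW cW.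
apply: (measurability _ (ErealGenOInfty.measurableE R)) => _ [_ [r ->] <-].
pose S := I `&` [set t | totvar mu (W t) A <= r%:E].
have -> : I `&` (fun t => totvar mu (W t) A) @^-1` `]r%:E, +oo[%classic = I `\` closure S.
  apply/seteqP; split => t [It] /=; rewrite ?in_itv/= ?andbT.
    move=> rt; split => // cSt; move: rt; rewrite ltNge => /negP; apply.
    apply: (totvar_lsc dbl oA bA) => [|e e0]; first exact: mW.
    have [dl dl0 Hdl] := cW t e It e0.
    have [s [[Is sr] ts]] := cSt _ (nbhsx_ballx t _ dl0).
    by exists (W s); split; [exact: mW|exact: sr|exact: Hdl].
  move=> nS; split => //; rewrite /= ltNge; apply/negP => tr.
  by apply: nS; apply: subset_closure.
apply: measurableD => //; apply: closed_measurable; exact: closed_closure.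
Qed.

End total_variation_measurable.

Section curves.
Context {d} {R : realType} {X : completeBorelMetricType d R}.
Variable mu : {measure set X -> \bar R}.
Hypothesis dbl : doubling mu.
Local Notation leb := (@lebesgue_measure R).
Variables (A : set X) (T : R).
Hypothesis oA : open A.
Hypothesis bA : metric_bounded A.
Hypothesis T0 : (0 < T)%R.

Let mA : measurable A. Proof. exact: open_measurableX. Qed.
Let Afin : mu A < +oo. Proof. exact: bounded_measure_lty. Qed.

Definition L2_uniform (W : R -> X -> R) := forall e : R, (0 < e)%R ->
  exists2 r : R, (0 < r)%R & forall s t, s \in `[0%R, T] -> t \in `[0%R, T] ->
    (`|t - s| < r)%R -> \int[mu]_(x in A) ((W s x - W t x) ^+ 2)%:E <= e%:E.

(** On a set of finite measure continuity in L^2 implies continuity in L^1, which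
    is what lower semicontinuity of the total variation requires. *)
Lemma totvar_measurable_L2 (W : R -> X -> R) :
  (forall t, t \in `[0%R, T] -> measurable_fun A (W t)) -> L2_uniform W ->
  measurable_fun `]0%R, T[ (fun t => totvar mu (W t) A).
Proof.
move=> mW uW; have I0T t : t \in `]0%R, T[ -> t \in `[0%R, T] by exact: subset_itv_oo_cc.
apply: (totvar_measurable dbl oA bA (measurable_itv _)) => [t tT|t e tT e0].
  exact/mW/I0T.
pose m := fine (mu A); have m0 : (0 <= m)%R by exact: fine_ge0.
have mE : mu A = m%:E by rewrite fineK// ge0_fin_numE.
pose e' := (e / (2 * (m + 1)))%R.
have e'0 : (0 < e')%R by rewrite divr_gt0// mulr_gt0// ltr_wpDl.
have [r r0 Hr] := uW (e' * (e / 2))%R (mulr_gt0 e'0 (divr_gt0 e0 (ltr0Sn _ 1))).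
exists r => // s sT ts; have := Hr s t (I0T _ sT) (I0T _ tT) ts => Hst.
apply: (le_trans (int_abs_le_sqr mu mA e'0 _)).
  by apply: measurable_funB; apply: mW; exact: I0T.
have e'i : 0 <= (e'^-1)%:E :> \bar R by rewrite lee_fin invr_ge0 ltW.
apply: (le_trans (leeD2l _ (lee_wpmul2l e'i Hst))).
rewrite mE -!EFinM -EFinD lee_fin mulKf ?gt_eqF//.
have -> : (e / 2 = e' * (m + 1))%R by rewrite /e'; field; rewrite gt_eqF// ltr_wpDl.
have -> : (e = e' * (m + 1) + e' * (m + 1))%R.
  by rewrite /e'; field; rewrite gt_eqF// ltr_wpDl.
by rewrite lerD2r ler_pM2l// lerDl.
Qed.

Lemma L2_uniformD (U : R -> X -> R) (phi : X * R -> R) (K : R) :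
  (forall t, t \in `[0%R, T] -> measurable_fun A (U t)) -> L2_uniform U ->
  (forall t, measurable_fun A (fun x => phi (x, t))) -> (0 <= K)%R ->
  (forall x s t, A x -> (`|phi (x, s) - phi (x, t)| <= K * `|s - t|)%R) ->
  L2_uniform (fun t x => U t x + phi (x, t))%R.
Proof.
move=> mU uU mphi K0 Kphi e e0.
pose m := fine (mu A); have m0 : (0 <= m)%R by exact: fine_ge0.
have mE : mu A = m%:E by rewrite fineK// ge0_fin_numE.
have e4 : (0 < e / 4)%R by rewrite divr_gt0.
have [r1 r10 H1] := uU _ e4.
have M0 : (0 < K ^+ 2 * m + 1)%R by rewrite ltr_wpDl// mulr_ge0// sqr_ge0.
pose r2 := Num.min 1%R (e / 4 / (K ^+ 2 * m + 1))%R.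
have r20 : (0 < r2)%R by rewrite lt_min ltr01 divr_gt0.
exists (Num.min r1 r2); first by rewrite lt_min r10.
move=> s t sT tT; rewrite lt_min => /andP[ts1 ts2].
have -> : (fun x => ((U s x + phi (x, s) - (U t x + phi (x, t))) ^+ 2)%:E) =
    (fun x => (((U s x - U t x) + (phi (x, s) - phi (x, t))) ^+ 2)%:E).
  by apply/funext => x; congr (_ ^+ 2)%:E; ring.
apply: (le_trans (int_sqrD mu mA _ _)).
- by apply: measurable_funB; exact: mU.
- exact: measurable_funB.
have h1 := H1 s t sT tT ts1.
have h2 : \int[mu]_(x in A) ((phi (x, s) - phi (x, t)) ^+ 2)%:E <= (e / 4)%:E.
  apply: (@le_trans _ _ (\int[mu]_(x in A) cst (K ^+ 2 * `|s - t|)%:E x)).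
    apply: le_integral_gen => x Ax; rewrite lee_fin -(real_normK (num_real (_ - _))).
    apply: (@le_trans _ _ ((K * `|s - t|) ^+ 2)%R).
      by rewrite lerXn2r ?nnegrE ?mulr_ge0//; exact: Kphi.
    rewrite exprMn ler_wpM2l ?sqr_ge0// expr2 ler_piMr// distrC ltW//.
    by apply: (lt_le_trans ts2); rewrite ge_min lexx.
  rewrite integral_cst// mE -EFinM lee_fin mulrAC.
  apply: (@le_trans _ _ ((K ^+ 2 * m + 1) * `|s - t|)%R).
    by rewrite ler_wpM2r// lerDl.
  rewrite mulrC -ler_pdivlMr// distrC ltW//.
  by apply: (lt_le_trans ts2); rewrite ge_min lexx orbT.
apply: (le_trans (leeD (lee_wpmul2l _ h1) (lee_wpmul2l _ h2))) => //.
by rewrite -!EFinM -EFinD lee_fin; lra.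
Qed.

End curves.

(** * Piecewise affine functions of time *)

Section ramp.
Context {R : realType}.
Implicit Types (a l s t : R).

(** The Lipschitz primitive of the indicator function of the interval from [a] to
    [a + l] that vanishes before [a]. *)
Definition ramp a l t : R := Num.max 0%R (Num.min (t - a) l)%R.

Lemma ramp_lip a l s t : (`|ramp a l s - ramp a l t| <= `|s - t|)%R.
Proof.
wlog st : s t / (s <= t)%R.
  by move=> H; have [/H//|/ltW/H] := leP s t; rewrite distrC [X in (_ <= X)%R]distrC.
rewrite (ler0_norm (_ : s - t <= 0)%R) ?subr_le0// ler_norml.
have E (r : R) : ramp a l r = (if r - a <= l then if 0 <= r - a then r - a else 0
    else if 0 <= l then l else 0)%R.
  by rewrite /ramp minEle; case: ifP => _; rewrite maxEle.
by rewrite !E; do !(case: ifPn; rewrite -?ltNge => ?); apply/andP; split; lra.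
Qed.

Lemma ramp_ge0 a l t : (0 <= ramp a l t)%R.
Proof. by rewrite /ramp le_max lexx. Qed.

Lemma ramp_le a l t : (0 <= l)%R -> (ramp a l t <= l)%R.
Proof. by move=> l0; rewrite /ramp ge_max l0 ge_min lexx orbT. Qed.

Lemma ramp_before a l t : (t <= a)%R -> ramp a l t = 0%R.
Proof. by move=> ta; apply/max_idPl; rewrite ge_min subr_le0 ta. Qed.

Lemma ramp_during a l t : (a <= t)%R -> (t <= a + l)%R -> ramp a l t = (t - a)%R.
Proof.
move=> at_ tl; rewrite /ramp; have -> : Num.min (t - a)%R l = (t - a)%R.
  by apply/min_idPl; rewrite lerBlDl.
by apply/max_idPr; rewrite subr_ge0.
Qed.

Lemma ramp_after a l t : (0 <= l)%R -> (a + l <= t)%R -> ramp a l t = l.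
Proof.
move=> l0 lt_; rewrite /ramp; have -> : Num.min (t - a)%R l = l.
  by apply/min_idPr; rewrite lerBrDl.
exact/max_idPr.
Qed.

Lemma ramp_is_derive a l t : (0 < l)%R -> t != a -> t != (a + l)%R ->
  is_derive t 1%R (ramp a l) (\1_(`[a, (a + l)%R[%classic) t).
Proof.
move=> l0; rewrite !neq_lt indicE => /orP[ta _|at_ /orP[tl|lt_]].
- rewrite memNset/=; last by rewrite in_itv/= leNgt ta.
  have dc : is_derive t (1%R : R) (fun=> 0%R : R) (0%R : R) by exact: is_derive_cst.
  apply: near_eq_is_derive dc.
  near=> s; rewrite ramp_before//; apply: ltW; near: s; exact: lt_nbhsl.
- rewrite mem_set/=; last by rewrite in_itv/= ltW.
  have dc : is_derive t (1%R : R) (fun s : R => s - a : R)%R (1%R : R).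
    by rewrite -[X in is_derive _ _ _ X]subr0; apply: is_deriveB.
  apply: near_eq_is_derive dc.
  near=> s; rewrite ramp_during//; apply: ltW; near: s; [exact: lt_nbhsr|exact: lt_nbhsl].
- rewrite memNset/=; last by rewrite in_itv/= ltW//= ltNge ltW.
  have dc : is_derive t (1%R : R) (fun=> l : R) (0%R : R) by exact: is_derive_cst.
  apply: near_eq_is_derive dc.
  near=> s; rewrite ramp_after ?ltW//; near: s; exact: lt_nbhsr.
Unshelve. all: by end_near. Qed.

Lemma ramp_measurable a l (D : set R) : measurable_fun D (ramp a l).
Proof.
apply: measurable_maxr => //; apply: measurable_minr => //.
exact: measurable_funB.
Qed.

End ramp.

Lemma square_integrable_sum {d} {T : measurableType d} {R : realType}
    (m : {measure set T -> \bar R}) (C : set T) (N : nat) (F : 'I_N -> T -> R) :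
  measurable C -> (forall j, square_integrable m C (F j)) ->
  square_integrable m C (fun z => \sum_(j < N) F j z)%R.
Proof.
move=> mC; elim: N F => [|N IH] F HF.
  have -> : (fun z => \sum_(j < 0) F j z)%R = cst 0%R.
    by apply/funext => z; rewrite big_ord0.
  by split => //; under eq_integral do rewrite /= expr0n; rewrite integral0.
have -> : (fun z => \sum_(j < N.+1) F j z)%R =
    (fun z => \sum_(j < N) F (widen_ord (leqnSn N) j) z + F ord_max z)%R.
  by apply/funext => z; rewrite big_ord_recr.
by apply: square_integrableD => //; apply: IH.
Qed.

Lemma Linfty_square_integrable {d} {T : measurableType d} {R : realType}
    (m : {measure set T -> \bar R}) (C : set T) (k : T -> R) :
  measurable C -> m C < +oo -> in_Lp m +oo setT k -> square_integrable m C k.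
Proof.
move=> mC Cfin [mk kfin]; have mkC : measurable_fun C k by exact: measurable_funS mk.
have [M HM] : exists M : R, \forall x \ae m, (`|k x| <= M)%R.
  have [m0|m0] := leP (m setT) 0.
    exists 0%R; exists setT; split => //.
    by apply/eqP; rewrite eq_le m0 measure_ge0.
  move: kfin; rewrite /Lpnorm unlock/= m0 patch_setT => kfin.
  exists (fine (ess_sup m (abse \o (EFin \o k)))).
  have := ess_sup_ge m (abse \o (EFin \o k)); apply: ae_imp => x /=.
  by case: (ess_sup m _) kfin => [r| |].
split => //; apply: (@le_lt_trans _ _ (\int[m]_(x in C) (cst (M ^+ 2)%:E) x)).
  apply: ae_le_integral_gen; apply: ae_imp HM => x kM _; rewrite lee_fin.
  by rewrite -(real_normK (num_real (k x))) lerXn2r// ?nnegrE// (le_trans _ kM).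
by rewrite integral_cst// lte_mul_pinfty// lee_fin sqr_ge0.
Qed.

Section separated_functions.
Context {d} {R : realType} {X : completeBorelMetricType d R}.
Variable mu : {measure set X -> \bar R}.
Hypothesis sf : sigma_finite [set: X] mu.
Local Notation leb := (@lebesgue_measure R).
Variables (A : set X) (T : R).
Hypothesis mA : measurable A.
Hypothesis T0 : (0 < T)%R.
Local Notation C := (cylinder A T).

Lemma measurable_space d' (Y : measurableType d') (f : X -> Y) :
  measurable_fun A f -> measurable_fun C (fun z => f z.1).
Proof.
move=> mf; apply: (measurable_comp mA) mf _; last exact: measurable_funS measurable_fst.
by move=> _ [z [Az _] <-].
Qed.

Lemma measurable_time d' (Y : measurableType d') (c : R -> Y) :
  measurable_fun `]0%R, T[ c -> measurable_fun C (fun z => c z.2).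
Proof.
move=> mc; apply: (measurable_comp (measurable_itv `]0%R, T[)) mc _.
  by move=> _ [z [_ tz] <-].
exact: measurable_funS measurable_snd.
Qed.

Lemma square_integrable_space (f : X -> R) : square_integrable mu A f ->
  square_integrable (mu \x leb) C (fun z => f z.1).
Proof.
move=> [mf f2]; split; first exact: measurable_space.
rewrite (cyl_tonelli2 sf mA)/=; last 2 first.
- by apply: measurable_sqr; exact: measurable_space.
- by move=> z _; rewrite lee_fin sqr_ge0.
have E := lebesgue_itv_oo (ltW T0).
have -> : \int[leb]_(t in `]0%R, T[) (\int[mu]_(x in A) (f x ^+ 2)%:E) =
  (\int[mu]_(x in A) (f x ^+ 2)%:E) * (T - 0)%:E.
  exact: (etrans (integral_cst leb (measurable_itv _) _) (congr1 (fun e => _ * e) E)).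
by rewrite muleC lte_mul_pinfty// ?lee_fin subr0 ?ltW// ge0_int_sqr.
Qed.

Lemma square_integrable_sep (c : R -> R) (M : R) (f : X -> R) :
  measurable_fun `]0%R, T[ c -> (forall t, (`|c t| <= M)%R) -> square_integrable mu A f ->
  square_integrable (mu \x leb) C (fun z => c z.2 * f z.1)%R.
Proof.
move=> mc cM sf_; have [mf _] := sf_.
have sC := square_integrable_space sf_.
apply: (@square_integrable_le _ (X * measurableTypeR R)%type R (mu \x leb) C
  (cyl_measurable T mA) _ _ (M ^+ 2)%R _ sC).
  by apply: measurable_funM; [exact: measurable_time|exact: measurable_space].
move=> z _; rewrite exprMn ler_wpM2r ?sqr_ge0//.
by rewrite -(real_normK (num_real (c _))) lerXn2r// ?nnegrE// (le_trans _ (cM z.2)).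
Qed.

End separated_functions.

Section integration_by_parts.
Context {d} {R : realType} {X : completeBorelMetricType d R}.
Variable mu : {measure set X -> \bar R}.
Hypothesis sf : sigma_finite [set: X] mu.
Local Notation leb := (@lebesgue_measure R).
Variables (A B : set X) (T : R) (phi : X * R -> R).
Hypothesis oA : open A.
Hypothesis Afin : mu A < +oo.
Hypothesis T0 : (0 < T)%R.
Hypothesis tphi : lip_test A B T phi.
Local Notation Phi := (time_ext T phi).
Local Notation C := (cylinder A T).
Let mA : measurable A. Proof. exact: open_measurableX. Qed.

Lemma time_ext_square_integrable : square_integrable (mu \x leb) C Phi.
Proof.
have [L L0 [_ _ HM]] := time_ext_lip T0 tphi.
apply: (@square_integrable_bounded _ (X * measurableTypeR R)%type R (mu \x leb) C _ _ _ (L * T)%R).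
- exact: cyl_measurable.
- exact: cyl_measure.
- apply: measurable_funS (time_ext_measurable oA T0 tphi).
  + by apply: measurableX.
  + by move=> z [].
- by move=> [x t] [Ax _]; exact: HM.
Qed.

(** For almost every point in space the integrand is the derivative in time of
    a Lipschitz function that vanishes at both ends of the time interval. *)
Lemma integration_by_parts_time (D v w : X * R -> R) :
  square_integrable (mu \x leb) C D ->
  square_integrable (mu \x leb) C v -> square_integrable (mu \x leb) C w ->
  (forall x, A x -> {ae leb, forall t, t \in `]0%R, T[ ->
    derivable (fun s => Phi (x, s)) t 1 /\
    D (x, t) = ((fun s => Phi (x, s))^`())%classic t}) ->
  (forall x, A x -> exists2 K : R, (0 <= K)%R & {in `[0%R, T] &, forall s t,
    (`|v (x, s) - v (x, t)| <= K * `|s - t|)%R}) ->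
  (forall x, A x -> {ae leb, forall t, t \in `]0%R, T[ ->
    is_derive t 1%R (fun s => v (x, s)) (w (x, t))}) ->
  \int[mu \x leb]_(z in C) (v z * D z)%:E = - \int[mu \x leb]_(z in C) (w z * Phi z)%:E.
Proof.
move=> sD sv sw HD Hv Hw; have sP := time_ext_square_integrable.
have mC := cyl_measurable T mA.
have ivD := @integrable_mul _ (X * measurableTypeR R)%type R (mu \x leb) C mC _ _ sv sD.
have iwP := @integrable_mul _ (X * measurableTypeR R)%type R (mu \x leb) C mC _ _ sw sP.
have key : \int[mu \x leb]_(z in C) ((v z * D z)%:E + (w z * Phi z)%:E) = 0.
  rewrite (cyl_fubini1 sf mA); last exact: integrableD.
  rewrite -[RHS](integral0 mu A); apply: eq_integral => x /set_mem Ax /=.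
  have [L L0 [HL _ HM]] := time_ext_lip T0 tphi.
  have [K K0 HK] := Hv x Ax.
  pose F t := (v (x, t) * Phi (x, t))%R.
  have v_le t : t \in `[0%R, T] -> (`|v (x, t)| <= `|v (x, 0%R)| + K * T)%R.
    move=> tT; have h0 : (0%R : R) \in `[0%R, T] by rewrite in_itv/= lexx ltW.
    rewrite -[v (x, t)](subrK (v (x, 0%R))); apply: le_trans (ler_normD _ _) _.
    rewrite addrC lerD2l; apply: le_trans (HK _ _ tT h0) _.
    move: tT; rewrite in_itv/= => /andP[t0 tT].
    by rewrite subr0 ger0_norm// ler_wpM2l.
  have FL : {in `[0%R, T] &, forall s t, (`|F s - F t| <=
      ((`|v (x, 0%R)| + K * T) * L + L * T * K) * `|s - t|)%R}.
    move=> s t sT tT; rewrite /F.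
    have -> : (v (x, s) * Phi (x, s) - v (x, t) * Phi (x, t) =
      v (x, s) * (Phi (x, s) - Phi (x, t)) + Phi (x, t) * (v (x, s) - v (x, t)))%R by ring.
    have -> : (((`|v (x, 0%R)| + K * T) * L + L * T * K) * `|s - t| =
      (`|v (x, 0%R)| + K * T) * (L * `|s - t|) + L * T * (K * `|s - t|))%R by ring.
    apply: le_trans (ler_normD _ _) _; rewrite !normrM.
    by apply: lerD; apply: ler_pM; rewrite ?normr_ge0//; [exact: v_le|exact: HL|exact: HM|exact: HK].
  have [_ FTC] := lipschitz_FTC T0 FL.
  transitivity (\int[leb]_(t in `]0%R, T[) (F^`()%classic t)%:E).
    apply: ae_eq_integral_gen; apply: ae_imp2 (HD x Ax) (Hw x Ax) => t hD hw tT.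
    have [dP DE] := hD tT; have dv := hw tT.
    rewrite -EFinD; congr EFin; rewrite derive1E /F.
    have dP' : is_derive t 1%R (fun s => Phi (x, s)) (D (x, t)).
      by rewrite DE derive1E; apply: DeriveDef.
    rewrite (@derive_val _ _ _ _ _ _ _ (is_deriveM dv dP')) /=.
    by rewrite /GRing.scale/=; ring.
  rewrite FTC /F; have -> : Phi (x, T) = 0%R by rewrite /time_ext/= in_itv/= ltxx andbF.
  have -> : Phi (x, 0%R) = 0%R by rewrite /time_ext/= in_itv/= ltxx.
  by rewrite !mulr0 subr0.
move: key; rewrite integralD//.
have /fineK <- : \int[mu \x leb]_(z in C) (w z * Phi z)%:E \is a fin_num.
  exact: integrable_fin_num.
have /fineK <- : \int[mu \x leb]_(z in C) (v z * D z)%:E \is a fin_num.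
  exact: integrable_fin_num.
by move=> [] /eqP; rewrite addr_eq0 => /eqP ->.
Qed.

End integration_by_parts.

Section step_functions.
Context {R : realType} {X : Type}.
Variables (N : nat) (dl : R).
Hypothesis dl0 : (0 < dl)%R.
Implicit Types (t : R) (F : nat -> X -> R).

(** Cells contain their left end point, so that each time of the interval lies in
    exactly one of them. *)
Definition cell (j : nat) : set R := `[(j%:R * dl)%R, (j%:R * dl + dl)%R[%classic.

Lemma cellP j t : (cell j t) = (j%:R * dl <= t < j%:R * dl + dl)%R :> Prop.
Proof. by rewrite /cell/= in_itv. Qed.

Lemma cell_inj j k t : cell j t -> cell k t -> j = k.
Proof.
wlog jk : j k / (j <= k)%N.
  by move=> H hj hk; have [/H->//|/ltnW/H->] := leqP j k.
rewrite !cellP => /andP[_ h1] /andP[h2 _]; apply/eqP; rewrite eqn_leq jk leqNgt/=.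
apply/negP => kj; have := le_lt_trans h2 h1.
rewrite -[X in (_ + X)%R]mul1r -mulrDl natr1 ltr_pM2r//.
by rewrite ltr_nat ltnNge kj.
Qed.

Lemma cell_exists t : (0 < t < N%:R * dl)%R -> exists2 k : nat, (k < N)%N & cell k t.
Proof.
move=> /andP[t0 tT]; have td0 : (0 <= t / dl)%R by rewrite divr_ge0// ltW.
exists (Num.truncn (t / dl)).
  by rewrite Num.Theory.truncn_lt_nat// ltr_pdivrMr.
have /andP[h1 h2] := Num.Theory.truncn_itv td0.
rewrite cellP -[X in (_ + X)%R]mul1r -mulrDl natr1.
by rewrite -ler_pdivlMr// -ltr_pdivrMr// h1.
Qed.

Definition step F (z : X * R) : R := (\sum_(j < N) \1_(cell j) z.2 * F j z.1)%R.

Lemma step_cell F k x t : (k < N)%N -> cell k t -> step F (x, t) = F k x.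
Proof.
move=> kN kt; rewrite /step (bigD1 (Ordinal kN))//= big1 => [|j jk].
  by rewrite indicE mem_set// mul1r addr0.
rewrite indicE memNset ?mul0r// => jt; case/eqP: jk; apply: val_inj => /=.
exact: cell_inj jt kt.
Qed.

(** The function with initial value [f0] and time derivative [step F]; as a sum of
    ramps it is visibly Lipschitz in time and square integrable. *)
Definition ramp_sum (f0 : X -> R) F (z : X * R) : R :=
  (f0 z.1 + \sum_(j < N) ramp (j%:R * dl) dl z.2 * F j z.1)%R.

Lemma ramp_sum_cell f0 F k x t : (k < N)%N -> cell k t ->
  ramp_sum f0 F (x, t) =
  (f0 x + \sum_(j < k) dl * F j x + (t - k%:R * dl) * F k x)%R.
Proof.
move=> kN; rewrite cellP => /andP[kt tk]; rewrite /ramp_sum/= -addrA; congr (_ + _)%R.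
have E j : ramp (j%:R * dl) dl t =
    if (j < k)%N then dl else if j == k then (t - k%:R * dl)%R else 0%R.
  case: ltngtP => [jk|kj|->].
  - apply: ramp_after; first exact: ltW.
    apply: le_trans kt; rewrite -[X in (_ + X)%R]mul1r -mulrDl natr1.
    by rewrite ler_pM2r// ler_nat.
  - apply: ramp_before; apply: (le_trans (ltW tk)).
    rewrite -[X in (_ + X)%R]mul1r -mulrDl natr1.
    by rewrite ler_pM2r// ler_nat.
  - by apply: ramp_during => //; exact: ltW.
rewrite -(big_mkord xpredT (fun j => ramp (j%:R * dl) dl t * F j x)%R).
rewrite -(big_mkord xpredT (fun j => dl * F j x)%R).
rewrite (@big_cat_nat _ _ _ k)//=; last exact: ltnW.
congr (_ + _)%R.
  by apply: eq_big_nat => j /andP[_ jk]; rewrite E jk.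
rewrite big_ltn// E ltnn eqxx big_nat_cond big1 ?addr0// => j /andP[/andP[kj _] _].
by rewrite E ltnNge (ltnW kj)/= gtn_eqF// mul0r.
Qed.

Lemma ramp_sum_lip f0 F x s t :
  (`|ramp_sum f0 F (x, s) - ramp_sum f0 F (x, t)| <= (\sum_(j < N) `|F j x|) * `|s - t|)%R.
Proof.
rewrite /ramp_sum/= opprD addrACA subrr add0r -sumrB mulr_suml; apply: le_trans (ler_norm_sum _ _ _) _.
apply: ler_sum => j _; rewrite -mulrBl normrM mulrC.
by apply: ler_wpM2l => //; exact: ramp_lip.
Qed.

Lemma ramp_sum_derive f0 F x : {ae (@lebesgue_measure R), forall t,
  is_derive t 1%R (fun s => ramp_sum f0 F (x, s)) (step F (x, t))}.
Proof.
pose E := range (fun j : nat => (j%:R * dl)%R : R).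
have cE : countable E by exact: card_image_le.
have E0 := countable_lebesgue_measure0 cE.
exists E; split => //.
  by apply: countable_measurable => //.
move=> t /= nd; apply: contrapT => nE; apply: nd.
have tE (j : nat) : t != (j%:R * dl)%R by apply/eqP => tj; apply: nE; exists j.
have dj (j : 'I_N) : is_derive t (1%R : R) (F j x \*: ramp (j%:R * dl) dl)%R
    (F j x *: (\1_(cell j) t : R))%R.
  apply: is_deriveZ; apply: ramp_is_derive => //.
  by rewrite -[X in (_ + X)%R]mul1r -mulrDl natr1.
have d0 : is_derive t (1%R : R) (fun=> f0 x : R) (0%R : R) by exact: is_derive_cst.
have := is_deriveD d0 (is_derive_sum dj).
rewrite add0r fct_sumE; rewrite /step /ramp_sum.
have -> : (\sum_(i < N) F i x *: (\1_(cell i) t : R) = \sum_(j < N) \1_(cell j) t * F j x)%R.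
  by apply: eq_bigr => j _; rewrite /GRing.scale/= mulrC.
congr is_derive; apply/funext => s /=; congr (_ + _)%R.
by apply: eq_bigr => j _; rewrite /GRing.scale/= mulrC.
Qed.

End step_functions.

Section step_integrals.
Context {d} {R : realType} {X : completeBorelMetricType d R}.
Variable mu : {measure set X -> \bar R}.
Hypothesis sf : sigma_finite [set: X] mu.
Local Notation leb := (@lebesgue_measure R).
Variables (A : set X) (T dl : R) (N : nat).
Hypothesis mA : measurable A.
Hypothesis T0 : (0 < T)%R.
Hypothesis dl0 : (0 < dl)%R.
Variables (f0 : X -> R) (F : nat -> X -> R).
Hypothesis sf0 : square_integrable mu A f0.
Hypothesis sF : forall j, square_integrable mu A (F j).
Local Notation C := (cylinder A T).

Lemma measurable_cell j : measurable (cell dl j : set R).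
Proof. exact: measurable_itv. Qed.

Lemma lebesgue_cell j : leb (cell dl j : set R) = dl%:E.
Proof.
by rewrite lebesgue_measure_itv/= lte_fin ltrDl dl0 -EFinB addrC addKr.
Qed.

Lemma square_integrable_step : square_integrable (mu \x leb) C (step N dl F).
Proof.
apply: (@square_integrable_sum _ (X * measurableTypeR R)%type) => [|j].
  exact: cyl_measurable.
apply: (square_integrable_sep sf mA T0 (M := 1%R)) => //.
  by apply: measurable_funTS; apply: measurable_indic; exact: measurable_cell.
by move=> t; rewrite indicE ger0_norm// lern1 leq_b1.
Qed.

Lemma square_integrable_ramp_sum :
  square_integrable (mu \x leb) C (ramp_sum N dl f0 F).
Proof.
apply: (@square_integrableD _ (X * measurableTypeR R)%type).
- exact: cyl_measurable.
- exact: square_integrable_space.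
apply: (@square_integrable_sum _ (X * measurableTypeR R)%type) => [|j].
  exact: cyl_measurable.
apply: (square_integrable_sep sf mA T0 (M := dl)) => //.
  exact: ramp_measurable.
by move=> t; rewrite ger0_norm ?ramp_ge0// ramp_le// ltW.
Qed.

Lemma ramp_sum_slice t :
  square_integrable mu A (fun x => ramp_sum N dl f0 F (x, t)).
Proof.
apply: square_integrableD => //; apply: square_integrable_sum => // j.
exact: (square_integrableZ mA (ramp (j%:R * dl) dl t) (sF j)).
Qed.

Hypothesis Afin : mu A < +oo.

Lemma ramp_sum_C0_rep :
  C0_rep mu 1 A T (ramp_sum N dl f0 F) (fun t x => ramp_sum N dl f0 F (x, t)).
Proof.
pose G x := (\sum_(j < N) `|F j x|)%R.
have sG : square_integrable mu A G.
  apply: square_integrable_sum => // j.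
  apply: (square_integrable_le mA (k := 1%R) _ (sF j)).
    by have [mF _] := sF j; exact: measurableT_comp.
  by move=> x _; rewrite mul1r real_normK// num_real.
have iG := square_integrable_integrable mA Afin sG.
have fG : \int[mu]_(x in A) (G x)%:E \is a fin_num by exact: integrable_fin_num iG.
pose K := fine (\int[mu]_(x in A) (G x)%:E).
have K0 : (0 <= K)%R by apply: fine_ge0; apply: integral_ge0 => x _; rewrite lee_fin sumr_ge0.
split.
- move=> t _; have sV := ramp_sum_slice t; have [mV _] := sV; split => //.
  rewrite Lpnorm1E//; have := square_integrable_integrable mA Afin sV.
  by move=> /integrableP[].
- move=> t tT.
  apply: (@squeeze_cvge _ _ _ _ (fun=> 0) _ (fun s => (K * `|s - t|)%:E)).
  + near=> s; apply/andP; split; first exact: Lnorm_ge0.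
    rewrite Lpnorm1E//; apply: (@le_trans _ _ (\int[mu]_(x in A) (`|s - t|%:E * (G x)%:E))).
      by apply: le_integral_gen => x _; rewrite -EFinM lee_fin mulrC ramp_sum_lip.
    rewrite (integralZl mA iG).
    by rewrite -(fineK fG) -EFinM mulrC.
  + exact: cvg_cst.
  + apply: cvg_EFin; first by near=> s.
    apply: cvg_within_filter; apply/cvgrPdist_lt => e e0; near=> s.
    rewrite /= sub0r normrN ger0_norm ?mulr_ge0//.
    apply: (@le_lt_trans _ _ ((K + 1) * `|s - t|)%R).
      by rewrite ler_wpM2r// lerDl.
    rewrite mulrC -ltr_pdivlMr ?ltr_wpDl// distrC; near: s.
    apply/nbhs_ballP; exists (e / (K + 1))%R => //=.
    by rewrite divr_gt0// ltr_wpDl.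
- by apply: aeW => t _; apply: aeW.
Unshelve. all: by end_near. Qed.

Lemma ramp_sum_weak_dt : open A -> weak_dt mu A T (ramp_sum N dl f0 F) (step N dl F).
Proof.
move=> oA eta teta.
have [D [L [L0 mD DL HD aeD]]] := test_dt_repr sf oA T0 teta.
have mC := cyl_measurable T mA.
have sD : square_integrable (mu \x leb) C D.
  apply: (@square_integrable_bounded _ (X * measurableTypeR R)%type R (mu \x leb) C _ _ _ L) => //.
  exact: cyl_measure.
have := integration_by_parts_time sf oA Afin T0 teta sD square_integrable_ramp_sum
  square_integrable_step HD.
have -> : \int[mu \x leb]_(z in C) (ramp_sum N dl f0 F z * D z)%:E =
    \int[mu \x leb]_(z in C) (ramp_sum N dl f0 F z * dt eta z.1 z.2)%:E.
  by apply: ae_eq_integral_gen; apply: ae_imp aeD => z dD Cz; rewrite dD.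
have -> : \int[mu \x leb]_(z in C) (step N dl F z * time_ext T eta z)%:E =
    \int[mu \x leb]_(z in C) (step N dl F z * eta z)%:E.
  by apply: eq_integral => z /set_mem [_ tz]; rewrite /time_ext ifT.
apply => x Ax.
  exists (\sum_(j < N) `|F j x|)%R; first exact: sumr_ge0.
  by move=> s t _ _; exact: ramp_sum_lip.
by apply: ae_imp (ramp_sum_derive N dl0 f0 F x).
Qed.

Lemma step_time_integral (e : nat -> R) : (forall j, 0 <= e j)%R ->
  \int[leb]_(t in `]0%R, T[) (\sum_(j < N) \1_(cell dl j) t * e j)%:E <=
  (dl * \sum_(j < N) e j)%:E.
Proof.
move=> e0; under eq_integral do rewrite -sumEFin.
rewrite (@ge0_integral_sum _ (measurableTypeR R) R leb _ (measurable_itv _)); last 2 first.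
- move=> j; apply/measurable_EFinP; apply: measurable_funM => //.
  by apply: measurable_funTS; apply: measurable_indic; exact: measurable_cell.
- by move=> j t _; rewrite lee_fin mulr_ge0.
rewrite mulr_sumr -sumEFin; apply: lee_sum => j _.
under eq_integral do rewrite mulrC EFinM.
rewrite (@ge0_integralZl_EFin _ (measurableTypeR R) R leb)//; last first.
  apply/measurable_EFinP.
  by apply: measurable_funTS; apply: measurable_indic; exact: measurable_cell.
rewrite (@integral_indic _ (measurableTypeR R) R leb)//; last exact: measurable_cell.
rewrite mulrC EFinM; apply: lee_wpmul2l; first by rewrite lee_fin.
rewrite -(lebesgue_cell j); apply: le_measure; rewrite ?inE//.
- by apply: measurableI => //; exact: measurable_cell.
- exact: measurable_cell.
Qed.

End step_integrals.

(** * Relaxation towards a piecewise constant curve *)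

Section step_ratio.
Context {R : realType}.
Variables (dl h : R).
Hypotheses (dl0 : (0 < dl)%R) (h0 : (0 < h)%R) (dlh : (2 * dl <= h)%R).

Lemma ratio_ge0 : (0 <= dl / h)%R. Proof. by rewrite divr_ge0 ?ltW. Qed.

Lemma ratio_le1 : (dl / h <= 1)%R.
Proof.
rewrite ler_pdivrMr// mul1r; apply: le_trans dlh.
by rewrite ler_peMl ?ltW// ltr1n.
Qed.

End step_ratio.

Section relaxation.
Context {R : realType} {X : Type}.
Variables (N : nat) (dl h : R).
Hypothesis dl0 : (0 < dl)%R.
Hypothesis h0 : (0 < h)%R.
Variables (f0 : X -> R) (G : nat -> X -> R).

(** Explicit Euler scheme, with step dl, for the equation h v' = G - v. *)
Fixpoint relax (n : nat) : X -> R :=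
  if n is n'.+1 then fun x => (relax n' x + dl * ((G n' x - relax n' x) / h))%R else f0.

Definition slope (j : nat) (x : X) : R := ((G j x - relax j x) / h)%R.

(** The piecewise affine interpolation in time of the Euler scheme. *)
Definition competitor : X * R -> R := ramp_sum N dl f0 slope.

Definition competitor_dt : X * R -> R := step N dl slope.

Lemma relaxE n x : relax n x = (f0 x + \sum_(j < n) dl * slope j x)%R.
Proof.
elim: n => [|n IH] /=; first by rewrite big_ord0 addr0.
by rewrite big_ord_recr/= addrA -IH.
Qed.

Lemma competitor_cell k x t : (k < N)%N -> cell dl k t ->
  competitor (x, t) = (relax k x + (t - k%:R * dl) * slope k x)%R.
Proof. by move=> kN kt; rewrite /competitor (ramp_sum_cell dl0 f0 _ _ kN kt) relaxE. Qed.

Lemma competitor_dt_cell k x t : (k < N)%N -> cell dl k t ->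
  competitor_dt (x, t) = slope k x.
Proof. by move=> kN kt; rewrite /competitor_dt (step_cell dl0 _ _ kN kt). Qed.

Lemma competitor_convex k x t : (k < N)%N -> cell dl k t ->
  competitor (x, t) = ((1 - (t - k%:R * dl) / h) * relax k x + (t - k%:R * dl) / h * G k x)%R.
Proof. by move=> kN kt; rewrite (competitor_cell x kN kt) /slope; ring. Qed.

Lemma relax_convex n x : relax n.+1 x = ((1 - dl / h) * relax n x + dl / h * G n x)%R.
Proof. by rewrite /=; ring. Qed.

Variables (a0 : R) (b : nat -> R).
Hypothesis a0_ge0 : (0 <= a0)%R.
Hypothesis b_ge0 : forall j, (0 <= b j)%R.
Hypothesis dlh : (2 * dl <= h)%R.

(** Each [relax n] is a convex combination of the previous one and of [G], so that
    bounds [b] for the total variation of the functions [G] propagate along the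
    scheme. *)
Fixpoint relax_energy (n : nat) : R :=
  if n is n'.+1 then ((1 - dl / h) * relax_energy n' + dl / h * b n')%R else a0.

Lemma relax_energy_ge0 n : (0 <= relax_energy n)%R.
Proof.
elim: n => [|n IH] //=; rewrite addr_ge0// mulr_ge0 ?ratio_ge0//.
by rewrite subr_ge0 ratio_le1.
Qed.

(** The recursion telescopes: relaxation costs at most [h * a0] in the time
    integral of the bounds. *)
Lemma relax_energy_sum n :
  (dl * (\sum_(j < n) relax_energy j) + h * relax_energy n =
   dl * (\sum_(j < n) b j) + h * a0)%R.
Proof.
elim: n => [|n IH]; first by rewrite !big_ord0 !mulr0.
rewrite !big_ord_recr/= !mulrDr [RHS]addrAC -IH.
by field; rewrite gt_eqF.
Qed.

End relaxation.

Section competitor_admissible.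
Context {d} {R : realType} {X : completeBorelMetricType d R}.
Variable mu : {measure set X -> \bar R}.
Hypothesis dbl : doubling mu.
Local Notation leb := (@lebesgue_measure R).
Variables (A B : set X) (T dl h : R) (N : nat).
Hypothesis oA : open A.
Hypothesis bA : metric_bounded A.
Hypothesis T0 : (0 < T)%R.
Hypothesis dl0 : (0 < dl)%R.
Hypothesis h0 : (0 < h)%R.
Hypothesis dlh : (2 * dl <= h)%R.
Hypothesis TE : (N%:R * dl)%R = T.
Variables (f0 : X -> R) (G : nat -> X -> R) (a0 : R) (b : nat -> R).
Hypothesis sf0 : square_integrable mu A f0.
Hypothesis sG : forall j, square_integrable mu A (G j).
Hypothesis b_ge0 : forall j, (0 <= b j)%R.
Hypothesis tv0 : totvar mu f0 A <= a0%:E.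
Hypothesis tvG : forall j, (j < N)%N -> totvar mu (G j) A <= (b j)%:E.
Local Notation v := (competitor N dl h f0 G).
Local Notation w := (competitor_dt N dl h f0 G).
Local Notation e := (relax_energy dl h a0 b).
Local Notation C := (cylinder A T).

Let mA : measurable A. Proof. exact: open_measurableX. Qed.
Let Afin : mu A < +oo. Proof. exact: bounded_measure_lty. Qed.
Let sf : sigma_finite setT mu. Proof. exact: doubling_sigma_finite. Qed.

Let a0_ge0 : (0 <= a0)%R.
Proof. by rewrite -lee_fin; apply: le_trans tv0; exact: totvar_ge0. Qed.

Let e_ge0 n : (0 <= e n)%R.
Proof. exact: relax_energy_ge0. Qed.

Lemma relax_square_integrable n : square_integrable mu A (relax dl h f0 G n).
Proof.
elim: n => [|n IH] //=.
apply: square_integrableD => //; apply: square_integrableZ => //.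
have := square_integrableZ mA h^-1 (square_integrableB mA (sG n) IH).
by congr square_integrable; apply/funext => x; rewrite mulrC.
Qed.

Lemma slope_square_integrable n : square_integrable mu A (slope dl h f0 G n).
Proof.
have := square_integrableZ mA h^-1 (square_integrableB mA (sG n) (relax_square_integrable n)).
by congr square_integrable; apply/funext => x; rewrite /slope mulrC.
Qed.

Lemma competitor_square_integrable : square_integrable (mu \x leb) C v.
Proof.
by apply: square_integrable_ramp_sum => //; exact: slope_square_integrable.
Qed.

Lemma competitor_dt_square_integrable : square_integrable (mu \x leb) C w.
Proof. by apply: square_integrable_step => //; exact: slope_square_integrable. Qed.

Lemma competitor_slice t : square_integrable mu A (fun x => v (x, t)).
Proof. by apply: ramp_sum_slice => //; exact: slope_square_integrable. Qed.

Lemma totvar_relax n : (n <= N)%N -> totvar mu (relax dl h f0 G n) A <= (e n)%:E.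
Proof.
elim: n => [|n IH] nN //.
have -> : relax dl h f0 G n.+1 =
    (fun x => (1 - dl / h) * relax dl h f0 G n x + dl / h * G n x)%R.
  by apply/funext => x; exact: relax_convex.
have [m1 _] := relax_square_integrable n; have [m2 _] := sG n.
apply: (totvar_comb dbl oA bA) => //.
- by rewrite subr_ge0; exact: ratio_le1.
- exact: ratio_ge0.
- exact/IH/ltnW.
- exact: tvG.
Qed.

Lemma totvar_competitor k t : (k < N)%N -> cell dl k t ->
  totvar mu (fun x => v (x, t)) A <= (e k + dl / h * b k)%:E.
Proof.
move=> kN kt; pose th := ((t - k%:R * dl) / h)%R.
have := kt; rewrite cellP => /andP[t1 t2].
have th0 : (0 <= th)%R by rewrite divr_ge0 ?subr_ge0// ltW.
have th1 : (th <= dl / h)%R by rewrite ler_pM2r ?invr_gt0// lerBlDl ltW.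
have thh := le_trans th1 (ratio_le1 dl0 h0 dlh).
have -> : (fun x => v (x, t)) = (fun x => (1 - th) * relax dl h f0 G k x + th * G k x)%R.
  by apply/funext => x; exact: competitor_convex.
have [m1 _] := relax_square_integrable k; have [m2 _] := sG k.
apply: (le_trans (totvar_comb dbl oA bA (p := e k) (q := b k) _ _ m1 m2 _ _)) => //.
- by rewrite subr_ge0.
- exact/totvar_relax/ltnW.
- exact: tvG.
rewrite lee_fin; apply: lerD; last exact: ler_wpM2r.
by rewrite ler_piMl// gerBl.
Qed.

(** At each time the competitor is a convex combination of [relax k] and [G k].
    The total variation may fail to be a measurable function of time, so the
    integral is bounded through a step function that dominates it. *)
Lemma competitor_energy (f : R -> \bar R) : leb.-integrable `]0%R, T[ f ->
  \int[leb]_(t in `]0%R, T[) (f t + totvar mu (fun x => v (x, t)) A) <=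
  \int[leb]_(t in `]0%R, T[) f t +
    (h * a0 + (1 + dl / h) * (dl * \sum_(j < N) b j))%:E.
Proof.
move=> fi; pose E j := (e j + dl / h * b j)%R.
have E0 j : (0 <= E j)%R by apply: addr_ge0 => //; apply: mulr_ge0 => //; exact: ratio_ge0.
pose S t := (\sum_(j < N) \1_(cell dl j) t * E j)%:E.
have S0 t : 0 <= S t by rewrite lee_fin sumr_ge0// => j _; rewrite mulr_ge0.
have IS : \int[leb]_(t in `]0%R, T[) S t <= (dl * \sum_(j < N) E j)%:E.
  exact: step_time_integral.
have iS : leb.-integrable `]0%R, T[ S.
  apply/integrableP; split.
    apply/measurable_EFinP; apply: measurable_sum => j; apply: measurable_funM => //.
    by apply: measurable_funTS; apply: measurable_indic; exact: measurable_cell.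
  apply: le_lt_trans (ltry (dl * \sum_(j < N) E j)%R).
  by under eq_integral do rewrite gee0_abs//.
apply: (@le_trans _ _ (\int[leb]_(t in `]0%R, T[) (f t + S t))).
  apply: le_integral_gen => t /=; rewrite in_itv/= => tT.
  apply: leeD2l; have [|k kN kt] := @cell_exists _ N dl dl0 t; first by rewrite TE.
  apply: le_trans (totvar_competitor kN kt) _; rewrite lee_fin.
  (* The terms are nonnegative; that of the cell of [t] is the bound found above. *)
  rewrite (bigD1 (Ordinal kN))//= indicE mem_set// mul1r lerDl.
  by apply: sumr_ge0 => j _; rewrite mulr_ge0.
rewrite (@integralD _ (measurableTypeR R) R leb _ (measurable_itv _) _ _ fi iS).
apply: leeD2l; apply: le_trans IS _; rewrite lee_fin /E big_split/= mulrDr -mulr_sumr.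
have := relax_energy_sum dl h0 a0 b N.
have := mulr_ge0 (ltW h0) (e_ge0 N).
set s1 := (\sum_(j < N) e j)%R; set s2 := (\sum_(j < N) b j)%R => h1 h2.
have -> : (dl * (dl / h * s2) = dl / h * (dl * s2))%R by ring.
by rewrite mulrDl mul1r; lra.
Qed.

Lemma competitor_L1w_BV : L1w_BV mu A T v.
Proof.
have mC := cyl_measurable T mA.
have sv := competitor_square_integrable.
split.
- have iv := @square_integrable_integrable _ (X * measurableTypeR R)%type R (mu \x leb) C mC
    (cyl_measure T mA Afin) v sv.
  by apply: iv.
- apply: aeW => t tT; split.
    exact: square_integrable_integrable (competitor_slice t).
  have [|k kN kt] := @cell_exists _ N dl dl0 t; first by rewrite TE; move: tT; rewrite in_itv.
  exact: le_lt_trans (totvar_competitor kN kt) (ltry _).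
- move=> D hD k [_ _ _ [[kinf _] _]] _.
  have sk := Linfty_square_integrable mA Afin kinf.
  have skC := square_integrable_space sf mA T0 sk.
  have := @integrable_mul _ (X * measurableTypeR R)%type R (mu \x leb) C mC _ _ sv skC.
  by move=> /(cyl_integrable2 sf mA)/measurable_int.
- have := competitor_energy (@integrable0 _ (measurableTypeR R) R leb `]0%R, T[).
  rewrite integral0 add0e; under eq_integral do rewrite add0e.
  by move=> H; exact: le_lt_trans H (ltry _).
Qed.

Hypothesis Gdatum : forall j, (j < N)%N ->
  \forall x \ae mu, (A `\` B) x -> G j x = f0 x.

Lemma relax_datum n : (n <= N)%N -> \forall x \ae mu, (A `\` B) x -> relax dl h f0 G n x = f0 x.
Proof.
elim: n => [|n IH] nN; first exact: aeW.
apply: ae_imp2 (IH (ltnW nN)) (Gdatum nN) => x h1 h2 ABx.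
by rewrite /= h1// h2// subrr mul0r mulr0 addr0.
Qed.

Lemma competitor_L1w_BV_datum : L1w_BV_datum mu B A f0 T v.
Proof.
have L1v := competitor_L1w_BV; split => //; have [_ BVv _ _] := L1v.
apply: ae_imp BVv => t BVt tT; split; first exact: BVt.
have [|k kN kt] := @cell_exists _ N dl dl0 t; first by rewrite TE; move: tT; rewrite in_itv.
apply: ae_imp2 (relax_datum (ltnW kN)) (Gdatum kN) => x h1 h2 ABx.
by rewrite (competitor_convex _ _ _ _ _ kN kt)// h1// h2// -mulrDl subrK mul1r.
Qed.

End competitor_admissible.

(** * The variational inequality tested with the competitor *)

(** With w the velocity of the competitor v, y = W - G the error of the piecewise
    constant approximation and l w = G - v, this is Young's inequality. *)
Lemma young_step {R : realType} (D w y l h L : R) : (0 < h)%R -> (l <= h)%R ->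
  (h <= 2 * l)%R -> (`|D| <= L)%R ->
  ((D - w) * (y + l * w) <= h / 2 * L ^+ 2 + h^-1 * y ^+ 2)%R.
Proof.
move=> h0 lh hl DL.
have l0 : (0 < l)%R by rewrite -(@pmulr_rgt0 _ 2%R)//; exact: lt_le_trans hl.
have DL2 : (D ^+ 2 <= L ^+ 2)%R.
  by rewrite -(real_normK (num_real D)) lerXn2r// ?nnegrE// (le_trans _ DL).
rewrite -(@ler_pM2l _ (2 * l)%R) ?mulr_gt0//.
apply: (@le_trans _ _ (l * l * D ^+ 2 + y ^+ 2)%R).
  rewrite -subr_ge0.
  have -> : (l * l * D ^+ 2 + y ^+ 2 - 2 * l * ((D - w) * (y + l * w)) =
    2^-1 * ((2 * l * w - (l * D - y)) ^+ 2 + (l * D - y) ^+ 2))%R by field.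
  by rewrite mulr_ge0// addr_ge0// sqr_ge0.
rewrite mulrDr; apply: lerD.
  have -> : (2 * l * (h / 2 * L ^+ 2) = l * (h * L ^+ 2))%R by field.
  rewrite -mulrA ler_pM2l//; apply: ler_pM => //; [exact: ltW|exact: sqr_ge0].
by rewrite mulrA ler_peMl ?sqr_ge0// ler_pdivlMr// mul1r.
Qed.

Section pairing.
Context {d} {R : realType} {X : completeBorelMetricType d R}.
Variable mu : {measure set X -> \bar R}.
Hypothesis dbl : doubling mu.
Local Notation leb := (@lebesgue_measure R).
Variables (A B : set X) (T dl h : R) (N : nat).
Hypothesis oA : open A.
Hypothesis bA : metric_bounded A.
Hypothesis T0 : (0 < T)%R.
Hypothesis dl0 : (0 < dl)%R.
Hypothesis h0 : (0 < h)%R.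
Hypothesis dlh : (2 * dl <= h)%R.
Hypothesis TE : (N%:R * dl)%R = T.
Variables (f0 : X -> R) (G : nat -> X -> R).
Hypothesis sf0 : square_integrable mu A f0.
Hypothesis sG : forall j, square_integrable mu A (G j).
Variable phi : X * R -> R.
Hypothesis tphi : lip_test A B T phi.
Local Notation v := (competitor N dl h f0 G).
Local Notation w := (competitor_dt N dl h f0 G).
Local Notation Phi := (time_ext T phi).
Local Notation C := (cylinder A T).
Variables (D u : X * R -> R) (L : R).
Hypothesis mD : measurable_fun C D.
Hypothesis DL : forall z, C z -> (`|D z| <= L)%R.
Hypothesis DE : forall x, A x -> {ae leb, forall t, t \in `]0%R, T[ ->
    derivable (fun s => Phi (x, s)) t 1 /\
    D (x, t) = ((fun s => Phi (x, s))^`())%classic t}.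
Hypothesis su : square_integrable (mu \x leb) C u.
Local Notation y := (fun z => u z + Phi z - step N dl G z)%R.

Let mA : measurable A. Proof. exact: open_measurableX. Qed.
Let Afin : mu A < +oo. Proof. exact: bounded_measure_lty. Qed.
Let sf : sigma_finite setT mu. Proof. exact: doubling_sigma_finite. Qed.
Let mC : measurable C. Proof. exact: cyl_measurable. Qed.
Let Cfin : (mu \x leb) C < +oo. Proof. exact: cyl_measure. Qed.

Lemma bounded_square_integrable : square_integrable (mu \x leb) C D.
Proof.
exact: (@square_integrable_bounded _ (X * measurableTypeR R)%type R (mu \x leb) C mC Cfin _ L).
Qed.

Lemma pairing_pointwise z : C z ->
  (w z * (v z - u z) + Phi z * D z + u z * D z <=
   (h / 2 * L ^+ 2 + h^-1 * y z ^+ 2) + v z * D z + w z * Phi z)%R.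
Proof.
case: z => x t Cz; have [/= Ax] := Cz; rewrite in_itv/= => tT.
have [|k kN kt] := @cell_exists _ N dl dl0 t; first by rewrite TE.
have := kt; rewrite cellP => /andP[t1 t2].
rewrite (step_cell dl0 _ _ kN kt) (competitor_cell _ _ _ _ _ kN kt)//.
rewrite (competitor_dt_cell _ _ _ _ _ kN kt)//.
have Gs : G k x = (relax dl h f0 G k x + h * slope dl h f0 G k x)%R.
  by rewrite /slope; field; rewrite gt_eqF.
have := DL Cz; rewrite Gs; set s := slope _ _ _ _ _ _; set r := relax _ _ _ _ _ _.
set tau := (t - k%:R * dl)%R; set p := Phi _; set q := D _; set uu := u _ => qL.
have tau0 : (0 <= tau)%R by rewrite subr_ge0.
have taudl : (tau <= dl)%R by rewrite lerBlDl ltW.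
have lh : (h - tau <= h)%R by rewrite gerBl.
have tauh : (2 * tau <= h)%R by apply: le_trans dlh; rewrite ler_pM2l.
have hl : (h <= 2 * (h - tau))%R.
  by rewrite mulrBr [X in (_ <= X - _)%R]mulr_natl mulr2n -addrA lerDl subr_ge0.
have -> : (s * (r + tau * s - uu) + p * q + uu * q =
  (q - s) * (uu + p - (r + h * s) + (h - tau) * s) + (r + tau * s) * q + s * p)%R by ring.
by rewrite !lerD2r; exact: young_step.
Qed.

(** In the pointwise inequality the integrals of [Phi * D] and of
    [v * D + w * Phi] vanish, by integration by parts in time. What remains of
    the pairing of the velocity with [v - u] is [- u * D], up to the error terms. *)
Lemma pairing_le :
  \int[mu \x leb]_(z in C) (w z * (v z - u z))%:E + \int[mu \x leb]_(z in C) (u z * D z)%:E <=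
  (h / 2 * L ^+ 2)%:E * (mu \x leb) C + (h^-1)%:E * \int[mu \x leb]_(z in C) (y z ^+ 2)%:E.
Proof.
have sD := bounded_square_integrable.
have sP := time_ext_square_integrable oA Afin T0 tphi.
have sv : square_integrable (mu \x leb) C v by exact: competitor_square_integrable.
have sw : square_integrable (mu \x leb) C w by exact: competitor_dt_square_integrable.
have sS : square_integrable (mu \x leb) C (step N dl G) by exact: square_integrable_step.
have sy := @square_integrableB _ (X * measurableTypeR R)%type R (mu \x leb) C mC _ _
  (@square_integrableD _ (X * measurableTypeR R)%type R (mu \x leb) C mC _ _ su sP) sS.
have svu := @square_integrableB _ (X * measurableTypeR R)%type R (mu \x leb) C mC _ _ sv su.
pose ifn := @integrable_fin_num _ (X * measurableTypeR R)%type R (mu \x leb) C mC.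
pose im := @integrable_mul _ (X * measurableTypeR R)%type R (mu \x leb) C mC.
have i1 := im _ _ sw svu; have i2 := im _ _ sP sD; have i3 := im _ _ su sD.
have i5 := im _ _ sv sD; have i6 := im _ _ sw sP; have iyy := im _ _ sy sy.
have iy : (mu \x leb).-integrable C (fun z => (h^-1)%:E * (y z ^+ 2)%:E).
  exact: integrableZl.
have ic : (mu \x leb).-integrable C (cst (h / 2 * L ^+ 2)%:E).
  by apply/integrableP; split => //=; rewrite integral_cst// lte_mul_pinfty//= lee_fin.
have B1 : \int[mu \x leb]_(z in C) (v z * D z)%:E = - \int[mu \x leb]_(z in C) (w z * Phi z)%:E.
  apply: (integration_by_parts_time sf oA Afin T0 tphi sD sv sw DE) => x Ax.
    exists (\sum_(j < N) `|slope dl h f0 G j x|)%R; first exact: sumr_ge0.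
    by move=> s t _ _; exact: ramp_sum_lip.
  by apply: ae_imp (ramp_sum_derive N dl0 f0 (slope dl h f0 G) x).
have [K K0 [PL _ _]] := time_ext_lip T0 tphi.
have B2 : \int[mu \x leb]_(z in C) (Phi z * D z)%:E = 0.
  have E : \int[mu \x leb]_(z in C) (Phi z * D z)%:E = - \int[mu \x leb]_(z in C) (D z * Phi z)%:E.
    apply: (integration_by_parts_time sf oA Afin T0 tphi sD sP sD DE) => x Ax.
      by exists K => // s t _ _; exact: PL.
    apply: ae_imp (DE Ax) => t H tT; have [dP ->] := H tT.
    by rewrite derive1E; exact: DeriveDef.
  have E2 : \int[mu \x leb]_(z in C) (D z * Phi z)%:E = \int[mu \x leb]_(z in C) (Phi z * D z)%:E.
    by apply: eq_integral => z _; rewrite mulrC.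
  move: E; rewrite E2; have /fineK <- := ifn _ i2.
  by move=> [] H; congr EFin; lra.
have H : \int[mu \x leb]_(z in C) ((w z * (v z - u z))%:E + (Phi z * D z)%:E + (u z * D z)%:E) <=
    \int[mu \x leb]_(z in C) (((h / 2 * L ^+ 2)%:E + (h^-1)%:E * (y z ^+ 2)%:E) + (v z * D z)%:E
      + (w z * Phi z)%:E).
  by apply: le_integral_gen => z Cz; rewrite -!EFinM -!EFinD lee_fin; exact: pairing_pointwise.
pose iD := @integrableD _ (X * measurableTypeR R)%type R (mu \x leb) C mC.
pose ID := @integralD _ (X * measurableTypeR R)%type R (mu \x leb) C mC.
have icy := iD _ _ ic iy; have icy5 := iD _ _ icy i5; have i12 := iD _ _ i1 i2.
move: H; rewrite (ID _ _ i12 i3) (ID _ _ i1 i2) (ID _ _ icy5 i6) (ID _ _ icy i5) (ID _ _ ic iy).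
rewrite B1 B2 adde0 (@integral_cst _ (X * measurableTypeR R)%type R (mu \x leb) C mC).
rewrite (@integralZl _ (X * measurableTypeR R)%type R (mu \x leb) C mC _ iyy).
have /fineK <- := ifn _ i6.
by rewrite -addeA -EFinN -EFinD addNr adde0.
Qed.

End pairing.

Section approximation.
Context {d} {R : realType} {X : completeBorelMetricType d R}.
Variable mu : {measure set X -> \bar R}.
Hypothesis dbl : doubling mu.
Local Notation leb := (@lebesgue_measure R).
Variables (Om Oms : set X) (u0 : X -> R) (u : X * R -> R) (T : R).
Hypothesis oA : open Oms.
Hypothesis bA : metric_bounded Oms.
Hypothesis u0L2 : in_Lp mu 2%:E Oms u0.
Hypothesis u0BV : BV mu Oms u0.
Hypothesis T0 : (0 < T)%R.
Variable phi : X * R -> R.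
Hypothesis tphi : lip_test Oms Om T phi.
Hypothesis L1u : L1w_BV_datum mu Om Oms u0 T u.
Variable U : R -> X -> R.
Hypothesis cU : C0_rep mu 2%:E Oms T u U.
Hypothesis var_ineq : forall (v w : X * R -> R) V,
    L1w_BV_datum mu Om Oms u0 T v ->
    in_Lp (mu \x leb) 2%:E (cylinder Oms T) w -> weak_dt mu Oms T v w ->
    C0_rep mu 1 Oms T v V -> in_Lp mu 2%:E Oms (V 0%R) ->
    \int[leb]_(t in `]0%R, T[) totvar mu (fun x => u (x, t)) Oms <=
    \int[leb]_(t in `]0%R, T[)
      (\int[mu]_(x in Oms) (w (x, t) * (v (x, t) - u (x, t)))%:E
       + totvar mu (fun x => v (x, t)) Oms)
    - (2^-1)%:E * Lpnorm mu 2%:E Oms (V T \- U T)%R ^+ 2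
    + (2^-1)%:E * Lpnorm mu 2%:E Oms (V 0%R \- u0)%R ^+ 2.
Local Notation Phi := (time_ext T phi).
Local Notation C := (cylinder Oms T).
Local Notation W := (fun t x => U t x + Phi (x, t))%R.
Variables (D : X * R -> R) (L : R).
Hypothesis mD : measurable_fun C D.
Hypothesis DL : forall z, C z -> (`|D z| <= L)%R.
Hypothesis DE : forall x, Oms x -> {ae leb, forall t, t \in `]0%R, T[ ->
    derivable (fun s => Phi (x, s)) t 1 /\
    D (x, t) = ((fun s => Phi (x, s))^`())%classic t}.
Variable Q : R.
Hypothesis QE : \int[leb]_(t in `]0%R, T[) totvar mu (W t) Oms = Q%:E.

Let mA : measurable Oms. Proof. exact: open_measurableX. Qed.
Let Afin : mu Oms < +oo. Proof. exact: bounded_measure_lty. Qed.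
Let sf : sigma_finite setT mu. Proof. exact: doubling_sigma_finite. Qed.
Let mC : measurable C. Proof. exact: cyl_measurable. Qed.
Let Cfin : (mu \x leb) C < +oo. Proof. exact: cyl_measure. Qed.
Let I0T (t : R) : t \in `]0%R, T[ -> t \in `[0%R, T].
Proof. exact: subset_itv_oo_cc. Qed.

Definition good_time (t : R) :=
  (\forall x \ae mu, Oms x -> u (x, t) = U t x) /\ BV_datum mu Om Oms u0 (fun x => u (x, t)).

Lemma ae_good_time : \forall t \ae leb, t \in `]0%R, T[ -> good_time t.
Proof.
have [_ BVu] := L1u; have [_ _ uU] := cU.
by apply: ae_imp2 uU BVu => t h1 h2 tT; split; [exact: h1|exact: h2].
Qed.

Lemma curve_square_integrable t : t \in `[0%R, T] -> square_integrable mu Oms (W t).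
Proof.
move=> tT; apply: square_integrableD => //; first exact: (C0_square_integrable cU tT).
have [K K0 [_ _ HK]] := time_ext_lip T0 tphi.
apply: (@square_integrable_bounded _ _ _ mu Oms mA Afin _ (K * T)%R) => [|x Ax].
  exact: (time_ext_slice_measurable oA T0 tphi).
exact: HK.
Qed.

Lemma curve_datum t : t \in `]0%R, T[ -> good_time t ->
  \forall x \ae mu, (Oms `\` Om) x -> W t x = u0 x.
Proof.
move=> tT [uU [_ ud]]; apply: ae_imp2 uU ud => x h1 h2 [Ax nOm].
rewrite -(h1 Ax) (h2 (conj Ax nOm)) /time_ext ifT//.
have [_ [_ sub]] := tphi.
have [->|p0] := eqVneq (phi (x, t)) 0%R; first by rewrite addr0.
by have [] := sub (x, t) (subset_closure (conj (conj Ax tT) p0)).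
Qed.

Lemma curve_uniform : L2_uniform mu Oms T W.
Proof.
have [K K0 [HK _ _]] := time_ext_lip T0 tphi.
apply: (L2_uniformD dbl oA bA (K := K)) => //.
- by move=> t tT; have [] := C0_square_integrable cU tT.
- by move=> e e0; exact: (C0_uniform mA cU e0).
- by move=> t; exact: (time_ext_slice_measurable oA T0 tphi).
- by move=> x s t Ax; exact: HK.
Qed.

Lemma totvar_curve_measurable : measurable_fun `]0%R, T[ (fun t => totvar mu (W t) Oms).
Proof.
apply: (totvar_measurable_L2 dbl oA bA _ curve_uniform) => t tT.
by have [] := curve_square_integrable tT.
Qed.

Lemma totvar_curve_integrable : leb.-integrable `]0%R, T[ (fun t => totvar mu (W t) Oms).
Proof.
apply/integrableP; split; first exact: totvar_curve_measurable.
under eq_integral do rewrite gee0_abs ?totvar_ge0//.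
by rewrite QE ltry.
Qed.

(** In each cell a time is chosen at which the total variation does not exceed its
    mean over the cell; thus the Riemann sum of the total variation is controlled
    by the integral, although the total variation is only lower semicontinuous in
    time. Choosing within a set of full measure makes the slice of [u] at that
    time satisfy the boundary condition. *)
Lemma sample_exists (N : nat) (dl e : R) : (0 < dl)%R -> (N%:R * dl)%R = T -> (0 < e)%R ->
  exists s : nat -> R, forall j, (j < N)%N ->
    [/\ s j \in `](j%:R * dl)%R, (j.+1%:R * dl)%R[, s j \in `]0%R, T[, good_time (s j) &
      dl%:E * totvar mu (W (s j)) Oms <=
      \int[leb]_(t in `](j%:R * dl)%R, (j.+1%:R * dl)%R[) totvar mu (W t) Oms + e%:E].
Proof.
move=> dl0 TE e0.
suff /choice[s Hs] : forall j, exists s : R, (j < N)%N ->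
    [/\ s \in `](j%:R * dl)%R, (j.+1%:R * dl)%R[, s \in `]0%R, T[, good_time s &
      dl%:E * totvar mu (W s) Oms <=
      \int[leb]_(t in `](j%:R * dl)%R, (j.+1%:R * dl)%R[) totvar mu (W t) Oms + e%:E].
  by exists s.
move=> j; have [jN|] := ltnP j N; last by move=> _; exists 0%R.
have ab : (j%:R * dl < j.+1%:R * dl)%R by rewrite ltr_pM2r// ltr_nat.
have sub t : t \in `](j%:R * dl)%R, (j.+1%:R * dl)%R[ -> t \in `]0%R, T[.
  rewrite !in_itv/= => /andP[t1 t2]; apply/andP; split.
    by apply: le_lt_trans t1; rewrite mulr_ge0// ltW.
  by apply: lt_le_trans t2 _; rewrite -TE ler_pM2r// ler_nat.
have [||s [s1 s2 s3]] := mean_pick (f := fun t => totvar mu (W t) Oms)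
    (P := fun t => (t \in `]0%R, T[) /\ good_time t) ab e0.
- by move=> t _; exact: totvar_ge0.
- by apply: ae_imp ae_good_time => t h tI; split; [exact: sub|exact/h/sub].
exists s => _; have [? ?] := s2; split => //.
have dlE : (j.+1%:R * dl - j%:R * dl = dl)%R by rewrite -natr1 mulrDl mul1r addrAC subrr add0r.
by move: s3; rewrite dlE.
Qed.

Lemma solution_measurable : measurable_fun C u.
Proof.
have [[iu _ _ _] _] := L1u; apply/measurable_EFinP.
exact: (@measurable_int _ (X * measurableTypeR R)%type R (mu \x leb) C _ iu).
Qed.

(** Testing at almost every time replaces [u] by its continuous representative,
    which moves little within a cell. *)
Lemma step_error (N : nat) (dl om : R) (G : nat -> X -> R) (s : nat -> R) :
  (0 < dl)%R -> (N%:R * dl)%R = T -> (0 <= om)%R ->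
  (forall j, square_integrable mu Oms (G j)) ->
  (forall j, (j < N)%N -> G j = W (s j)) ->
  (forall j t, (j < N)%N -> cell dl j t -> t \in `]0%R, T[ ->
    \int[mu]_(x in Oms) ((W t x - W (s j) x) ^+ 2)%:E <= om%:E) ->
  square_integrable (mu \x leb) C (fun z => u z + Phi z - step N dl G z)%R /\
  \int[mu \x leb]_(z in C) ((u z + Phi z - step N dl G z) ^+ 2)%:E <= (T * om)%:E.
Proof.
move=> dl0 TE om0 sG GW Hom.
have sP := time_ext_square_integrable oA Afin T0 tphi.
have sS : square_integrable (mu \x leb) C (step N dl G) by exact: square_integrable_step.
have my : measurable_fun C (fun z => u z + Phi z - step N dl G z)%R.
  apply: measurable_funB; last by have [] := sS.
  by apply: measurable_funD; [exact: solution_measurable|have [] := sP].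
have H : \int[mu \x leb]_(z in C) ((u z + Phi z - step N dl G z) ^+ 2)%:E <= (T * om)%:E.
  rewrite (cyl_tonelli2 sf mA); last 2 first.
  - exact: (@measurable_sqr _ (X * measurableTypeR R)%type R C _ my).
  - by move=> z _; rewrite lee_fin sqr_ge0.
  apply: (@le_trans _ _ (\int[leb]_(t in `]0%R, T[) cst om%:E t)); last first.
    have E := lebesgue_itv_oo (ltW T0).
    rewrite (etrans (integral_cst leb (measurable_itv _) _) (congr1 (fun e => _ * e) E)).
    by rewrite subr0 -EFinM mulrC.
  apply: ae_le_integral_gen; apply: ae_imp ae_good_time => t gt tT.
  have [|k kN kt] := @cell_exists _ N dl dl0 t; first by rewrite TE; move: tT; rewrite /= in_itv.
  apply: le_trans (Hom k t kN kt tT); apply: ae_le_integral_gen.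
  have [uU _] := gt tT; apply: ae_imp uU => x uUx Ax.
  by rewrite (step_cell dl0 _ _ kN kt) (GW _ kN) uUx.
by split=> //; split => //; exact: le_lt_trans H (ltry _).
Qed.

(** The competitor relaxes, with relaxation time [eta], to the piecewise constant
    approximation of [u + phi]. If the time steps are of order [eta ^ 2], and so
    small that the curve moves by at most [eta ^ 2] in squared L^2 norm within a
    step, all errors in [competitor_energy] and [pairing_le] are of order [eta]. *)
Lemma approximate_inequality (eta : R) : (0 < eta)%R -> (eta <= 1)%R ->
  \int[leb]_(t in `]0%R, T[) totvar mu (fun x => u (x, t)) Oms +
  \int[mu \x leb]_(z in C) (u z * D z)%:E <=
  (Q + eta * (fine (totvar mu u0 Oms) + Q + 2 + L ^+ 2 / 2 * fine ((mu \x leb) C) + T))%:E.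
Proof.
move=> eta0 eta1; pose om := (eta ^+ 2)%R.
have om0 : (0 < om)%R by rewrite exprn_gt0.
have [r r0 Hr] := curve_uniform om0.
(* The bound by [r / 2] controls the oscillation in a step; the bound by [om / 2]
   gives [dl / eta <= eta] and [2 * dl <= eta]. *)
pose m := (Num.min (r / 2) (om / 2))%R.
have m0 : (0 < m)%R by rewrite lt_min !divr_gt0.
pose N := (Num.truncn (T / m)).+1; pose dl := (T / N%:R)%R.
have N0 : (0 < N%:R :> R)%R by rewrite ltr0n.
have dl0 : (0 < dl)%R by rewrite divr_gt0.
have TE : (N%:R * dl)%R = T by rewrite /dl mulrC divfK// gt_eqF.
have dlm : (dl <= m)%R.
  by rewrite ler_pdivrMr// mulrC -ler_pdivrMr// ltW// truncnS_gt.
have dlr : (dl < r)%R.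
  apply: (le_lt_trans dlm); apply: (@le_lt_trans _ _ (r / 2)%R); first by rewrite ge_min lexx.
  by rewrite ltr_pdivrMr// ltr_pMr// ltr1n.
have dlom : (2 * dl <= om)%R.
  rewrite mulrC -ler_pdivlMr//; apply: (le_trans dlm); by rewrite ge_min lexx orbT.
have ometa : (om <= eta)%R by rewrite /om expr2 ler_piMr// ltW.
have dlh : (2 * dl <= eta)%R := le_trans dlom ometa.
have [s Hs] := sample_exists dl0 TE (divr_gt0 eta0 N0).
(* Beyond the last step, [u0] and [0] are admissible default values. *)
pose G j := if (j < N)%N then W (s j) else u0.
pose b j := if (j < N)%N then fine (totvar mu (W (s j)) Oms) else 0%R.
have su0 : square_integrable mu Oms u0 by apply/in_L2P.
have sG j : square_integrable mu Oms (G j).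
  rewrite /G; case: ifPn => // jN; have [_ sT _ _] := Hs j jN.
  exact/curve_square_integrable/I0T.
have iW : leb.-integrable `]0%R, (N%:R * dl)%R[ (fun t => totvar mu (W t) Oms).
  by rewrite TE; exact: totvar_curve_integrable.
have part := integral_uniform_partition dl0 iW; rewrite TE in part.
have tvfin j : (j < N)%N -> totvar mu (W (s j)) Oms \is a fin_num.
  move=> jN; have [_ _ _ H] := Hs j jN.
  have I_le : \int[leb]_(t in `](j%:R * dl)%R, (j.+1%:R * dl)%R[) totvar mu (W t) Oms <= Q%:E.
    rewrite -QE part (bigD1 (Ordinal jN))//= leeDl// sume_ge0// => i _.
    by apply: integral_ge0 => t _; exact: totvar_ge0.
  rewrite ge0_fin_numE ?totvar_ge0// ltNge leye_eq; apply/negP => /eqP ty.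
  move: H; rewrite ty gt0_muley ?lte_fin// leye_eq => /eqP H.
  by have := leeD2r (eta / N%:R)%:E I_le; rewrite H -EFinD leye_eq.
have b0 j : (0 <= b j)%R.
  by rewrite /b; case: ifPn => // jN; rewrite fine_ge0// totvar_ge0.
have tvG j : (j < N)%N -> totvar mu (G j) Oms <= (b j)%:E.
  by move=> jN; rewrite /G /b jN fineK// tvfin.
have u0fin : totvar mu u0 Oms \is a fin_num.
  by rewrite ge0_fin_numE ?totvar_ge0//; have [_] := u0BV.
have tv0 : totvar mu u0 Oms <= (fine (totvar mu u0 Oms))%:E by rewrite fineK.
have Gdatum j : (j < N)%N -> \forall x \ae mu, (Oms `\` Om) x -> G j x = u0 x.
  move=> jN; have [_ sT gs _] := Hs j jN; rewrite /G jN.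
  exact: curve_datum.
have sumb : (dl * (\sum_(j < N) b j) <= Q + eta)%R.
  rewrite -lee_fin mulr_sumr -sumEFin EFinD -QE part.
  have -> : eta%:E = \sum_(j < N) (eta / N%:R)%:E.
    by rewrite sumEFin sumr_const card_ord -[(eta / N%:R *+ N)%R]mulr_natr divfK// gt_eqF.
  rewrite -big_split/=; apply: lee_sum => j _; have jN := ltn_ord j.
  have [_ _ _ H] := Hs j jN; apply: le_trans H.
  by rewrite /b jN EFinM fineK ?tvfin.
have GW j : (j < N)%N -> G j = W (s j) by rewrite /G => ->.
have Hom j t : (j < N)%N -> cell dl j t -> t \in `]0%R, T[ ->
    \int[mu]_(x in Oms) ((W t x - W (s j) x) ^+ 2)%:E <= om%:E.
  move=> jN; rewrite cellP => /andP[t1 t2] tT; have [+ sT _ _] := Hs j jN.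
  rewrite in_itv/= -natr1 mulrDl mul1r => /andP[s1 s2].
  apply: Hr; [exact: I0T|exact: I0T|].
  by rewrite ltr_norml; apply/andP; split; lra.
have [sy Hy] := step_error dl0 TE (ltW om0) sG GW Hom.
have sP := time_ext_square_integrable oA Afin T0 tphi.
have sS : square_integrable (mu \x leb) C (step N dl G) by exact: square_integrable_step.
have su : square_integrable (mu \x leb) C u.
  have := @square_integrableB _ (X * measurableTypeR R)%type R (mu \x leb) C mC _ _
    (@square_integrableD _ (X * measurableTypeR R)%type R (mu \x leb) C mC _ _ sy sS) sP.
  by congr square_integrable; apply/funext => z; ring.
pose v := competitor N dl eta u0 G; pose w := competitor_dt N dl eta u0 G.
have sv : square_integrable (mu \x leb) C v by exact: competitor_square_integrable.
have sw : square_integrable (mu \x leb) C w by exact: competitor_dt_square_integrable.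
have sslope j := slope_square_integrable dl eta oA su0 sG j.
have v0 x : v (x, 0%R) = u0 x.
  rewrite /v /competitor /ramp_sum/= big1 ?addr0// => j _.
  by rewrite ramp_before ?mul0r// mulr_ge0// ltW.
have ineq := @var_ineq v w (fun t x => v (x, t))
  (competitor_L1w_BV_datum dbl oA bA T0 dl0 eta0 dlh TE su0 sG b0 tv0 tvG Gdatum)
  _ _ _ _.
have {}ineq : \int[leb]_(t in `]0%R, T[) totvar mu (fun x => u (x, t)) Oms <=
    \int[leb]_(t in `]0%R, T[)
      (\int[mu]_(x in Oms) (w (x, t) * (v (x, t) - u (x, t)))%:E
       + totvar mu (fun x => v (x, t)) Oms).
  (* The competitor starts from [u0], so that the initial term vanishes; the
     term at the final time has the favourable sign. *)
  apply: le_trans (ineq _ _ _ _) _.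
  - exact/in_L2P.
  - exact: ramp_sum_weak_dt.
  - exact: ramp_sum_C0_rep.
  - by apply/in_L2P; exact: competitor_slice.
  rewrite !Lpnorm2_sqr.
  have -> : \int[mu]_(x in Oms) ((v (x, 0%R) - u0 x) ^+ 2)%:E = 0.
    by apply: integral0_eq => x _; rewrite v0 subrr expr0n.
  rewrite mule0 adde0 -[leRHS]adde0; apply: leeD2l.
  by rewrite oppe_le0 mule_ge0// ?lee_fin// ge0_int_sqr.
pose F t := \int[mu]_(x in Oms) (w (x, t) * (v (x, t) - u (x, t)))%:E.
have svu := @square_integrableB _ (X * measurableTypeR R)%type R (mu \x leb) C mC _ _ sv su.
have iwvu := @integrable_mul _ (X * measurableTypeR R)%type R (mu \x leb) C mC _ _ sw svu.
have iF : leb.-integrable `]0%R, T[ F by exact: (cyl_integrable2 sf mA iwvu).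
have energy := competitor_energy dbl oA bA dl0 eta0 dlh TE su0 sG b0 tv0 tvG iF.
have FE : \int[leb]_(t in `]0%R, T[) F t = \int[mu \x leb]_(z in C) (w z * (v z - u z))%:E.
  by rewrite (cyl_fubini2 sf mA).
have pair := pairing_le dbl oA bA T0 dl0 eta0 dlh TE su0 sG tphi mD DL DE su.
have sD := bounded_square_integrable dbl oA bA mD DL.
have iuD := @integrable_mul _ (X * measurableTypeR R)%type R (mu \x leb) C mC _ _ su sD.
have ei0 : 0 <= (eta^-1)%:E :> \bar R by rewrite lee_fin invr_ge0 ltW.
have {}pair := le_trans pair (leeD2l _ (lee_wpmul2l ei0 Hy)).
have {}ineq := le_trans ineq energy; rewrite FE in ineq.
have [x xE] : exists x : R, \int[mu \x leb]_(z in C) (w z * (v z - u z))%:E = x%:E.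
  exists (fine (\int[mu \x leb]_(z in C) (w z * (v z - u z))%:E)); rewrite fineK//.
  exact: (@integrable_fin_num _ (X * measurableTypeR R)%type R (mu \x leb) C mC _ iwvu).
have [i iE] : exists i : R, \int[mu \x leb]_(z in C) (u z * D z)%:E = i%:E.
  exists (fine (\int[mu \x leb]_(z in C) (u z * D z)%:E)); rewrite fineK//.
  exact: (@integrable_fin_num _ (X * measurableTypeR R)%type R (mu \x leb) C mC _ iuD).
have [c cE] : exists c : R, (mu \x leb) C = c%:E.
  by exists (fine ((mu \x leb) C)); rewrite fineK// ge0_fin_numE.
move: ineq pair; rewrite -/v -/w xE iE cE => ineq pair.
apply: (le_trans (leeD2r i%:E ineq)); move: pair.
have Q0 : (0 <= Q)%R.
  by rewrite -lee_fin -QE; apply: integral_ge0 => t _; exact: totvar_ge0.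
rewrite -!EFinM -!EFinD !lee_fin => pair.
rewrite addrAC; apply: (le_trans (lerD pair (lexx _))).
move: sumb; set a0 := fine (totvar mu u0 Oms); set S := (dl * _)%R => sumb.
have dleta : (dl / eta <= eta)%R.
  by rewrite ler_pdivrMr// -expr2; apply: le_trans dlom; rewrite ler_peMl ?ler1n// ltW.
have dle0 : (0 <= dl / eta)%R by rewrite divr_ge0 ?ltW.
have S0 : (0 <= S)%R by rewrite mulr_ge0 ?(ltW dl0)// sumr_ge0.
have h1 : ((1 + dl / eta) * S <= (1 + eta) * (Q + eta))%R.
  by apply: ler_pM => //; [rewrite addr_ge0|rewrite lerD2l].
have h2 : ((1 + eta) * (Q + eta) <= Q + eta * Q + 2 * eta)%R.
  have -> : ((1 + eta) * (Q + eta) = Q + eta * Q + (eta + eta * eta))%R by ring.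
  by rewrite lerD2l mulr_natl mulr2n lerD2l ler_piMr// ltW.
have -> : (eta^-1 * (T * om) = eta * T)%R by rewrite /om; field; rewrite gt_eqF.
have h3 := le_trans h1 h2.
apply: (@le_trans _ _ (eta / 2 * L ^+ 2 * c + eta * T + (eta * a0 + (Q + eta * Q + 2 * eta))))%R.
  by rewrite !lerD2l.
by rewrite le_eqVlt; apply/orP; left; apply/eqP; rewrite /fine; field.
Qed.


End approximation.

Lemma le_small_error {R : realType} (p : \bar R) (q k : R) :
  (forall eta : R, (0 < eta)%R -> (eta <= 1)%R -> p <= (q + eta * k)%:E) -> p <= q%:E.
Proof.
move=> H; apply/lee_addgt0Pr => e e0.
have k0 : (0 < `|k| + 1)%R by rewrite ltr_wpDl.
pose eta := (Num.min 1 (e / (`|k| + 1)))%R.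
have eta0 : (0 < eta)%R by rewrite lt_min ltr01 divr_gt0.
have eta1 : (eta <= 1)%R by rewrite ge_min lexx.
apply: (le_trans (H eta eta0 eta1)); rewrite -EFinD lee_fin lerD2l.
apply: (@le_trans _ _ (eta * (`|k| + 1))%R).
  by rewrite ler_pM2l// (le_trans (ler_norm k))// lerDl.
by rewrite -ler_pdivlMr// ge_min lexx orbT.
Qed.

Lemma minimality {d} {R : realType} {X : completeBorelMetricType d R}
    (mu : {measure set X -> \bar R}) (Om Oms : set X) (u0 : X -> R) (u : X * R -> R) (T : R)
    (phi : X * R -> R) :
  doubling mu -> open Oms -> metric_bounded Oms ->
  in_Lp mu 2%:E Oms u0 -> BV mu Oms u0 -> (0 < T)%R ->
  variational_solution mu Om Oms u0 T u -> lip_test Oms Om T phi ->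
  \int[@lebesgue_measure R]_(t in `]0%R, T[)
    (\int[mu]_(x in Oms) (u (x, t) * dt phi x t)%:E
     + totvar mu (fun x => u (x, t)) Oms) <=
  \int[@lebesgue_measure R]_(t in `]0%R, T[) totvar mu (fun x => (u \+ phi)%R (x, t)) Oms.
Proof.
move=> dbl oA bA u0L2 u0BV T0 [L1u [U cU var_ineq]] tphi.
set leb := @lebesgue_measure R.
have mA : measurable Oms by exact: open_measurableX.
have sf := doubling_sigma_finite dbl.
have Afin : mu Oms < +oo by exact: bounded_measure_lty.
have [D [L [L0 mD DL DE dtD]]] := test_dt_repr sf oA T0 tphi.
pose W t x := (U t x + time_ext T phi (x, t))%R.
have good := ae_good_time L1u cU.
have QE : \int[leb]_(t in `]0%R, T[) totvar mu (fun x => (u \+ phi)%R (x, t)) Oms =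
    \int[leb]_(t in `]0%R, T[) totvar mu (W t) Oms.
  apply: ae_eq_integral_gen; apply: ae_imp good => t gt tT.
  apply: totvar_ae_eq; have [uU _] := gt tT; apply: ae_imp uU => x uUx Ax.
  by rewrite /W /time_ext/= ifT// uUx.
rewrite QE.
have fin_or_top (x : \bar R) : 0 <= x -> x = +oo \/ exists r : R, x = r%:E.
  by case: x => [r _|_|//]; [right; exists r|left].
have [->|[Q {}QE]] : \int[leb]_(t in `]0%R, T[) totvar mu (W t) Oms = +oo \/
    exists Q : R, \int[leb]_(t in `]0%R, T[) totvar mu (W t) Oms = Q%:E.
- by apply: fin_or_top; apply: integral_ge0 => t _; exact: totvar_ge0.
- exact: leey.
rewrite QE.
have approx := approximate_inequality dbl oA bA u0L2 u0BV T0 tphi L1u cU var_ineq mD DL DE QE.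
have [L1bv _] := L1u; have [iu _ _ tvu] := L1bv.
have mC := cyl_measurable T mA.
have iuD : (mu \x leb).-integrable (cylinder Oms T) (fun z => (u z * D z)%:E).
  have iLu := @integrableZl _ (X * measurableTypeR R)%type R (mu \x leb) _ mC L _ iu.
  apply: (@le_integrable _ (X * measurableTypeR R)%type R (mu \x leb) _ mC _ _ _ _ iLu).
    apply/measurable_EFinP; apply: measurable_funM => //.
    exact: (solution_measurable L1u).
  move=> z Cz; rewrite /= lee_fin !normrM mulrC; apply: ler_wpM2r => //.
  by rewrite (ger0_norm L0); exact: DL.
pose F t := \int[mu]_(x in Oms) (u (x, t) * D (x, t))%:E.
have iF : leb.-integrable `]0%R, T[ F by exact: (cyl_integrable2 sf mA iuD).
have FE : \int[mu \x leb]_(z in cylinder Oms T) (u z * D z)%:E = \int[leb]_(t in `]0%R, T[) F t.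
  exact: (cyl_fubini2 sf mA iuD).
have tvE : \forall t \ae leb, t \in `]0%R, T[ ->
    totvar mu (fun x => u (x, t)) Oms = totvar mu (U t) Oms.
  apply: ae_imp good => t gt tT; apply: totvar_ae_eq.
  by have [uU _] := gt tT.
have PE : \int[leb]_(t in `]0%R, T[) totvar mu (fun x => u (x, t)) Oms =
    \int[leb]_(t in `]0%R, T[) totvar mu (U t) Oms.
  exact: ae_eq_integral_gen.
have iU : leb.-integrable `]0%R, T[ (fun t => totvar mu (U t) Oms).
  apply/integrableP; split.
    apply: (totvar_measurable_L2 dbl oA bA) => [t tT|e e0].
      by have [] := C0_square_integrable cU tT.
    exact: (C0_uniform mA cU e0).
  apply: le_lt_trans tvu; rewrite PE; apply: le_integral_gen => t _.
  by rewrite gee0_abs; [exact: lexx|exact: totvar_ge0].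
have -> : \int[leb]_(t in `]0%R, T[) (\int[mu]_(x in Oms) (u (x, t) * dt phi x t)%:E
     + totvar mu (fun x => u (x, t)) Oms) =
    \int[leb]_(t in `]0%R, T[) (F t + totvar mu (U t) Oms).
  apply: ae_eq_integral_gen; apply: ae_imp2 tvE (cyl_ae_slice sf dtD) => t tvt dt_t tT.
  rewrite (tvt tT); congr (_ + _); apply: ae_eq_integral_gen.
  by apply: ae_imp (dt_t tT) => x dx Ax; rewrite -(dx Ax).
rewrite (@integralD _ (measurableTypeR R) R leb _ (measurable_itv _) _ _ iF iU) -FE -PE addeC.
exact: (le_small_error approx).
Qed.

Theorem proposition6p2 (d : measure_display) (R : realType)
    (X : completeBorelMetricType d R) (mu : {measure set X -> \bar R})
    (Om Oms : set X) (u0 : X -> R) (u : (X * R)%type -> R) :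
  separable_space X ->
  connected [set: X] ->
  doubling mu ->
  poincare11 mu ->
  open Om -> metric_bounded Om ->
  open Oms -> metric_bounded Oms ->
  compactly_contained Om Oms ->
  in_Lp mu 2%:E Oms u0 ->
  BV mu Oms u0 ->
  global_variational_solution mu Om Oms u0 u ->
  parabolic_minimizer mu Om Oms u0 u.
Proof.
move=> _ _ dbl _ _ _ oA bA _ u0L2 u0BV sol T T0.
have solT := sol T T0; have [L1u _] := solT; have [[_ _ _ tvu] _] := L1u.
by split => // phi tphi; exact: minimality solT tphi.
Qed.
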